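(* Let $\mathbb{S}^2$ be the unit sphere, let $p_1,\dots,p_k,q_1,\dots,q_k\in\mathbb{S}^2$ and let $r_1,\dots,r_k>0$. Assume that $d(q_i,q_j)\le d(p_i,p_j)$ for all $i,j\in\{1,\dots,k\}$. (i) If $r_i\ge \pi/2$ for all $i$, then $\mathrm{Area}\big(\bigcup_{i=1}^k B_{q_i}(r_i)\big)\le \mathrm{Area}\big(\bigcup_{i=1}^k B_{p_i}(r_i)\big)$. (ii) If $r_i\le \pi/2$ for all $i$, then $\mathrm{Area}\big(\bigcap_{i=1}^k B_{q_i}(r_i)\big)\ge \mathrm{Area}\big(\bigcap_{i=1}^k B_{p_i}(r_i)\big)$.
   Context: The unit sphere $\mathbb{S}^2$ carries its intrinsic (geodesic) distance $d$. For $p\in\mathbb{S}^2$ and $r>0$, $B_p(r)=\{x\in \mathbb{S}^2: d(p,x)\le r\}$ is the closed disk of radius $r$ centered at $p$. *)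

(* Defs.v *)
From mathcomp Require Import all_boot all_order all_algebra.
From mathcomp Require Import all_classical all_reals all_analysis.
From mathcomp Require Import ring.

Set Implicit Arguments.
Unset Strict Implicit.
Unset Printing Implicit Defensive.

Import Order.TTheory GRing.Theory Num.Theory.
Import numFieldNormedType.Exports.

Local Open Scope classical_set_scope.
Local Open Scope ring_scope.

(* The library norm on row vectors is the max norm, hence an explicit
   Euclidean scalar product. *)
Definition dotv (R : realType) (u v : 'rV[R]_3) : R :=
  \sum_(i < 3) u 0 i * v 0 i.

Definition sphere2 (R : realType) := {x : 'rV[R]_3 | dotv x x == 1}.

(* Length of the shorter great-circle arc, i.e. the angle between x and y. *)
Definition gdist (R : realType) (x y : sphere2 R) : R :=
  acos (dotv (val x) (val y)).

Definition gball (R : realType) (p : sphere2 R) (r : R) : set (sphere2 R) :=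
  [set x | gdist p x <= r].

Definition sph_vec (R : realType) (theta phi : R) : 'rV[R]_3 :=
  \row_(i < 3)
    [:: sin theta * cos phi; sin theta * sin phi; cos theta]`_i.

Lemma sph_vec_unit (R : realType) (theta phi : R) :
  dotv (sph_vec theta phi) (sph_vec theta phi) == 1.
Proof.
apply/eqP; rewrite /dotv !big_ord_recl big_ord0 !mxE /=.
have -> : sin theta * cos phi * (sin theta * cos phi) +
    (sin theta * sin phi * (sin theta * sin phi) +
     (cos theta * cos theta + 0)) =
    cos theta ^+ 2 + sin theta ^+ 2 * (cos phi ^+ 2 + sin phi ^+ 2) by ring.
by rewrite cos2Dsin2 mulr1 cos2Dsin2.
Qed.

Definition sph_point (R : realType) (theta phi : R) : sphere2 R :=
  exist _ (sph_vec theta phi) (sph_vec_unit theta phi).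

(* Surface integral in spherical coordinates (polar angle in [0, pi], azimuth
   in [0, 2 pi]): sin theta is the area element, the Euclidean norm of the
   cross product of the two partial derivatives of sph_vec. *)
Definition area (R : realType) (A : set (sphere2 R)) : \bar R :=
  \int[(@lebesgue_measure R \x @lebesgue_measure R)%E]_(z in
      `[0%R, pi] `*` `[0%R, pi *+ 2])
    (\1_A (sph_point z.1 z.2) * sin z.1)%:E.

(* Main.v *)
Require Import Defs.
From mathcomp Require Import all_boot all_order all_algebra.
From mathcomp Require Import all_classical all_reals all_analysis.
From mathcomp Require Import measurable_realfun.
From mathcomp Require Import ring lra zify.

Set Implicit Arguments.
Unset Strict Implicit.
Unset Printing Implicit Defensive.

Import Order.TTheory GRing.Theory Num.Theory.
Import numFieldNormedType.Exports.
Local Open Scope classical_set_scope.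
Local Open Scope ring_scope.

(** By complementation (antipodal centres, complementary radii, null circles)
    part (i) reduces to part (ii), and (ii) is proved for intersections of
    caps [c_i <= <x, p_i>] with [0 <= c_i].  Two caps: moving one of them towards
    the other increases the area of the intersection, by the reflection that
    exchanges the old and the new position.  In general, if the caps have a common
    interior point, stereographic projection from its antipode turns them into
    disks of the plane, and every finite family of disks with a common interior
    point reduces to pairs by two steps.  Adding a disk m that contains the
    intersection changes nothing for the p_i, and Kirszbraun's theorem provides
    a cap on the side of the q_i which keeps the hypothesis.  If each
    point of m lies in every disk of F1 or in every disk of F2, then inclusion-exclusion
    reduces m, F1, F2 to m, F1 and m, F2: the union of the two intersections is the
    cap m for the p_i and is contained in the cap m for the q_i, which has the same
    area.  To find m, take a disk which contains the intersection and is as small as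
    possible in the sense of its power at some interior point; its contact points with
    the intersection cut it into pieces that the other disks cover one at
    a time.  If no such disk is lower than the given ones, m is one of the given disks or
    a disk of the pencil spanned by two of them. *)

(** * Disks of the plane *)

(** The condition [0 <= c_i] puts the antipode of a common interior point outside every cap, so that
    projecting from it gives honest disks. The same interior point has positive products with all
    centres [p_i], which is the half-space condition in Kirszbraun's theorem: it keeps the convex
    combinations of the centres away from 0. Caps without a common interior point meet in a null
    set.

    The decomposition looks only at the disks of the [p_i]; the [q_i] enter when the resulting tree
    is traversed. It terminates because an auxiliary disk m comes with cuts whose final parts each
    omit at least two disks of the family, so that m together with a part is a smaller family.

    The area is an integral in spherical coordinates, in which only reflections in planes through
    the polar axis are visible. Exchanging two coordinate axes supplies the other ones, and is
    proved by projecting the sphere onto the plane of these axes. Changes of variables are made for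
    continuous integrands; caps are reached by monotone limits. *)

(* Disks of the plane are coded by [a], the disk D_a being [0 <= pw a x]; up to
   sign [pw a x] is the power of the point [x] with respect to its boundary circle. *)
Definition pw (R : realType) (a : R * R * R) (x : R * R) : R :=
  a.1.1 * x.1 + a.1.2 * x.2 + a.2 - (x.1 ^+ 2 + x.2 ^+ 2).

Definition inK (R : realType) (L : seq (R * R * R)) (x : R * R) : Prop :=
  forall a, a \in L -> 0 <= pw a x.

Definition intK (R : realType) (L : seq (R * R * R)) (x : R * R) : Prop :=
  forall a, a \in L -> 0 < pw a x.

Definition lerp (R : realType) (t : R) (x y : R * R) : R * R :=
  ((1 - t) * x.1 + t * y.1, (1 - t) * x.2 + t * y.2).

Definition dist2 (R : realType) (x y : R * R) : R :=
  (x.1 - y.1) ^+ 2 + (x.2 - y.2) ^+ 2.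

(** Twice the signed area of the triangle [v w x]; the sign tells on which side of the line [vw] the
    point [x] lies. *)
Definition side (R : realType) (v w x : R * R) : R :=
  (w.1 - v.1) * (x.2 - v.2) - (w.2 - v.2) * (x.1 - v.1).

(** All [pw a] share the quadratic part, minus the squared norm. Hence each is strictly concave
    along segments, with a defect that does not depend on [a], and the difference of two of them is
    affine. *)
Lemma pw_lerp (R : realType) a t (x y : R * R) :
  pw a (lerp t x y) = (1 - t) * pw a x + t * pw a y + t * (1 - t) * dist2 x y.
Proof. by rewrite /pw /lerp /dist2 /=; ring. Qed.

Lemma pwB_lerp (R : realType) a b t (x y : R * R) :
  pw a (lerp t x y) - pw b (lerp t x y) =
  (1 - t) * (pw a x - pw b x) + t * (pw a y - pw b y).
Proof. by rewrite /pw /lerp /=; ring. Qed.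

Lemma side_lerp (R : realType) (v w : R * R) t (x y : R * R) :
  side v w (lerp t x y) = (1 - t) * side v w x + t * side v w y.
Proof. by rewrite /side /lerp /=; ring. Qed.

Lemma sideC (R : realType) (v w x : R * R) : side w v x = - side v w x.
Proof. by rewrite /side; ring. Qed.

Lemma side_rot (R : realType) (v w x : R * R) : side w x v = side v w x.
Proof. by rewrite /side; ring. Qed.

Lemma side_l (R : realType) (v w : R * R) : side v w v = 0.
Proof. by rewrite /side; ring. Qed.

Lemma side_r (R : realType) (v w : R * R) : side v w w = 0.
Proof. by rewrite /side; ring. Qed.

Lemma dist2_ge0 (R : realType) (x y : R * R) : 0 <= dist2 x y.
Proof. by rewrite addr_ge0 ?sqr_ge0. Qed.

Lemma dist2_gt0 (R : realType) (x y : R * R) : x <> y -> 0 < dist2 x y.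
Proof.
move=> xy; rewrite lt_neqAle dist2_ge0 andbT eq_sym paddr_eq0 ?sqr_ge0//.
rewrite !sqrf_eq0 !subr_eq0; apply/negP => /andP[/eqP e1 /eqP e2].
by apply: xy; rewrite (surjective_pairing x) (surjective_pairing y) e1 e2.
Qed.

Lemma intK_inK (R : realType) (L : seq (R * R * R)) x : intK L x -> inK L x.
Proof. by move=> h a /h /ltW. Qed.

Lemma exists_common_radius (R : realType) (T : eqType) (L : seq T)
    (P : T -> R -> Prop) :
  (forall a, a \in L -> exists2 d : R, 0 < d & forall t, 0 < t < d -> P a t) ->
  exists2 d : R, 0 < d & forall t, 0 < t < d -> forall a, a \in L -> P a t.
Proof.
elim: L => [|a L IH] H; first by exists 1.
have [|d d0 hd] := IH; first by move=> b bL; apply: H; rewrite in_cons bL orbT.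
have [|e e0 he] := H a; first by rewrite mem_head.
exists (Num.min d e); first by rewrite lt_min d0.
move=> t; rewrite lt_min => /and3P[t0 td te] b; rewrite in_cons.
by move=> /predU1P[->|bL]; [apply: he; rewrite t0|apply: hd; rewrite ?t0].
Qed.

Lemma intK_square (R : realType) (L : seq (R * R * R)) (x : R * R) :
  intK L x -> exists2 d : R, 0 < d &
    forall h k : R, `|h| <= d -> `|k| <= d -> intK L (x.1 + h, x.2 + k).
Proof.
move=> xL.
have [|d d0 hd] := @exists_common_radius R _ L (fun a d => forall h k : R,
    `|h| <= d -> `|k| <= d -> 0 < pw a (x.1 + h, x.2 + k)).
  move=> a /xL ax.
  (* [(A, B)] is the gradient of [pw a] at [x]. *)
  set A := a.1.1 - 2 * x.1; set B := a.1.2 - 2 * x.2.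
  have AB0 : 0 < `|A| + `|B| + 3 by have := normr_ge0 A; have := normr_ge0 B; lra.
  exists (Num.min 1 (pw a x / (`|A| + `|B| + 3))); first by rewrite lt_min ltr01 divr_gt0.
  move=> t; rewrite lt_min => /and3P[t0 t1]; rewrite ltr_pdivlMr// => tax h k ht kt.
  have -> : pw a (x.1 + h, x.2 + k) = pw a x + A * h + B * k - h ^+ 2 - k ^+ 2.
    by rewrite /pw /A /B /=; ring.
  have hA : - (`|A| * t) <= A * h.
    rewrite lerNl (le_trans (ler_norm _))// normrN normrM.
    by apply: ler_wpM2l.
  have hB : - (`|B| * t) <= B * k.
    rewrite lerNl (le_trans (ler_norm _))// normrN normrM.
    by apply: ler_wpM2l.
  have h2 : h ^+ 2 <= t.
    rewrite -real_normK ?num_real//; apply: (@le_trans _ _ (t * t)); last by nra.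
    by rewrite expr2 ler_pM.
  have k2 : k ^+ 2 <= t.
    rewrite -real_normK ?num_real//; apply: (@le_trans _ _ (t * t)); last by nra.
    by rewrite expr2 ler_pM.
  by move: tax; rewrite !mulrDr (mulrC t `|A|) (mulrC t `|B|); lra.
exists (d / 2) => [|h k hh kk a aL]; first by rewrite divr_gt0.
by apply: (hd (d / 2)) => //; apply/andP; split; lra.
Qed.

(** Two points of the intersection at distance [d] on either side of [x] lie in D_m; by strict
    concavity [pw m] is positive at their midpoint [x]. *)
Lemma intK_lt (R : realType) (L : seq (R * R * R)) m (x : R * R) :
  intK L x -> (forall y, inK L y -> 0 <= pw m y) -> 0 < pw m x.
Proof.
move=> /intK_square[d d0 hd] Km.
have n0 : `|0 : R| <= d by rewrite normr0 ltW.
have nd : `|d| <= d by rewrite ger0_norm// ltW.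
have nNd : `|- d| <= d by rewrite normrN.
have := Km _ (intK_inK (hd _ _ nd n0)); have := Km _ (intK_inK (hd _ _ nNd n0)).
have : 0 < d * d by rewrite mulr_gt0.
by rewrite /pw /=; nra.
Qed.

(** At the point of parameter [t] on the line [vw], [pw m] equals [t (1 - t)] times the squared
    length of the chord, so it is nonnegative only between [v] and [w]. *)
Lemma on_chord (R : realType) m (v w o : R * R) :
  v <> w -> pw m v = 0 -> pw m w = 0 -> side v w o = 0 -> 0 <= pw m o ->
  exists2 t : R, 0 <= t <= 1 & o = lerp t v w.
Proof.
move=> vw mv mw so mo; have d0 := dist2_gt0 vw.
pose t := ((w.1 - v.1) * (o.1 - v.1) + (w.2 - v.2) * (o.2 - v.2)) / dist2 v w.
have ot : o = lerp t v w.
  rewrite (surjective_pairing o) /lerp; congr pair; apply: (mulfI (lt0r_neq0 d0)).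
  - have -> : dist2 v w * ((1 - t) * v.1 + t * w.1) =
        dist2 v w * v.1 + (t * dist2 v w) * (w.1 - v.1) by ring.
    rewrite /t divfK ?lt0r_neq0//.
    apply/eqP; rewrite -subr_eq0; apply/eqP.
    transitivity (- (w.2 - v.2) * side v w o); last by rewrite so mulr0.
    by rewrite /side /dist2; ring.
  - have -> : dist2 v w * ((1 - t) * v.2 + t * w.2) =
        dist2 v w * v.2 + (t * dist2 v w) * (w.2 - v.2) by ring.
    rewrite /t divfK ?lt0r_neq0//.
    apply/eqP; rewrite -subr_eq0; apply/eqP.
    transitivity ((w.1 - v.1) * side v w o); last by rewrite so mulr0.
    by rewrite /side /dist2; ring.
exists t => //; move: mo; rewrite {1}ot pw_lerp mv mw !mulr0 !add0r pmulr_lge0//.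
move=> h; have := sqr_ge0 t; have := sqr_ge0 (1 - t).
by rewrite !expr2 => h1 h2; apply/andP; split; lra.
Qed.

Lemma chord_inside (R : realType) m a (v w o : R * R) :
  v <> w -> pw m v = 0 -> pw m w = 0 -> 0 <= pw a v -> 0 <= pw a w ->
  side v w o = 0 -> 0 <= pw m o -> pw m o <= pw a o.
Proof.
move=> vw mv mw av aw so mo; have [t t01 ot] := on_chord vw mv mw so mo.
by have := pwB_lerp m a t v w; rewrite -ot mv mw; nra.
Qed.

(* [pw m - pw a] is affine, positive on D_m \ D_a and nonpositive on the chord. *)
Lemma chord_one_side (R : realType) m a (v w x y : R * R) :
  v <> w -> pw m v = 0 -> pw m w = 0 -> 0 <= pw a v -> 0 <= pw a w ->
  0 <= pw m x -> pw a x < 0 -> 0 <= pw m y -> pw a y < 0 ->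
  0 <= side v w x -> 0 < side v w y.
Proof.
move=> vw mv mw av aw mx ax my ay sx; rewrite ltNge; apply/negP => sy.
have key o : side v w o = 0 -> 0 <= pw m o -> pw m o <= pw a o.
  exact: chord_inside.
have [sxy|sxy] := eqVneq (side v w x) (side v w y).
  by have := key x; rewrite (_ : side v w x = 0); lra.
have d0 : 0 < side v w x - side v w y.
  by rewrite lt_neqAle eq_sym subr_eq0 sxy/=; lra.
pose t := side v w x / (side v w x - side v w y).
have tE : t * (side v w x - side v w y) = side v w x.
  by rewrite /t divfK// lt0r_neq0.
have t0 : 0 <= t by rewrite divr_ge0// ltW.
have t1 : t <= 1 by rewrite ler_pdivrMr//; lra.
have mo : 0 <= pw m (lerp t x y).
  rewrite pw_lerp; have := dist2_ge0 x y => ?.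
    by do !apply: addr_ge0 => //; do ?[apply: mulr_ge0 => //]; lra.
have so : side v w (lerp t x y) = 0.
  by rewrite side_lerp; clearbody t; lra.
have := key _ so mo; have := pwB_lerp m a t x y; clearbody t.
have : 0 <= t * (pw m y - pw a y) by rewrite mulr_ge0//; lra.
have : 0 <= (1 - t) * (pw m x - pw a x) by rewrite mulr_ge0//; lra.
have [t12|t12] := lerP t (1 / 2).
  have : 0 < (1 - t) * (pw m x - pw a x) by rewrite mulr_gt0//; lra.
  lra.
have : 0 < t * (pw m y - pw a y) by rewrite mulr_gt0//; lra.
lra.
Qed.

(** The first nonzero coefficient decides the sign just to the right of 0; the third case is the
    zero polynomial. *)
Lemma quadratic_near0 (R : realType) (c0 c1 c2 : R) :
  [\/ 0 <= c0 /\ exists2 d : R, 0 < d &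
        forall t : R, 0 < t < d -> 0 < c0 + c1 * t + c2 * t ^+ 2,
      c0 <= 0 /\ exists2 d : R, 0 < d &
        forall t : R, 0 < t < d -> c0 + c1 * t + c2 * t ^+ 2 < 0 |
      [/\ c0 = 0, c1 = 0 & c2 = 0]].
Proof.
have pos (b0 b1 b2 : R) : 0 < b0 -> exists2 d : R, 0 < d &
    forall t : R, 0 < t < d -> 0 < b0 + b1 * t + b2 * t ^+ 2.
  move=> b00; have n1 := normr_ge0 b1; have n2 := normr_ge0 b2.
  exists (Num.min 1 (b0 / (`|b1| + `|b2| + 1))).
    by rewrite lt_min ltr01 divr_gt0//; lra.
  move=> t; rewrite lt_min => /and3P[t0 t1]; rewrite ltr_pdivlMr => [tb|]; last by lra.
  have h1 : - (`|b1| * t) <= b1 * t.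
    by rewrite lerNl (le_trans (ler_norm _))// normrN normrM (gtr0_norm t0).
  have h2 : - (`|b2| * t) <= b2 * t ^+ 2.
    rewrite lerNl (le_trans (ler_norm _))// normrN normrM.
    rewrite (ger0_norm (sqr_ge0 t)) ler_wpM2l// expr2.
    by rewrite ger_pMl// ltW.
  by move: tb; rewrite !mulrDr mulr1 (mulrC t) (mulrC t `|b2|); lra.
have [c0p|c0n|c00] := ltrgtP c0 0.
- constructor 2; have [|d d0 hd] := pos (- c0) (- c1) (- c2); first by lra.
  split; first by lra.
  by exists d => // t /hd; lra.
- by constructor 1; split; [lra|exact: pos].
have [c1p|c1n|c10] := ltrgtP c1 0.
- constructor 2; have [|d d0 hd] := pos (- c1) (- c2) 0; first by lra.
  split => //.
  exists d => // t /[dup] /andP[t0 _] /hd h; rewrite c00.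
  rewrite (_ : _ + _ = - (t * (- c1 + - c2 * t + 0 * t ^+ 2))); last by ring.
  by rewrite oppr_lt0 mulr_gt0.
- constructor 1; have [|d d0 hd] := pos c1 c2 0; first by lra.
  split => //.
  exists d => // t /[dup] /andP[t0 _] /hd h; rewrite c00.
  rewrite (_ : _ + _ = t * (c1 + c2 * t + 0 * t ^+ 2)); last by ring.
  by rewrite mulr_gt0.
have [c2p|c2n|c20] := ltrgtP c2 0.
- constructor 2; split => //.
  exists 1 => // t /andP[t0 _]; rewrite c00 c10.
  by rewrite mul0r !add0r nmulr_rlt0// exprn_gt0.
- constructor 1; split => //.
  exists 1 => // t /andP[t0 _]; rewrite c00 c10.
  by rewrite mul0r !add0r mulr_gt0// exprn_gt0.
by constructor 3.
Qed.

(* Otherwise a point of the boundary circle of D_m close to [v] would lie in the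
   interior of every disk of [L], hence in the interior of D_m. *)
Lemma touching_disk (R : realType) (L : seq (R * R * R)) m (e : R) (v w : R * R) :
  (forall x, inK L x -> 0 <= pw m x) -> m \notin L -> e ^+ 2 = 1 ->
  v <> w -> pw m v = 0 -> pw m w = 0 -> inK L v ->
  exists a, [/\ a \in L, pw a v = 0 &
    exists x, [/\ 0 <= pw m x, pw a x < 0 & 0 < e * side v w x]].
Proof.
move=> Km mL e1 vw mv mw vL; apply: contrapT => H.
have {}H a x : a \in L -> pw a v = 0 -> 0 <= pw m x -> 0 < e * side v w x ->
    0 <= pw a x.
  move=> aL av mx sx; rewrite leNgt; apply/negP => ax; apply: H.
  by exists a; split => //; exists x.
have D0 := dist2_gt0 vw; set D := dist2 v w in D0.
(* [d] is [w - v] turned by a quarter, towards the side [e]. The line from [w] through [g t] makes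
   an angle of tangent [t] with [wv], and [z t] is its second point on the circle of D_m: a rational
   parametrisation near [v], for which [(1 + t ^+ 2) * pw a (z t)] is a quadratic polynomial in
   [t]. *)
pose d : R * R := (- e * (w.2 - v.2), e * (w.1 - v.1)).
pose mu := ((m.1.1 - 2 * v.1) * d.1 + (m.1.2 - 2 * v.2) * d.2) / D.
have muD : mu * D = (m.1.1 - 2 * v.1) * d.1 + (m.1.2 - 2 * v.2) * d.2.
  by rewrite /mu divfK// lt0r_neq0.
clearbody mu.
pose g t : R * R := (v.1 + t * d.1, v.2 + t * d.2).
pose s t : R := (1 + t * mu) / (1 + t ^+ 2).
pose z t := lerp (s t) w (g t).
have tt0 (t : R) : 0 < 1 + t ^+ 2 by have := sqr_ge0 t; lra.
have sE t : s t * (1 + t ^+ 2) = 1 + t * mu by rewrite /s divfK// lt0r_neq0.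
have dg t : dist2 w (g t) = D * (1 + t ^+ 2).
  transitivity (D + t ^+ 2 * e ^+ 2 * D); last by rewrite e1; ring.
  by rewrite /D /dist2 /g /d /=; ring.
have mg t : pw m (g t) = t * mu * D - t ^+ 2 * D.
  transitivity (pw m v + t * (mu * D) - t ^+ 2 * e ^+ 2 * D).
    by rewrite muD /D /dist2 /pw /g /d /=; ring.
  by rewrite mv e1; ring.
have mz t : pw m (z t) = 0.
  rewrite /z pw_lerp mw dg mg.
  transitivity (s t * D * (1 + t * mu - s t * (1 + t ^+ 2))); first by ring.
  by rewrite sE subrr mulr0.
have sz t : e * side v w (z t) = s t * t * D.
  rewrite /z side_lerp side_r mulr0 add0r.
  transitivity (s t * t * e ^+ 2 * D); last by rewrite e1; ring.
  by rewrite /D /dist2 /g /d /side /=; ring.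
have [|r r0 hr] := @exists_common_radius R _ L (fun a t => 0 < s t /\ 0 < pw a (z t)).
  move=> a aL; pose psi x := pw a x - pw m x.
  pose pd := (a.1.1 - m.1.1) * d.1 + (a.1.2 - m.1.2) * d.2.
  have zE t : (1 + t ^+ 2) * pw a (z t) =
      pw a v + (pd + mu * (psi v - psi w)) * t + (psi w + mu * pd) * t ^+ 2.
    have -> : pw a (z t) = (1 - s t) * psi w + s t * (psi v + t * pd).
      have := pwB_lerp a m (s t) w (g t); rewrite -/(z t) mz subr0 => ->.
      by rewrite /psi /pd /pw /g /=; ring.
    transitivity ((1 + t ^+ 2) * psi w - s t * (1 + t ^+ 2) * psi w
       + s t * (1 + t ^+ 2) * (psi v + t * pd)); first by ring.
    by rewrite sE /psi mv mw; ring.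
  have [r1 r10 hr1] : exists2 r : R, 0 < r & forall t, 0 < t < r -> 0 < s t.
    have [[_ [r r0 hr]]|[]|[/eqP]] := quadratic_near0 1 mu 0.
    - exists r => // t /hr; rewrite mul0r addr0 mulrC => h.
      by rewrite divr_gt0// mulrC.
    - by rewrite ler10.
    - by rewrite oner_eq0.
  have [[_ [r2 r20 hr2]]|[av0 [r2 r20 hr2]]|[c0 c1 c2]] := quadratic_near0 (pw a v)
      (pd + mu * (psi v - psi w)) (psi w + mu * pd).
  - exists (Num.min r1 r2); first by rewrite lt_min r10.
    move=> t; rewrite lt_min => /and3P[t0 t1 t2]; split.
      by apply: hr1; rewrite t0.
    by have := hr2 t; rewrite t0 t2 -zE pmulr_rgt0//; apply.
  - exfalso; pose t := Num.min r1 r2 / 2.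
    have r120 : 0 < Num.min r1 r2 by rewrite lt_min r10.
    have : 0 < t < Num.min r1 r2 by rewrite /t; apply/andP; split; lra.
    rewrite lt_min => /and3P[t0 t1 t2].
    have := hr2 t; rewrite t0 t2 -zE pmulr_rlt0// => /(_ isT).
    rewrite ltNge => /negP; apply; apply: H => //.
    - by apply/eqP; rewrite eq_le av0 vL.
    - by rewrite mz.
    - by rewrite sz; do 2 apply: mulr_gt0 => //; apply: hr1; rewrite t0.
  (* Here [pw a] vanishes along the circle of D_m, which forces [a = m]. *)
  - exfalso; have pv : psi v = 0 by rewrite /psi c0 mv subrr.
    have pw0 : psi w = 0.
      have : psi w * (1 + mu ^+ 2) = 0.
        transitivity (psi w + mu * pd - mu * (pd + mu * (psi v - psi w))).
          by rewrite pv; ring.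
        by rewrite c1 c2; ring.
      by move/eqP; rewrite mulf_eq0 (gt_eqF (tt0 mu)) orbF => /eqP.
    have pd0 : pd = 0 by move: c1; rewrite pv pw0 subrr mulr0 addr0.
    have E1 : a.1.1 = m.1.1.
      apply/eqP; rewrite -subr_eq0 -(mulrI_eq0 _ (mulfI (lt0r_neq0 D0))).
      apply/eqP; transitivity ((w.1 - v.1) * (psi w - psi v) - e * (w.2 - v.2) * pd
        - (1 - e ^+ 2) * ((w.2 - v.2) * ((a.1.1 - m.1.1) * (v.2 - w.2)
          + (a.1.2 - m.1.2) * (w.1 - v.1)))).
        by rewrite /pd /psi /D /dist2 /pw /d /=; ring.
      by rewrite e1 pd0 pv pw0; ring.
    have E2 : a.1.2 = m.1.2.
      apply/eqP; rewrite -subr_eq0 -(mulrI_eq0 _ (mulfI (lt0r_neq0 D0))).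
      apply/eqP; transitivity ((w.2 - v.2) * (psi w - psi v) + e * (w.1 - v.1) * pd
        - (1 - e ^+ 2) * ((w.1 - v.1) * ((a.1.1 - m.1.1) * (w.2 - v.2)
          - (a.1.2 - m.1.2) * (w.1 - v.1)))).
        by rewrite /pd /psi /D /dist2 /pw /d /=; ring.
      by rewrite e1 pd0 pv pw0; ring.
    have E3 : a.2 = m.2.
      by move: pv; rewrite /psi /pw E1 E2; lra.
    move: aL; rewrite (_ : a = m) ?(negbTE mL)//.
    by rewrite (surjective_pairing a) (surjective_pairing a.1) E1 E2 E3 -!surjective_pairing.
pose t := r / 2.
have tr : 0 < t < r by rewrite /t; apply/andP; split; lra.
have : intK L (z t) by move=> a aL; have [] := hr t tr a aL.
by move=> /intK_lt/(_ Km); rewrite mz ltxx.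
Qed.

(** * Lowest disks and their contact points *)

Lemma continuous_pw (R : realType) (a : R * R * R) : continuous (pw a).
Proof.
move=> x; have c1 : (y : R * R).1 @[y --> x] --> x.1 by exact: cvg_fst.
have c2 : (y : R * R).2 @[y --> x] --> x.2 by exact: cvg_snd.
apply: cvgB; last by apply: cvgD; [exact: (cvgM c1 c1)|exact: (cvgM c2 c2)].
apply: cvgD; last exact: cvg_cst.
by apply: cvgD; apply: cvgM => //; exact: cvg_cst.
Qed.

Lemma continuous_pw_disk (R : realType) (x : R * R) :
  continuous (fun a : R * R * R => pw a x).
Proof.
move=> a; have c1 : (b : R * R * R).1 @[b --> a] --> a.1 by exact: cvg_fst.
have c11 : (b : R * R * R).1.1 @[b --> a] --> a.1.1.
  by apply: (cvg_comp _ _ c1); exact: cvg_fst.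
have c12 : (b : R * R * R).1.2 @[b --> a] --> a.1.2.
  by apply: (cvg_comp _ _ c1); exact: cvg_snd.
have c2 : (b : R * R * R).2 @[b --> a] --> a.2 by exact: cvg_snd.
apply: cvgB; last exact: cvg_cst.
apply: cvgD => //.
by apply: cvgD; apply: cvgM => //; exact: cvg_cst.
Qed.

Lemma closed_le_preimage (R : realType) (T : topologicalType) (f : T -> R) (c : R) :
  continuous f -> closed [set x | c <= f x].
Proof.
move=> cf; apply: (@preimage_closed _ _ f [set y | c <= y]); last exact: closed_ge.
by move=> x _; exact: cf.
Qed.

(** Differences of two [pw] have this form: moving the code of a disk by [t] times [b] adds
    [t * aff b] to its [pw]. *)
Definition aff (R : realType) (b : R * R * R) (x : R * R) : R :=
  b.1.1 * x.1 + b.1.2 * x.2 + b.2.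

Lemma continuous_aff (R : realType) (b : R * R * R) : continuous (aff b).
Proof.
move=> x; have c1 : (y : R * R).1 @[y --> x] --> x.1 by exact: cvg_fst.
have c2 : (y : R * R).2 @[y --> x] --> x.2 by exact: cvg_snd.
apply: cvgD; last exact: cvg_cst.
by apply: cvgD; apply: cvgM => //; exact: cvg_cst.
Qed.

Lemma closed_inK (R : realType) (L : seq (R * R * R)) : closed [set x | inK L x].
Proof.
rewrite (_ : [set x | inK L x] =
    \bigcap_(a in [set a | a \in L]) [set x | 0 <= pw a x]).
  by apply: closed_bigI => a _; apply: closed_le_preimage; exact: continuous_pw.
by apply/seteqP; split => x /= h a /h.
Qed.

Lemma compact_inK (R : realType) (L : seq (R * R * R)) a :
  a \in L -> compact [set x | inK L x].
Proof.
(* [r] is the squared radius of D_a, whose centre is [(a.1.1 / 2, a.1.2 / 2)]. *)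
move=> aL; pose r := a.2 + (a.1.1 ^+ 2 + a.1.2 ^+ 2) / 4.
pose B1 := `[a.1.1 / 2 - (`|r| + 1), a.1.1 / 2 + (`|r| + 1)]%classic.
pose B2 := `[a.1.2 / 2 - (`|r| + 1), a.1.2 / 2 + (`|r| + 1)]%classic.
apply: (@subclosed_compact _ _ (B1 `*` B2)); first exact: closed_inK.
  by apply: compact_setX; exact: segment_compact.
move=> x /(_ a aL); rewrite /pw => h.
have sq (c : R) : c ^+ 2 <= r -> `|c| <= `|r| + 1.
  move=> cr; have r1 := ler_norm r; have r0 := normr_ge0 r.
  rewrite leNgt; apply/negP => rc; have : `|c| ^+ 2 <= r by rewrite real_normK ?num_real.
  by rewrite expr2; nra.
split; rewrite /B1 /B2 /= in_itv/=.
- have /sq : (x.1 - a.1.1 / 2) ^+ 2 <= r.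
    by have := sqr_ge0 (x.2 - a.1.2 / 2); rewrite /r; move: h; rewrite !expr2; lra.
  by rewrite ler_norml => /andP[? ?]; apply/andP; split; lra.
- have /sq : (x.2 - a.1.2 / 2) ^+ 2 <= r.
    by have := sqr_ge0 (x.1 - a.1.1 / 2); rewrite /r; move: h; rewrite !expr2; lra.
  by rewrite ler_norml => /andP[? ?]; apply/andP; split; lra.
Qed.

Lemma compact_min (R : realType) (T : topologicalType) (f : T -> R) (A : set T) :
  compact A -> continuous f -> A !=set0 ->
  exists2 c, A c & forall x, A x -> f c <= f x.
Proof.
move=> cA cf A0; have [c cin cmin] := compact_EVT_min A0 cA (continuous_subspaceT cf).
by exists c; [rewrite inE in cin|move=> x Ax; apply: cmin; rewrite inE].
Qed.

(** Compactness in the three parameters of a disk: being no higher than a given disk bounds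
    [pw a e], and containing the four points at distance [d] from [e] along the axes bounds the
    gradient of [pw a] at [e]. *)
Lemma exists_lowest_disk (R : realType) (L : seq (R * R * R)) (e : R * R) :
  L != [::] -> intK L e ->
  exists2 m, forall x, inK L x -> 0 <= pw m x &
    forall a, (forall x, inK L x -> 0 <= pw a x) -> pw m e <= pw a e.
Proof.
case: L => // a0 L _; set L' := a0 :: L => eL.
have [d d0 hd] := intK_square eL.
have eK := intK_inK eL.
pose M := pw a0 e.
pose A := [set a | (forall x, inK L' x -> 0 <= pw a x) /\ - M <= - pw a e].
have a0A : A a0 by split => // x; apply; rewrite mem_head.
have n0 : `|0 : R| <= d by rewrite normr0 ltW.
have nd : `|d| <= d by rewrite ger0_norm// ltW.
have nNd : `|- d| <= d by rewrite normrN.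
pose b (c : R) := M / d + d + 2 * `|c|.
pose C := M + b e.1 * `|e.1| + b e.2 * `|e.2| + e.1 ^+ 2 + e.2 ^+ 2.
have cA : compact A.
  apply: (@subclosed_compact _ _ (`[- b e.1, b e.1]%classic `*`
      `[- b e.2, b e.2]%classic `*` `[- C, C]%classic)).
  - rewrite (_ : A = \bigcap_(x in [set x | inK L' x]) [set a | 0 <= pw a x] `&`
        [set a | - M <= - pw a e]).
      apply: closedI.
        apply: closed_bigI => x _; apply: closed_le_preimage.
        exact: continuous_pw_disk.
      apply: (@closed_le_preimage R _ (fun a => - pw a e)) => a.
      by apply: cvgN; exact: continuous_pw_disk.
    by apply/seteqP; split => a [h1 h2]; split => // x /=; exact: h1.
  - by apply: compact_setX; [apply: compact_setX|]; exact: segment_compact.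
  move=> a [Ka /= Ma].
  have P0 := Ka _ eK.
  have bnd (c h : R) : 0 <= pw a e + d * (h - 2 * c) - d ^+ 2 ->
      0 <= pw a e - d * (h - 2 * c) - d ^+ 2 -> `|h| <= b c.
    move=> h1 h2; have d20 := sqr_ge0 d.
    have : `|h - 2 * c| <= M / d.
      by rewrite ler_pdivlMr// -(gtr0_norm d0) -normrM ler_norml; apply/andP; split; lra.
    have := ler_normD (h - 2 * c) (2 * c); rewrite subrK normrM ger0_norm//.
    by rewrite /b; lra.
  have h1 : `|a.1.1| <= b e.1.
    apply: bnd.
      have := Ka _ (intK_inK (hd _ _ nd n0)).
      by congr (0 <= _); rewrite /pw /=; ring.
    have := Ka _ (intK_inK (hd _ _ nNd n0)).
    by congr (0 <= _); rewrite /pw /=; ring.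
  have h2 : `|a.1.2| <= b e.2.
    apply: bnd.
      have := Ka _ (intK_inK (hd _ _ n0 nd)).
      by congr (0 <= _); rewrite /pw /=; ring.
    have := Ka _ (intK_inK (hd _ _ n0 nNd)).
    by congr (0 <= _); rewrite /pw /=; ring.
  have h3 : `|a.2| <= C.
    have -> : a.2 = pw a e - a.1.1 * e.1 - a.1.2 * e.2 + (e.1 ^+ 2 + e.2 ^+ 2).
      by rewrite /pw; ring.
    rewrite /C; apply: le_trans (ler_normD _ _) _.
    rewrite (ger0_norm (addr_ge0 (sqr_ge0 _) (sqr_ge0 _))) addrA !lerD2r.
    apply: le_trans (ler_normB _ _) _; apply: lerD; last by rewrite normrM ler_wpM2r.
    apply: le_trans (ler_normB _ _) _; apply: lerD; last by rewrite normrM ler_wpM2r.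
    by rewrite ger0_norm//; lra.
  by split=> [|/=]; [split|]; rewrite /= in_itv/= -ler_norml.
have [m [Km Mm] mmin] := compact_min cA (@continuous_pw_disk _ e) (ex_intro _ _ a0A).
exists m => // a Ka; have [aM|aM] := lerP (pw a e) M; last by move: Mm => /=; lra.
by apply: mmin; split => //; lra.
Qed.

(* Adding a small multiple of [b] to a lowest disk would lower it further. *)
Lemma lowest_contact (R : realType) (L : seq (R * R * R)) m b (e : R * R) :
  L != [::] -> inK L e -> (forall x, inK L x -> 0 <= pw m x) ->
  (forall a, (forall x, inK L x -> 0 <= pw a x) -> pw m e <= pw a e) ->
  aff b e < 0 -> exists v, [/\ inK L v, pw m v = 0 & aff b v <= 0].
Proof.
case: L => // a0 L _; set L' := a0 :: L => eK Km mmin be.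
apply: contrapT => H.
have {}H v : inK L' v -> pw m v = 0 -> 0 < aff b v.
  by move=> vK mv; rewrite ltNge; apply/negP => bv; apply: H; exists v.
have cK := compact_inK (mem_head a0 L).
have [x0 x0K bmin] := compact_min cK (@continuous_aff _ b) (ex_intro _ _ eK).
have cK' : compact ([set x | inK L' x] `&` [set x | 0 <= - aff b x]).
  apply: (@subclosed_compact _ _ [set x | inK L' x]) => //.
  apply: closedI; first exact: closed_inK.
  apply: (@closed_le_preimage R _ (fun x => - aff b x)) => x.
  by apply: cvgN; exact: continuous_aff.
have [|c [cK0 /= bc] cmin] := compact_min cK' (@continuous_pw _ m).
  by exists e; split => //=; lra.
have mc : 0 < pw m c.
  rewrite lt_neqAle Km// andbT eq_sym; apply/eqP => /(H _ cK0); lra.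
have b0 : aff b x0 < 0 by have := bmin e eK; lra.
(* With this [t], the lowering [t * aff b] never goes below [- pw m c] on the intersection, and
   where it is nonpositive [pw m] is at least [pw m c]. *)
pose t := pw m c / - aff b x0.
have t0 : 0 < t by rewrite divr_gt0//; lra.
have tE : t * - aff b x0 = pw m c by rewrite /t divfK//; lra.
clearbody t.
pose a := (m.1.1 + t * b.1.1, m.1.2 + t * b.1.2, m.2 + t * b.2).
have aE x : pw a x = pw m x + t * aff b x by rewrite /pw /aff /a /=; ring.
have := mmin a; rewrite aE => /(_ _)/wrap[x xK|]; last by nra.
rewrite aE; have [bx|bx] := lerP (aff b x) 0.
  have := cmin x (conj xK _) => /(_ _)/wrap[/=|]; first by lra.
  have : 0 <= t * (aff b x - aff b x0).
    by apply: mulr_ge0; [exact: ltW|rewrite subr_ge0; exact: bmin].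
  by lra.
by apply: addr_ge0; [exact: Km|rewrite mulr_ge0// ltW].
Qed.

(** * Decomposing a family of disks *)

(** Pairwise form of: every point of D_m lies in all disks of [F1] or in all disks of [F2]. *)
Definition separates (R : realType) m (F1 F2 : seq (R * R * R)) : Prop :=
  forall a b x, a \in F1 -> b \in F2 -> 0 <= pw m x -> 0 <= pw a x \/ 0 <= pw b x.

(** Certificates that the area inequality for a family follows from the one for pairs, by
    inclusion-exclusion and by adding a disk. Lists stand for finite sets, hence [=i]. *)
Inductive treelike (R : realType) : seq (R * R * R) -> Prop :=
| treelike_pair a b L : L =i [:: a; b] -> treelike L
| treelike_split m F1 F2 L : L =i m :: F1 ++ F2 -> separates m F1 F2 ->
    treelike (m :: F1) -> treelike (m :: F2) -> treelike L
| treelike_add m L : (forall x, inK L x -> 0 <= pw m x) ->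
    treelike (m :: L) -> treelike L.

Lemma treelike_eq (R : realType) (L L' : seq (R * R * R)) :
  L =i L' -> treelike L -> treelike L'.
Proof.
move=> LL' tL; elim: tL L' LL' => {L}.
- by move=> a b L Lab L' LL'; apply: (@treelike_pair R a b) => z; rewrite -LL'.
- move=> m F1 F2 L LE sep t1 _ t2 _ L' LL'.
  by apply: (treelike_split _ sep t1 t2) => z; rewrite -LL'.
- move=> m L Km _ IH L' LL'; apply: (@treelike_add R m).
    by move=> x xL'; apply: Km => a; rewrite LL'; exact: xL'.
  by apply: IH => z; rewrite !in_cons LL'.
Qed.

(** What D_a removes from D_m lies strictly on one side of the line [vw]; the sign [e] selects the
    side. *)
Definition cut (R : realType) (e : R) m (v w : R * R) a : Prop :=
  forall x, 0 <= pw m x -> pw a x < 0 -> 0 < e * side v w x.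

Lemma cut_total (R : realType) (e : R) m (v w : R * R) a : e ^+ 2 = 1 ->
  v <> w -> pw m v = 0 -> pw m w = 0 -> 0 <= pw a v -> 0 <= pw a w ->
  cut e m v w a \/ cut (- e) m v w a.
Proof.
move=> /eqP; rewrite sqrf_eq1 => ee vw mv mw av aw.
suff H : cut 1 m v w a \/ cut (- 1) m v w a.
  by case/orP: ee => /eqP -> //; rewrite opprK; case: H; [right|left].
have [|/existsNP[x /not_implyP[mx /not_implyP[ax /negP]]]] :=
  pselect (cut (- 1) m v w a); first by right.
rewrite -leNgt mulN1r oppr_le0 => sx; left => y my ay; rewrite mul1r.
exact: (chord_one_side vw mv mw av aw mx ax my ay sx).
Qed.

Lemma cut_separates (R : realType) (e : R) m (v w : R * R) F1 F2 :
  (forall a, a \in F1 -> cut e m v w a) -> (forall a, a \in F2 -> cut (- e) m v w a) ->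
  separates m F1 F2.
Proof.
move=> c1 c2 a b x aF bF mx; have [|ax] := lerP 0 (pw a x); first by left.
have [|bx] := lerP 0 (pw b x); first by right.
by have := c1 a aF x mx ax; have := c2 b bF x mx bx; rewrite mulNr; lra.
Qed.

Lemma circle_side_neq0 (R : realType) m (u v w : R * R) :
  v <> w -> pw m v = 0 -> pw m w = 0 -> pw m u = 0 -> u <> v -> u <> w ->
  side v w u != 0.
Proof.
move=> vw mv mw mu uv uw; apply/eqP => s0.
have [|t _ ut] := on_chord vw mv mw s0; first by rewrite mu.
have /eqP := mu; rewrite ut pw_lerp mv mw !mulr0 !add0r.
rewrite !mulf_eq0 (gt_eqF (dist2_gt0 vw)) orbF subr_eq0.
case/orP => /eqP tE; [apply: uv|apply: uw]; rewrite ut -?tE.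
  by rewrite tE /lerp subr0 !mul1r !mul0r !addr0 -surjective_pairing.
by rewrite /lerp subrr !mul1r !mul0r !add0r -surjective_pairing.
Qed.

(* The segment from [x] to [p] crosses the chord [qr]. *)
Lemma sector (R : realType) (e : R) m (p q r x : R * R) :
  pw m p = 0 -> pw m q = 0 -> pw m r = 0 -> q <> r -> 0 < e * side q r p ->
  0 <= pw m x -> e * side q r x < 0 ->
  0 <= e * side p q x /\ 0 <= e * side r p x.
Proof.
move=> mp mq mr qr sp mx sx.
have d0 : 0 < e * side q r p - e * side q r x by lra.
pose t := - (e * side q r x) / (e * side q r p - e * side q r x).
have tE : t * (e * side q r p - e * side q r x) = - (e * side q r x).
  by rewrite /t divfK// lt0r_neq0.
have t0 : 0 < t by rewrite divr_gt0//; lra.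
have t1 : t < 1 by rewrite ltr_pdivrMr//; lra.
clearbody t; pose o := lerp t x p.
have mo : 0 <= pw m o.
  rewrite /o pw_lerp mp mulr0 addr0 addr_ge0//; first by rewrite mulr_ge0//; lra.
  by rewrite mulr_ge0 ?dist2_ge0// mulr_ge0//; lra.
have e0 : e != 0 by apply/eqP => e0; move: sp; rewrite e0 mul0r ltxx.
have so : side q r o = 0.
  apply: (mulfI e0); rewrite mulr0 /o side_lerp; lra.
have [c /andP[c0 c1] oc] := on_chord qr mq mr so mo.
have sE1 : e * side p q o = (1 - t) * (e * side p q x).
  by rewrite /o side_lerp side_l; ring.
have sE2 : e * side r p o = (1 - t) * (e * side r p x).
  by rewrite /o side_lerp side_r; ring.
have r1 : side p q r = side q r p by rewrite -side_rot.
have r2 : side r p q = side q r p by rewrite side_rot.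
have c1' : 0 <= 1 - c by lra.
have t1' : 0 < 1 - t by lra.
split.
- rewrite -(pmulr_rge0 _ t1') -sE1 oc side_lerp side_r mulr0 add0r r1.
  by rewrite mulrCA mulr_ge0// ltW.
- rewrite -(pmulr_rge0 _ t1') -sE2 oc side_lerp side_l mulr0 addr0 r2.
  by rewrite mulrCA mulr_ge0// ltW.
Qed.

Lemma mem2_size (T : eqType) (s : seq T) a b :
  a \in s -> b \in s -> a != b -> (1 < size s)%N.
Proof.
case: s => [|x [|y s]]//; rewrite !inE => /eqP -> /eqP ->.
by rewrite eqxx.
Qed.

(** Induction hypothesis of the decomposition theorem, named so that its cases can be separate
    lemmas. *)
Definition treelike_below (R : realType) n : Prop :=
  forall (L : seq (R * R * R)) x0, (size L <= n)%N -> L != [::] -> intK L x0 -> treelike L.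

Lemma treelike_cons_below (R : realType) n (L F : seq (R * R * R)) m x0 :
  treelike_below R n -> intK L x0 -> (forall x, inK L x -> 0 <= pw m x) ->
  {subset F <= L} -> (size F < n)%N -> treelike (m :: F).
Proof.
move=> IH x0L Km FL sF; apply: (IH _ x0) => // a; rewrite in_cons => /predU1P[->|aF].
  exact: intK_lt Km.
exact/x0L/FL.
Qed.

Lemma three_parts_lt (a b c d l n : nat) : (a + b = l)%N -> (c + d = b)%N ->
  (0 < a)%N -> (0 < c)%N -> (0 < d)%N -> (l <= n.+1)%N ->
  [/\ a < n, c < n & d < n]%N.
Proof. by move=> *; split; lia. Qed.

(** The triangle [uvw] divides D_m into itself and three circular segments. A disk of [L] contains
    the three vertices, so it can only miss points of D_m beyond one chord. By [touching_disk] each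
    chord has a disk of [L] missing a point beyond it: the three parts are nonempty, and each omits
    at least two disks. *)
Lemma treelike_three_contacts (R : realType) n (L : seq (R * R * R)) m x0 u v w :
  treelike_below R n -> (size L <= n.+1)%N -> intK L x0 ->
  (forall x, inK L x -> 0 <= pw m x) -> m \notin L ->
  inK L u -> inK L v -> inK L w -> pw m u = 0 -> pw m v = 0 -> pw m w = 0 ->
  u <> v -> v <> w -> w <> u -> treelike L.
Proof.
move=> IH sL x0L Km mL uK vK wK mu mv mw uv vw wu.
have [e e1 se] : exists2 e : R, e ^+ 2 = 1 & 0 < e * side v w u.
  have s0 : side v w u != 0.
    by apply: (circle_side_neq0 vw mv mw mu uv) => uw; apply: wu.
  have [s|s|s] := ltrgtP (side v w u) 0.
  - by exists (- 1); rewrite ?sqrrN ?expr1n// mulN1r oppr_gt0.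
  - by exists 1; rewrite ?expr1n// mul1r.
  - by rewrite s eqxx in s0.
have eN : (- e) ^+ 2 = 1 by rewrite sqrrN.
have se1 : 0 < e * side u v w by rewrite -side_rot.
have se2 : 0 < e * side w u v by rewrite side_rot.
have ncut a p q x : 0 <= pw m x -> pw a x < 0 -> 0 <= e * side p q x ->
    ~ cut (- e) m p q a.
  by move=> mx ax sx /(_ x mx ax); rewrite mulNr; lra.
have tcut a p q : a \in L -> inK L p -> inK L q -> p <> q -> pw m p = 0 ->
    pw m q = 0 -> ~ cut (- e) m p q a -> cut e m p q a.
  move=> aL pK qK pq mp mq; case: (@cut_total R e m p q a) => //.
  - exact: pK.
  - exact: qK.
pose F1 := [seq a <- L | `[< cut (- e) m v w a >]].
pose F := [seq a <- L | ~~ `[< cut (- e) m v w a >]].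
pose F2 := [seq a <- F | `[< cut (- e) m u v a >]].
pose F3 := [seq a <- F | ~~ `[< cut (- e) m u v a >]].
have [a [aL _ [x [mx ax sx]]]] := touching_disk Km mL eN vw mv mw vK.
have aF1 : a \in F1.
  rewrite mem_filter aL andbT; apply/asboolP.
  have [//|] := @cut_total R (- e) m v w a eN vw mv mw (vK _ aL) (wK _ aL).
  by rewrite opprK => /(_ x mx ax); move: sx; rewrite mulNr; lra.
have [b [bL _ [y [my bY sy]]]] := touching_disk Km mL eN uv mu mv uK.
(* The missed point [y] lies beyond [uv], hence not beyond the other two chords; this keeps [b] out
   of [F1]. *)
have [|sy1 sy2] := @sector R e m w u v y mw mu mv uv se1 my; first by move: sy; rewrite mulNr; lra.
have bF2 : b \in F2.
  rewrite !mem_filter bL andbT; apply/andP; split; last by apply/asboolPn; exact: (ncut _ _ _ y).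
  apply/asboolP; have [//|] := @cut_total R (- e) m u v b eN uv mu mv (uK _ bL) (vK _ bL).
  by rewrite opprK => /(_ y my bY); move: sy; rewrite mulNr; lra.
have [c [cL _ [z [mz cz sz]]]] := touching_disk Km mL eN wu mw mu wK.
have [|sz1 sz2] := @sector R e m v w u z mv mw mu wu se2 mz; first by move: sz; rewrite mulNr; lra.
have cF3 : c \in F3.
  by rewrite !mem_filter cL andbT; apply/andP; split; apply/asboolPn; exact: (ncut _ _ _ z).
have size_pos (T : eqType) (s : seq T) d : d \in s -> (0 < size s)%N by case: s.
have s1 := size_pos _ _ _ aF1; have s2 := size_pos _ _ _ bF2; have s3 := size_pos _ _ _ cF3.
have sF : (size F1 + size F = size L)%N by rewrite !size_filter count_predC.
have sF' : (size F2 + size F3 = size F)%N.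
  by rewrite -(count_predC (fun a => `[< cut (- e) m u v a >]) F) -!size_filter.
have FL : {subset F <= L} by move=> d; rewrite mem_filter => /andP[].
have [l1 l2 l3] := three_parts_lt sF sF' s1 s2 s3 sL.
apply: (treelike_add Km); apply: (@treelike_split R m F1 F).
- move=> d; rewrite !in_cons mem_cat !mem_filter.
  by case: (d == m) => //=; case: `[< _ >]; rewrite ?orbF.
- apply: (@cut_separates R (- e) m v w).
    by move=> d; rewrite mem_filter => /andP[/asboolP].
  move=> d; rewrite mem_filter opprK => /andP[/asboolPn h dL].
  exact: tcut.
- apply: (treelike_cons_below IH x0L Km) => //.
  by move=> d; rewrite mem_filter => /andP[].
apply: (@treelike_split R m F2 F3).
- move=> d; rewrite !in_cons mem_cat [in RHS]mem_filter [X in _ || (_ || X)]mem_filter.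
  by case: (d == m) => //=; case: `[< _ >]; rewrite ?orbF.
- apply: (@cut_separates R (- e) m u v).
    by move=> d; rewrite mem_filter => /andP[/asboolP].
  move=> d; rewrite mem_filter opprK => /andP[/asboolPn h dF].
  by apply: tcut => //; exact: FL.
- apply: (treelike_cons_below IH x0L Km) => //.
  by move=> d; rewrite mem_filter => /andP[_ /FL].
- apply: (treelike_cons_below IH x0L Km) => //.
  by move=> d; rewrite mem_filter => /andP[_ /FL].
Qed.

(** No disk of [L] has both [v] and [w] on its boundary, so on each side of the chord the disk
    touching at [v] differs from the one touching at [w]. Both parts thus have two members, and each
    omits two. *)
Lemma treelike_chord (R : realType) n (L : seq (R * R * R)) m x0 v w :
  treelike_below R n -> (size L <= n.+1)%N -> intK L x0 ->
  (forall x, inK L x -> 0 <= pw m x) -> m \notin L ->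
  inK L v -> inK L w -> pw m v = 0 -> pw m w = 0 -> v <> w ->
  (forall a, a \in L -> pw a v = 0 -> pw a w = 0 -> False) -> treelike L.
Proof.
move=> IH sL x0L Km mL vK wK mv mw vw nvw.
have two (e : R) : e ^+ 2 = 1 -> exists a b, [/\ a != b, a \in L, b \in L,
    ~ cut (- e) m v w a & ~ cut (- e) m v w b].
  move=> e1; have eN : (- e) ^+ 2 = 1 by rewrite sqrrN.
  have nc a x : 0 <= pw m x -> pw a x < 0 -> 0 < e * side v w x -> ~ cut (- e) m v w a.
    by move=> mx ax sx /(_ x mx ax); rewrite mulNr; lra.
  have [a [aL av [x [mx ax sx]]]] := touching_disk Km mL e1 vw mv mw vK.
  have [|b [bL bw [y [my bY]]]] := touching_disk Km mL eN _ mw mv wK.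
    by move=> wv; apply: vw.
  rewrite sideC mulrNN => sy.
  exists a, b; split => //; [|exact: (nc a x)|exact: (nc b y)].
  by apply/eqP => ab; apply: (nvw a) => //; rewrite ab.
pose F := [seq a <- L | `[< cut 1 m v w a >]].
pose F' := [seq a <- L | ~~ `[< cut 1 m v w a >]].
have sF : (size F + size F' = size L)%N by rewrite !size_filter count_predC.
have twoF : (1 < size F)%N.
  have [a [b [ab aL bL ca cb]]] := two 1 (expr1n R 2).
  apply: (@mem2_size _ F a b) => //; rewrite mem_filter ?aL ?bL andbT; apply/asboolP.
    by have [] := cut_total (expr1n R 2) vw mv mw (vK a aL) (wK a aL).
  by have [] := cut_total (expr1n R 2) vw mv mw (vK b bL) (wK b bL).
have twoF' : (1 < size F')%N.
  have [|a [b [ab aL bL ca cb]]] := two (- 1); first by rewrite sqrrN expr1n.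
  rewrite opprK in ca cb.
  by apply: (@mem2_size _ F' a b) => //; rewrite mem_filter ?aL ?bL andbT; apply/asboolPn.
have cutN a : a \in F' -> cut (- 1) m v w a.
  rewrite mem_filter => /andP[/asboolPn h aL].
  by have [] := cut_total (expr1n R 2) vw mv mw (vK a aL) (wK a aL).
have l1 : (size F < n)%N by lia.
have l2 : (size F' < n)%N by lia.
apply: (treelike_add Km); apply: (@treelike_split R m F F').
- move=> d; rewrite !in_cons mem_cat !mem_filter.
  by case: (d == m) => //=; case: `[< _ >]; rewrite ?orbF.
- apply: (@cut_separates R 1 m v w) => //.
  by move=> d; rewrite mem_filter => /andP[/asboolP].
- apply: (treelike_cons_below IH x0L Km) => //.
  by move=> d; rewrite mem_filter => /andP[].
- apply: (treelike_cons_below IH x0L Km) => //.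
  by move=> d; rewrite mem_filter => /andP[].
Qed.

Lemma lowest_two_contacts (R : realType) (L : seq (R * R * R)) m (e : R * R) :
  L != [::] -> intK L e -> (forall x, inK L x -> 0 <= pw m x) ->
  (forall a, (forall x, inK L x -> 0 <= pw a x) -> pw m e <= pw a e) ->
  exists v w, [/\ v <> w, inK L v, inK L w, pw m v = 0 & pw m w = 0].
Proof.
move=> L0 eL Km mmin; have eK := intK_inK eL.
have [|v [vK mv _]] := @lowest_contact R L m (0, 0, -1) e L0 eK Km mmin.
  by rewrite /aff /=; lra.
have ve : v <> e by move=> ve; have := intK_lt eL Km; rewrite -ve mv ltxx.
(* [aff b] vanishes on the perpendicular bisector of [v] and [e], is negative at [e] and positive at
   [v]; the contact point it yields is therefore a new one. *)
pose b := (v.1 - e.1, v.2 - e.2,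
  - ((v.1 - e.1) * (v.1 + e.1) + (v.2 - e.2) * (v.2 + e.2)) / 2).
have D0 := dist2_gt0 ve.
have [|w [wK mw bw]] := @lowest_contact R L m b e L0 eK Km mmin.
  rewrite (_ : aff b e = - (dist2 v e / 2)); first by lra.
  by rewrite /aff /b /dist2 /=; field.
exists v, w; split => // vw; move: bw; rewrite -vw.
rewrite (_ : aff b v = dist2 v e / 2); first by lra.
by rewrite /aff /b /dist2 /=; field.
Qed.

(** A lowest disk lies strictly below all of [L] at [e], so it is not in [L]. If [e] is on the chord
    of two contacts, a disk of [L] through both would agree with it at [e], which is excluded;
    otherwise there is a third contact. *)
Lemma treelike_new_lowest (R : realType) n (L : seq (R * R * R)) x0 e a :
  treelike_below R n -> (size L <= n.+1)%N -> L != [::] -> intK L x0 ->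
  intK L e -> (forall x, inK L x -> 0 <= pw a x) ->
  (forall i, i \in L -> pw a e < pw i e) -> treelike L.
Proof.
move=> IH sL L0 x0L eL Ka alow.
have [m Km mmin] := exists_lowest_disk L0 eL.
have mlow i : i \in L -> pw m e < pw i e by move=> /alow; apply: le_lt_trans; exact: mmin.
have mL : m \notin L by apply/negP => /mlow; rewrite ltxx.
have [v [w [vw vK wK mv mw]]] := lowest_two_contacts L0 eL Km mmin.
have [se|se] := eqVneq (side v w e) 0.
  apply: (treelike_chord IH sL x0L Km mL vK wK mv mw vw) => i iL iv iw.
  have [t _ et] := on_chord vw mv mw se (Km _ (intK_inK eL)).
  have := pwB_lerp i m t v w; rewrite -et mv mw iv iw.
  by have := mlow i iL; lra.
pose s := side v w e.
have s0 : 0 < s * s.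
  by have := sqr_ge0 s; rewrite le_eqVlt eq_sym sqrf_eq0 (negbTE se)/= expr2.
(* [aff b] vanishes on the parallel to [vw] halfway to [e]; it is negative at [e] and positive at
   [v] and [w]. *)
pose b := (s * (w.2 - v.2), - s * (w.1 - v.1),
  s * ((w.1 - v.1) * v.2 - (w.2 - v.2) * v.1) + s * s / 2).
have bE x : aff b x = - (s * side v w x) + s * s / 2.
  by rewrite /aff /b /side /=; ring.
have [|u [uK mu bu]] := @lowest_contact R L m b e L0 (intK_inK eL) Km mmin.
  by rewrite bE -/s; lra.
apply: (treelike_three_contacts IH sL x0L Km mL uK vK wK mu mv mw) => //.
- by move=> uv; move: bu; rewrite bE uv side_l; lra.
- by move=> wu; move: bu; rewrite bE -wu side_r; lra.
Qed.

(** * Cutting along a given disk or a disk of a pencil *)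

Lemma two_parts_lt (a b l n : nat) : (a + b = l.-1)%N ->
  (0 < a)%N -> (0 < b)%N -> (l <= n.+1)%N -> (a < n)%N /\ (b < n)%N.
Proof. by move=> *; split; lia. Qed.

(** Here the cutting disk already belongs to [L], so it suffices that both parts of the remaining
    disks are nonempty, as [a] and [b] witness. *)
Lemma treelike_member_chord (R : realType) n (L : seq (R * R * R)) x0 m e v w a b :
  treelike_below R n -> (size L <= n.+1)%N -> uniq L -> intK L x0 -> m \in L -> e ^+ 2 = 1 ->
  inK L v -> inK L w -> pw m v = 0 -> pw m w = 0 -> v <> w ->
  a \in L -> b \in L -> a != m -> b != m ->
  cut e m v w a -> ~ cut e m v w b -> treelike L.
Proof.
move=> IH sL uL x0L mL e1 vK wK mv mw vw aL bL am bm ca cb.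
pose L' := rem m L.
have L'L : {subset L' <= L} by exact: mem_rem.
have Lm c : (c \in L') = (c != m) && (c \in L) by rewrite mem_rem_uniq.
pose F1 := [seq c <- L' | `[< cut e m v w c >]].
pose F2 := [seq c <- L' | ~~ `[< cut e m v w c >]].
have sF : (size F1 + size F2 = (size L).-1)%N.
  by rewrite -(size_rem mL) !size_filter count_predC.
have aF1 : a \in F1 by rewrite mem_filter Lm am aL !andbT; apply/asboolP.
have bF2 : b \in F2 by rewrite mem_filter Lm bm bL !andbT; apply/asboolPn.
have size_pos (T : eqType) (s : seq T) d : d \in s -> (0 < size s)%N by case: s.
have s1 := size_pos _ _ _ aF1; have s2 := size_pos _ _ _ bF2.
have [l1 l2] := two_parts_lt sF s1 s2 sL.
have Km x : inK L x -> 0 <= pw m x by apply.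
apply: (@treelike_split R m F1 F2).
- move=> d; rewrite !in_cons mem_cat !mem_filter Lm.
  by have [->|] := eqVneq d m => //=; case: `[< _ >]; rewrite ?orbF.
- apply: (@cut_separates R e m v w).
    by move=> d; rewrite mem_filter => /andP[/asboolP].
  move=> d; rewrite mem_filter => /andP[/asboolPn h /L'L dL].
  by have [] := cut_total e1 vw mv mw (vK d dL) (wK d dL).
- apply: (treelike_cons_below IH x0L Km) => //.
  by move=> d; rewrite mem_filter => /andP[_ /L'L].
- apply: (treelike_cons_below IH x0L Km) => //.
  by move=> d; rewrite mem_filter => /andP[_ /L'L].
Qed.

Lemma pw_closure (R : realType) a (x c : R * R) :
  (forall t, 0 < t < 1 -> 0 <= pw a (lerp t x c)) -> 0 <= pw a x.
Proof.
move=> H; rewrite leNgt; apply/negP => ax.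
have [[]|[_ [d d0 hd]]|[]] := quadratic_near0 (pw a x)
  (pw a c - pw a x + dist2 x c) (- dist2 x c); [lra| |lra].
pose t := Num.min d 1 / 2.
have m0 : 0 < Num.min d 1 by rewrite lt_min d0 ltr01.
have : 0 < t < Num.min d 1 by rewrite /t; apply/andP; split; lra.
clearbody t; rewrite lt_min => /and3P[t0 td t1].
have := H t; rewrite t0 t1 => /(_ isT); rewrite pw_lerp.
by have := hd t; rewrite t0 td => /(_ isT); nra.
Qed.

(* The half-disks of the pencil on the side of [l] grow with [s], the other ones
   shrink; [s] is the largest value for which the former stay inside D_x. *)
Lemma pencil_inside (R : realType) (i l x : R * R * R) (k : R) (v w : R * R) :
  v <> w -> pw i v = 0 -> pw i w = 0 -> 0 < k ->
  (forall y, pw l y = pw i y + k * side v w y) ->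
  0 <= pw x v -> 0 <= pw x w -> cut (- 1) i v w x -> cut 1 l v w x ->
  exists s m, [/\ 0 <= s <= 1, forall y, pw m y = pw i y + s * (k * side v w y) &
    forall y, 0 <= pw m y -> 0 <= pw x y].
Proof.
move=> vw iv iw k0 lE xv xw ci cl.
(* The pencil of circles through [v] and [w], with D_i at [s = 0] and D_l at [s = 1]. *)
pose ms s := (i.1.1 - s * k * (w.2 - v.2), i.1.2 + s * k * (w.1 - v.1),
  i.2 + s * k * ((w.2 - v.2) * v.1 - (w.1 - v.1) * v.2)).
have msE s y : pw (ms s) y = pw i y + s * (k * side v w y).
  by rewrite /pw /ms /side /=; ring.
have mv s : pw (ms s) v = 0 by rewrite msE iv side_l !mulr0 addr0.
have mw s : pw (ms s) w = 0 by rewrite msE iw side_r !mulr0 addr0.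
pose S := [set s | 0 <= s <= 1 /\ forall y, 0 <= side v w y ->
  0 <= pw (ms s) y -> 0 <= pw x y].
have S0 : S 0.
  split => [|y sy]; first by rewrite lexx ler01.
  rewrite msE mul0r addr0 => iy; rewrite leNgt; apply/negP => xy.
  by have := ci y iy xy; lra.
have hS : has_sup S by split; [exists 0|exists 1 => s [/andP[]]].
pose s1 := sup S.
have s10 : 0 <= s1 by apply: (sup_upper_bound hS) S0.
have s11 : s1 <= 1 by apply: (ge_sup _ _) => [|s [/andP[]]//]; exists 0.
(* The midpoint of the chord is interior to every disk of the pencil. Moving [y] slightly towards it
   makes the inequality strict, which leaves room for varying [s], and [pw_closure] returns to
   [y]. *)
pose c := lerp (1 / 2) v w.
have sc : side v w c = 0 by rewrite /c side_lerp side_l side_r; lra.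
have mc s : 0 < pw (ms s) c.
  rewrite /c pw_lerp mv mw !mulr0 !add0r; apply: mulr_gt0; last exact: dist2_gt0.
  by lra.
have mlt s y t : 0 <= pw (ms s) y -> 0 < t < 1 -> 0 < pw (ms s) (lerp t y c).
  move=> my /andP[t0 t1]; rewrite pw_lerp.
  have a1 : 0 <= (1 - t) * pw (ms s) y by apply: mulr_ge0 => //; lra.
  have a2 : 0 < t * pw (ms s) c by apply: mulr_gt0.
  have a3 : 0 <= t * (1 - t) * dist2 y c.
    by apply: mulr_ge0; [apply: mulr_ge0; lra|exact: dist2_ge0].
  by lra.
have st y t : side v w (lerp t y c) = (1 - t) * side v w y.
  by rewrite side_lerp sc mulr0 addr0.
exists s1, (ms s1); split => //; first by apply/andP.
move=> y my; apply: (@pw_closure _ _ _ c) => t t01.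
have mty := mlt _ _ _ my t01; set z := lerp t y c in mty *.
have n0 := normr_ge0 (k * side v w z); have nz := ler_norm (k * side v w z).
have nz' : - (k * side v w z) <= `|k * side v w z| by rewrite -normrN ler_norm.
(* Amount by which [s] may differ from [s1] while [z] stays in the disk. *)
pose eta := pw (ms s1) z / (`|k * side v w z| + 1).
have eta0 : 0 < eta by rewrite divr_gt0//; lra.
have etaE : eta * `|k * side v w z| + eta = pw (ms s1) z.
  by rewrite -[X in _ + X]mulr1 -mulrDr /eta divfK//; lra.
clearbody eta.
have near s : `|s - s1| <= eta -> 0 <= pw (ms s) z.
  move=> ss; have -> : pw (ms s) z = pw (ms s1) z + (s - s1) * (k * side v w z).
    by rewrite !msE; ring.
  have : - (eta * `|k * side v w z|) <= (s - s1) * (k * side v w z).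
    rewrite lerNl (le_trans (ler_norm _))// normrN normrM ler_wpM2r//.
  by lra.
have [sz|sz] := lerP 0 (side v w z).
  have [s [s01 hs] ss] := sup_adherent eta0 hS; rewrite -/s1 in ss.
  have := sup_upper_bound hS (conj s01 hs); rewrite -/s1 => le1.
  apply: hs => //; apply: near.
  by rewrite ler_norml; apply/andP; split; lra.
(* On the negative side: at [s1 = 1] the disk is D_l, where [cl] applies. For [s] slightly above
   [s1], D_x misses a point of the disk on the positive side, so by [chord_one_side] it misses none
   on the negative side. *)
have [s1E|s1lt] := eqVneq s1 1.
  have lz : 0 <= pw l z by rewrite lE; move: mty; rewrite msE s1E mul1r => /ltW.
  by rewrite leNgt; apply/negP => xz; have := cl z lz xz; lra.
have {}s1lt : s1 < 1 by rewrite lt_neqAle s1lt.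
pose s := Num.min 1 (s1 + eta).
have [ss1 ss2 ss3] : [/\ s1 < s, s <= 1 & s <= s1 + eta].
  by rewrite /s lt_min ge_min lexx ge_min lexx orbT; split => //; apply/andP; split; lra.
have sz0 : 0 <= pw (ms s) z.
  by apply: near; rewrite ger0_norm; lra.
have nS : ~ S s.
  by move=> /(sup_upper_bound hS); rewrite -/s1; lra.
have [y' sy' [my' xy']] : exists2 y', 0 <= side v w y' & 0 <= pw (ms s) y' /\ pw x y' < 0.
  apply: contrapT => H; apply: nS; split; first by apply/andP; split; lra.
  move=> y' sy' my'; rewrite leNgt; apply/negP => xy'; apply: H.
  by exists y'.
rewrite leNgt; apply/negP => xz.
have := chord_one_side vw (mv s) (mw s) xv xw my' xy' sz0 xz sy'.
by lra.
Qed.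

Lemma affine_on_line (R : realType) (i l : R * R * R) (v w : R * R) :
  v <> w -> pw i v = 0 -> pw i w = 0 -> pw l v = 0 -> pw l w = 0 ->
  exists k, forall y, pw l y = pw i y + k * side v w y.
Proof.
move=> vw iv iw lv lw; have D0 := dist2_gt0 vw.
pose A := l.1.1 - i.1.1; pose B := l.1.2 - i.1.2; pose C := l.2 - i.2.
(* The gradient [(A, B)] of [pw l - pw i] is normal to [vw]; [k] is its ratio to the gradient of
   [side v w]. *)
pose k := (B * (w.1 - v.1) - A * (w.2 - v.2)) / dist2 v w.
have kD : k * dist2 v w = B * (w.1 - v.1) - A * (w.2 - v.2).
  by rewrite /k divfK// lt0r_neq0.
have psi (y : R * R) : pw l y - pw i y = A * y.1 + B * y.2 + C.
  by rewrite /pw /A /B /C; ring.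
have e1 : A * v.1 + B * v.2 + C = 0 by rewrite -psi iv lv subrr.
have e2 : A * w.1 + B * w.2 + C = 0 by rewrite -psi iw lw subrr.
exists k => y; clearbody k.
suff H : pw l y - pw i y = k * side v w y by rewrite -H addrC subrK.
rewrite psi.
apply: (mulIf (lt0r_neq0 D0)).
transitivity ((k * dist2 v w) * side v w y); last by ring.
rewrite kD.
have -> : A * y.1 + B * y.2 + C = A * (y.1 - v.1) + B * (y.2 - v.2).
  by rewrite -[LHS]subr0 -e1; ring.
have e3 : A * (w.1 - v.1) + B * (w.2 - v.2) = 0.
  by transitivity ((A * w.1 + B * w.2 + C) - (A * v.1 + B * v.2 + C)); [ring|rewrite e1 e2 subrr].
transitivity ((B * (w.1 - v.1) - A * (w.2 - v.2)) * side v w y +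
  (A * (w.1 - v.1) + B * (w.2 - v.2)) *
    ((w.1 - v.1) * (y.1 - v.1) + (w.2 - v.2) * (y.2 - v.2))).
  by rewrite /dist2 /side; ring.
by rewrite e3; ring.
Qed.

Lemma seq_argmin (R : realType) (T : eqType) (f : T -> R) (s : seq T) :
  s != [::] -> exists2 a, a \in s & forall b, b \in s -> f a <= f b.
Proof.
elim: s => // a [|b s] IH _.
  by exists a => [|c]; rewrite mem_seq1 // => /eqP ->.
have [//|c cs cmin] := IH; have [ac|ca] := lerP (f a) (f c).
  exists a; first exact: mem_head.
  by move=> d; rewrite in_cons => /predU1P[->//|/cmin]; exact: le_trans.
exists c; first by rewrite in_cons cs orbT.
by move=> d; rewrite in_cons => /predU1P[->|/cmin//]; exact: ltW.
Qed.

Lemma continuous_lerp (R : realType) (x y : R * R) : continuous (fun t : R => lerp t x y).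
Proof.
have cl (p q : R) : continuous (fun t : R => (1 - t) * p + t * q).
  move=> t; apply: cvgD; apply: cvgM; try exact: cvg_cst; try exact: cvg_id.
  by apply: cvgB; [exact: cvg_cst|exact: cvg_id].
by move=> t; exact: (cvg_pair (cl _ _ t) (cl _ _ t)).
Qed.

Lemma intK_lerp (R : realType) (L : seq (R * R * R)) (x y : R * R) t :
  intK L x -> inK L y -> 0 <= t < 1 -> intK L (lerp t x y).
Proof.
move=> xL yL /andP[t0 t1] a aL; rewrite pw_lerp.
have a1 : 0 < (1 - t) * pw a x by rewrite mulr_gt0// ?xL//; lra.
have a2 : 0 <= t * pw a y by rewrite mulr_ge0// yL.
have a3 : 0 <= t * (1 - t) * dist2 x y.
  by apply: mulr_ge0; [apply: mulr_ge0; lra|exact: dist2_ge0].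
by lra.
Qed.

(* On a segment from an interior point to a point of D_i outside some D_j, the
   last point of the intersection lies on the boundary of a disk lower than D_i. *)
Lemma lowest_everywhere_sub (R : realType) (L : seq (R * R * R)) i x0 :
  i \in L -> intK L x0 ->
  (forall y, intK L y -> forall j, j \in L -> pw i y <= pw j y) ->
  forall j y, j \in L -> 0 <= pw i y -> 0 <= pw j y.
Proof.
move=> iL x0L ilow j y jL iy; rewrite leNgt; apply/negP => jy.
pose S : set R := [set t | (0 <= t <= 1) /\ inK L (lerp t x0 y)].
have cS : compact S.
  apply: (@subclosed_compact R S `[0, 1]%classic); last by move=> t [].
    rewrite (_ : S = `[0, 1]%classic `&`
        ((fun t => lerp t x0 y) @^-1` [set x | inK L x])).
      apply: closedI; first exact: interval_closed.
      apply: preimage_closed; last exact: closed_inK.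
      by move=> t _; exact: continuous_lerp.
    by apply/seteqP; split => t [] /= h1 h2; split => //; rewrite in_itv/= in h1 *.
  exact: segment_compact.
have [||t [/andP[t0 t1] tK] tmax] := @compact_min R _ (fun t => - t) S cS.
- by move=> t; apply: cvgN; exact: cvg_id.
- exists 0; split; first by rewrite lexx ler01.
  by move=> a /x0L; rewrite /lerp subr0 !mul1r !mul0r !addr0 -surjective_pairing => /ltW.
have {}t1 : t < 1.
  rewrite lt_neqAle t1 andbT; apply/eqP => tE; have := tK j jL.
  by rewrite tE /lerp subrr !mul1r !mul0r !add0r -surjective_pairing; lra.
pose z := lerp t x0 y; rewrite -/z in tK.
have [zL|] := pselect (intK L z).
  have [d d0 hd] := intK_square zL.
  pose M := `|y.1 - x0.1| + `|y.2 - x0.2| + 1.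
  have n1 := normr_ge0 (y.1 - x0.1); have n2 := normr_ge0 (y.2 - x0.2).
  have M0 : 0 < M by rewrite /M; lra.
  pose h := Num.min (1 - t) (d / M).
  have h0 : 0 < h by rewrite /h lt_min divr_gt0// subr_gt0 t1.
  have hM : h * M <= d by rewrite -ler_pdivlMr// /h ge_min lexx orbT.
  have h1 : h <= 1 - t by rewrite /h ge_min lexx.
  clearbody h.
  have : - t <= - (t + h).
    apply: tmax; split; first by apply/andP; split; lra.
    rewrite (_ : lerp (t + h) x0 y =
        (z.1 + h * (y.1 - x0.1), z.2 + h * (y.2 - x0.2))).
      apply: intK_inK; apply: hd; rewrite normrM gtr0_norm//.
        by apply: le_trans hM; rewrite ler_pM2l// /M; lra.
      by apply: le_trans hM; rewrite ler_pM2l// /M; lra.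
    by rewrite /z /lerp /=; congr pair; ring.
  by lra.
move=> /existsNP[l /not_implyP[lL /negP]]; rewrite -leNgt => lz.
have iz : 0 < pw i z.
  rewrite /z pw_lerp; have a1 : 0 < (1 - t) * pw i x0 by rewrite mulr_gt0// ?x0L//; lra.
  have a2 : 0 <= t * pw i y by rewrite mulr_ge0.
  have a3 : 0 <= t * (1 - t) * dist2 x0 y.
    by apply: mulr_ge0; [apply: mulr_ge0; lra|exact: dist2_ge0].
  by lra.
pose P := pw l x0 - pw i x0; pose N := pw i z - pw l z.
have P0 : 0 <= P by rewrite /P subr_ge0; exact: ilow.
have N0 : 0 < N by rewrite /N; lra.
(* On the segment from [x0] to [z], [pw l - pw i] goes from [P] to [- N]; at this [s < 1] it is
   [- (N / 2)], at a point that is still interior. *)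
pose s := (P + N / 2) / (P + N).
have sE : s * (P + N) = P + N / 2 by rewrite /s divfK//; lra.
have s0 : 0 <= s by rewrite divr_ge0//; lra.
have s1 : s < 1 by rewrite ltr_pdivrMr//; lra.
have s01 : 0 <= s < 1 by rewrite s0.
have := ilow _ (intK_lerp x0L tK s01) l lL.
have := pwB_lerp l i s x0 z; clearbody s; rewrite -/P.
have -> : pw l z - pw i z = - N by rewrite /N; ring.
by lra.
Qed.

(** The disk [i] is lowest at [x0] but not at some interior point [y]. Differences of [pw] being
    affine, the first crossing on the way to [y] is a point where [i] ties with another disk and
    both are lowest. *)
Lemma two_lowest (R : realType) (L : seq (R * R * R)) x0 :
  L != [::] -> intK L x0 ->
  (forall i, i \in L -> exists j, j \in L /\ ~ (forall y, 0 <= pw i y -> 0 <= pw j y)) ->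
  exists e i l, [/\ intK L e, i \in L, l \in L & i <> l /\
    pw i e = pw l e /\ forall j, j \in L -> pw i e <= pw j e].
Proof.
move=> L0 x0L ninc.
have [i iL imin] := seq_argmin (fun a => pw a x0) L0.
have [j [jL nij]] := ninc i iL.
have : ~ forall y, intK L y -> forall j, j \in L -> pw i y <= pw j y.
  by move=> /(lowest_everywhere_sub iL x0L) H; apply: nij => y; exact: H.
move=> /existsNP[y /not_implyP[yL /existsNP[j' /not_implyP[j'L /negP]]]].
rewrite -ltNge => j'y.
pose A l := pw l x0 - pw i x0; pose B l := pw i y - pw l y.
have A0 l : l \in L -> 0 <= A l by move=> lL; rewrite /A subr_ge0 imin.
(* Parameter at which [l] gets as low as [i]; it is meaningful for the [l] below [i] at [y],
   collected in [Lc]. *)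
pose tt l := A l / (A l + B l).
pose Lc := [seq l <- L | 0 < B l].
have Lc0 : Lc != [::].
  have : j' \in Lc by rewrite mem_filter j'L andbT /B; lra.
  by case: Lc.
have [l + lmin] := seq_argmin tt Lc0; rewrite mem_filter => /andP[Bl lL].
have tE k : k \in Lc -> [/\ 0 <= tt k, tt k < 1 & tt k * (A k + B k) = A k].
  rewrite mem_filter => /andP[Bk /A0 Ak].
  split; first by rewrite divr_ge0//; lra.
    by rewrite ltr_pdivrMr; lra.
  by rewrite /tt divfK//; lra.
have [|t0 t1 tA] := tE l; first by rewrite mem_filter Bl.
set t := tt l in lmin t0 t1 tA.
have low k : pw k (lerp t x0 y) - pw i (lerp t x0 y) = A k - t * (A k + B k).
  by rewrite pwB_lerp /A /B; ring.
exists (lerp t x0 y), i, l; split => //.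
  by apply: intK_lerp => //; [exact: intK_inK|rewrite t0].
split; first by move=> il; move: Bl; rewrite /B il subrr ltxx.
split; first by apply/eqP; rewrite eq_sym -subr_eq0 low tA subrr.
move=> k kL; rewrite -subr_ge0 low; have [Bk|Bk] := ltrP 0 (B k).
  have kLc : k \in Lc by rewrite mem_filter Bk.
  have [t0k t1k tAk] := tE k kLc.
  rewrite -[X in X - _]tAk -mulrBl mulr_ge0//; last by have := A0 k kL; lra.
  by rewrite subr_ge0; exact: lmin.
have a1 : 0 <= (1 - t) * A k by rewrite mulr_ge0 ?A0//; lra.
have a2 : 0 <= t * - B k by rewrite mulr_ge0//; lra.
by lra.
Qed.

Lemma third_element (T : eqType) (L : seq T) i l :
  uniq L -> (2 < size L)%N -> exists x, [/\ x \in L, x != i & x != l].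
Proof.
move=> uL sL; apply: contrapT => H.
have : (size L <= size [:: i; l])%N.
  apply: uniq_leq_size => // x xL; rewrite !inE; apply/negP => /negP.
  by rewrite negb_or => /andP[xi xl]; apply: H; exists x.
by rewrite leqNgt sL.
Qed.

(** D_i and D_l are themselves cut to opposite sides of their common chord. A third disk [x] either
    makes one of them a cutting disk with two nonempty parts, or contains a disk [m] of their
    pencil; then [x] splits off with [m], and the chord separates the others. *)
Lemma treelike_lens_chord (R : realType) n (L : seq (R * R * R)) x0 i l v w k :
  treelike_below R n -> (size L <= n.+1)%N -> (2 < size L)%N -> uniq L -> intK L x0 ->
  (forall i j, i \in L -> j \in L -> i != j -> ~ forall y, 0 <= pw i y -> 0 <= pw j y) ->
  i \in L -> l \in L -> i != l -> v <> w -> inK L v -> inK L w ->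
  pw i v = 0 -> pw i w = 0 -> pw l v = 0 -> pw l w = 0 -> 0 < k ->
  (forall y, pw l y = pw i y + k * side v w y) -> treelike L.
Proof.
move=> IH sL s2 uL x0L ninc iL lL il vw vK wK iv iw lv lw k0 lE.
have [x [xL xi xl]] := third_element i l uL s2.
have e1 : (1 : R) ^+ 2 = 1 := expr1n R 2.
have eN1 : (- 1 : R) ^+ 2 = 1 by rewrite sqrrN.
have li : l != i by rewrite eq_sym.
have cl y : 0 <= pw i y -> pw l y < 0 -> 0 < -1 * side v w y.
  rewrite lE => iy ly; rewrite mulN1r oppr_gt0 -(pmulr_rlt0 _ k0); lra.
have ci y : 0 <= pw l y -> pw i y < 0 -> 0 < 1 * side v w y.
  by rewrite lE mul1r => ly iy; rewrite -(pmulr_rgt0 _ k0); lra.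
have [cix|ncix] := pselect (cut (- 1) i v w x); last first.
  exact: (treelike_member_chord IH sL uL x0L iL eN1 vK wK iv iw vw lL xL li xi cl ncix).
have [clx|nclx] := pselect (cut 1 l v w x); last first.
  exact: (treelike_member_chord IH sL uL x0L lL e1 vK wK lv lw vw iL xL il xl ci nclx).
have [s [m [/andP[s0 s1] mE mx]]] :=
  pencil_inside vw iv iw k0 lE (vK x xL) (wK x xL) cix clx.
have mE' y : pw m y = (1 - s) * pw i y + s * pw l y by rewrite mE lE; ring.
have Km y : inK L y -> 0 <= pw m y.
  by move=> yK; rewrite mE' addr_ge0// mulr_ge0// ?yK//; lra.
have mv : pw m v = 0 by rewrite mE' iv lv !mulr0 addr0.
have mw : pw m w = 0 by rewrite mE' iw lw !mulr0 addr0.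
pose L' := rem x L.
have L'L : {subset L' <= L} by exact: mem_rem.
have Lm c : (c \in L') = (c != x) && (c \in L) by rewrite mem_rem_uniq.
(* When [m] is [i] itself, [i] is cut to both sides vacuously; the clause [c != i] forces it into
   [F2], which must be nonempty. *)
pose p c := `[< cut (- 1) m v w c >] && (c != i).
pose F1 := [seq c <- L' | p c].
pose F2 := [seq c <- L' | ~~ p c].
have sF : (size F1 + size F2 = (size L).-1)%N.
  by rewrite -(size_rem xL) !size_filter count_predC.
have cml : cut (- 1) m v w l.
  move=> y my ly; rewrite mulN1r oppr_gt0 -(pmulr_rlt0 _ k0).
  have : pw m y = pw l y - (1 - s) * (k * side v w y) by rewrite mE lE; ring.
  have [//|] := ltrP (k * side v w y) 0 => h.
  have : 0 <= (1 - s) * (k * side v w y) by rewrite mulr_ge0//; lra.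
  by lra.
have cmi : cut 1 m v w i.
  move=> y my iy; rewrite mul1r -(pmulr_rgt0 _ k0).
  have := mE y; have [//|] := ltrP 0 (k * side v w y) => h.
  have : 0 <= s * - (k * side v w y) by rewrite mulr_ge0//; lra.
  by lra.
have lF1 : l \in F1 by rewrite mem_filter Lm (eq_sym l) xl lL /p li !andbT; apply/asboolP.
have iF2 : i \in F2 by rewrite mem_filter Lm (eq_sym i) xi iL /p eqxx andbF.
have size_pos (T : eqType) (t : seq T) d : d \in t -> (0 < size t)%N by case: t.
have [l1 l2] := two_parts_lt sF (size_pos _ _ _ lF1) (size_pos _ _ _ iF2) sL.
apply: (treelike_add Km); apply: (@treelike_split R m [:: x] L').
- move=> d; rewrite !in_cons Lm.
  by have [->|] := eqVneq d x; rewrite ?xL ?orbT.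
- by move=> a b y; rewrite mem_seq1 => /eqP -> _ my; left; exact: mx.
- exact: (@treelike_pair R m x).
apply: (@treelike_split R m F1 F2).
- move=> d; rewrite !in_cons mem_cat [d \in F1]mem_filter [d \in F2]mem_filter.
  by case: (p d) => //=; rewrite ?orbF.
- apply: (@cut_separates R (- 1) m v w).
    by move=> d; rewrite mem_filter => /andP[/andP[/asboolP]].
  move=> d; rewrite mem_filter opprK negb_and negbK => /andP[+ /L'L dL].
  case/orP => [/asboolPn h|/eqP -> //].
  by have [] := cut_total e1 vw mv mw (vK d dL) (wK d dL).
- apply: (treelike_cons_below IH x0L Km) => //.
  by move=> d; rewrite mem_filter => /andP[_ /L'L].
- apply: (treelike_cons_below IH x0L Km) => //.
  by move=> d; rewrite mem_filter => /andP[_ /L'L].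
Qed.

Theorem treelike_common_interior (R : realType) (L : seq (R * R * R)) x0 :
  L != [::] -> intK L x0 -> treelike L.
Proof.
move: {2}(size L) (leqnn (size L)) => n; elim: n L x0 => [|n IH0] L x0 sL L0 x0L.
  by case: L sL L0 {x0L}.
have IH : treelike_below R n by exact: IH0.
have [uL|nuL] := boolP (uniq L); last first.
  apply: (@treelike_eq _ (undup L)); first exact: mem_undup.
  apply: (IH _ x0).
  - by rewrite -ltnS; apply: leq_trans sL; rewrite ltn_size_undup.
  - by apply: contra L0 => /eqP; case: (L) => // a s us; have := mem_undup (a :: s) a; rewrite us mem_head.
  - by move=> a; rewrite mem_undup; exact: x0L.
have [s2|s2] := leqP (size L) 2.
  case: L L0 s2 {sL x0L uL} => [//|a [|b [|]]//] _ _.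
    by apply: (@treelike_pair R a a) => d; rewrite !inE orbb.
  exact: (@treelike_pair R a b).
have [[i [j [iL jL ij inc]]]|ninc'] := pselect (exists i j, [/\ i \in L, j \in L, i != j &
    forall y, 0 <= pw i y -> 0 <= pw j y]).
  have iR : i \in rem j L by rewrite mem_rem_uniq// inE ij.
  (* A disk containing another one splits off, paired with it. *)
  apply: (@treelike_split R i [:: j] (rem j L)).
  - move=> d; rewrite !in_cons mem_rem_uniq// inE.
    have [->|di] := eqVneq d i; first by rewrite iL.
    by have [->|] := eqVneq d j; rewrite ?jL.
  - by move=> a b y; rewrite mem_seq1 => /eqP -> _ iy; left; exact: inc.
  - exact: (@treelike_pair R i j).
  apply: (@treelike_eq _ (rem j L)).
    by move=> d; rewrite in_cons; have [->|] := eqVneq d i; rewrite ?iR.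
  apply: (IH _ x0).
  - by rewrite size_rem//; case: (size L) sL.
  - by case: (rem j L) iR.
  - by move=> a /mem_rem; exact: x0L.
have ninc i j : i \in L -> j \in L -> i != j -> ~ forall y, 0 <= pw i y -> 0 <= pw j y.
  by move=> iL jL ij H; apply: ninc'; exists i, j.
have [[e [a [eL Ka alow]]]|nA] := pselect (exists e a, [/\ intK L e,
    forall x, inK L x -> 0 <= pw a x & forall i, i \in L -> pw a e < pw i e]).
  exact: (treelike_new_lowest IH sL L0 x0L eL Ka alow).
have [//|//|i iL|e [i [l [eL iL lL [il [ile imin]]]]]] := @two_lowest R L x0.
  have [j [jL ji _]] := third_element i i uL s2.
  by exists j; split => //; apply: ninc => //; rewrite eq_sym.
(* The mean of the two tied disks is also a lowest disk at [e]. Since [pw m] averages two functions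
   nonnegative on the intersection, its contact points lie on the boundaries of both D_i and D_l. *)
pose m := ((i.1.1 + l.1.1) / 2, (i.1.2 + l.1.2) / 2, (i.2 + l.2) / 2).
have mE x : pw m x = (pw i x + pw l x) / 2 by rewrite /pw /m /=; field.
have Km x : inK L x -> 0 <= pw m x.
  by move=> xK; rewrite mE divr_ge0// addr_ge0// xK.
have mmin a : (forall x, inK L x -> 0 <= pw a x) -> pw m e <= pw a e.
  move=> Ka; rewrite leNgt; apply/negP => am; apply: nA; exists e, a; split => // j jL.
  by have := imin j jL; move: am; rewrite mE -ile; lra.
have [v [w [vw vK wK mv mw]]] := lowest_two_contacts L0 eL Km mmin.
have [iv lv] : pw i v = 0 /\ pw l v = 0.
  by have := vK i iL; have := vK l lL; move: mv; rewrite mE; split; lra.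
have [iw lw] : pw i w = 0 /\ pw l w = 0.
  by have := wK i iL; have := wK l lL; move: mw; rewrite mE; split; lra.
have [k kE] := affine_on_line vw iv iw lv lw.
have il' : i != l by apply/eqP.
have [k0|k0|k0] := ltrgtP k 0.
- apply: (@treelike_lens_chord _ n L x0 i l w v (- k)) => //.
  + by move=> wv; apply: vw.
  + by rewrite oppr_gt0.
  + by move=> y; rewrite kE sideC; ring.
- exact: (@treelike_lens_chord _ n L x0 i l v w k).
- exfalso; apply: (ninc i l) => // y iy.
  by rewrite kE k0 mul0r addr0.
Qed.

(** * Kirszbraun's theorem for one additional point *)

Definition dot (R : realType) (x y : R * R * R) : R :=
  x.1.1 * y.1.1 + x.1.2 * y.1.2 + x.2 * y.2.

Lemma dotC (R : realType) (x y : R * R * R) : dot x y = dot y x.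
Proof. by rewrite /dot; ring. Qed.

Lemma dot_ge0 (R : realType) (x : R * R * R) : 0 <= dot x x.
Proof. by rewrite /dot -!expr2 !addr_ge0 ?sqr_ge0. Qed.

Lemma dot_eq0 (R : realType) (x y : R * R * R) : dot x x = 0 -> dot x y = 0.
Proof.
rewrite /dot -!expr2 => /eqP; rewrite !paddr_eq0 ?addr_ge0 ?sqr_ge0// !sqrf_eq0.
by move=> /andP[/andP[/eqP -> /eqP ->] /eqP ->]; ring.
Qed.

Lemma dot_CS (R : realType) (x y : R * R * R) : dot x y ^+ 2 <= dot x x * dot y y.
Proof.
rewrite -subr_ge0.
have -> : dot x x * dot y y - dot x y ^+ 2 =
  (x.1.1 * y.1.2 - x.1.2 * y.1.1) ^+ 2 + (x.1.2 * y.2 - x.2 * y.1.2) ^+ 2 +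
  (x.2 * y.1.1 - x.1.1 * y.2) ^+ 2 by rewrite /dot; ring.
by rewrite !addr_ge0 ?sqr_ge0.
Qed.

Definition wsum (R : realType) n (f : 'I_n -> R) (l : 'rV[R]_n) : R :=
  \sum_i l 0 i * f i.

Definition wcomb (R : realType) n (p : 'I_n -> R * R * R) (l : 'rV[R]_n) : R * R * R :=
  (wsum (fun i => (p i).1.1) l, wsum (fun i => (p i).1.2) l, wsum (fun i => (p i).2) l).

Lemma dot_wcomb (R : realType) n (p : 'I_n -> R * R * R) l x :
  dot x (wcomb p l) = wsum (fun i => dot x (p i)) l.
Proof.
rewrite /dot /wcomb /wsum /= !mulr_sumr -!big_split/=.
by apply: eq_bigr => i _; ring.
Qed.

Lemma wsum_ge (R : realType) n (f g : 'I_n -> R) (l : 'rV[R]_n) :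
  (forall i, 0 <= l 0 i) -> (forall i, f i <= g i) -> wsum f l <= wsum g l.
Proof. by move=> l0 fg; apply: ler_sum => i _; rewrite ler_wpM2l. Qed.

(** Both sides are double sums with the weights [l_i l_j >= 0]. *)
Lemma wcomb_gram (R : realType) n (p q : 'I_n -> R * R * R) (l : 'rV[R]_n) :
  (forall i, 0 <= l 0 i) -> (forall i j, dot (p i) (p j) <= dot (q i) (q j)) ->
  dot (wcomb p l) (wcomb p l) <= dot (wcomb q l) (wcomb q l).
Proof.
move=> l0 pq; rewrite !dot_wcomb; apply: wsum_ge => // i.
by rewrite dotC [leRHS]dotC !dot_wcomb; exact: wsum_ge.
Qed.

Lemma continuous_wsum (R : realType) n (f : 'I_n -> R) : continuous (wsum f).
Proof.
rewrite /wsum; elim: (index_enum _) => [|i r IH] l.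
  have -> : (fun l : 'rV[R]_n => \sum_(i <- [::]) l 0 i * f i) = cst 0.
    by apply/funext => l'; rewrite big_nil.
  exact: cst_continuous.
have -> : (fun l : 'rV[R]_n => \sum_(j <- i :: r) l 0 j * f j) =
    fun l : 'rV_n => l 0 i * f i + \sum_(j <- r) l 0 j * f j.
  by apply/funext => l'; rewrite big_cons.
have ci : {for l, continuous (fun l : 'rV[R]_n => l 0 i)} by exact: coord_continuous.
have h1 := continuousM ci (@cst_continuous _ _ (f i) l).
have h2 := IH l.
by have h3 := continuousD h1 h2; exact: h3.
Qed.

Definition simplex (R : realType) n : set 'rV[R]_n :=
  [set l | (forall i, 0 <= l 0 i) /\ \sum_i l 0 i = 1].

Lemma compact_simplex (R : realType) n : compact (@simplex R n).
Proof.
apply: (@subclosed_compact _ _ [set l : 'rV[R]_n | forall i, `[0, 1]%classic (l 0 i)]).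
- rewrite (_ : @simplex R n =
    (\bigcap_(i in [set: 'I_n]) [set l : 'rV[R]_n | 0 <= l 0 i]) `&`
    (wsum (fun=> 1) @^-1` [set 1])).
    apply: closedI.
      apply: closed_bigI => i _; apply: closed_le_preimage.
      exact: coord_continuous.
    apply: preimage_closed; last exact: closed_eq.
    by move=> l _; exact: continuous_wsum.
  have wl (l : 'rV[R]_n) : wsum (fun=> 1) l = \sum_i l 0 i.
    by apply: eq_bigr => i _; rewrite mulr1.
  apply/seteqP; split => l [] h1 h2; split.
  - by move=> i _; exact: h1.
  - by rewrite /= wl.
  - by move=> i; exact: h1.
  - by rewrite -wl.
- apply: (@rV_compact R n (fun=> `[0, 1]%classic)) => i.
  exact: segment_compact.
move=> l [l0 l1] i /=; rewrite in_itv/= l0/= -l1 (bigD1 i)//= lerDl sumr_ge0//.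
Qed.

(* For the weights minimising |sum l_i q_i| - sum l_i <c, p_i>, the unit vector
   in the direction of sum l_i q_i works. *)
Lemma kirszbraun_fin (R : realType) n (p q : 'I_n -> R * R * R) (x0 c : R * R * R) :
  (forall i, dot (q i) (q i) = 1) ->
  (forall i j, dot (p i) (p j) <= dot (q i) (q j)) ->
  (forall i, 0 < dot x0 (p i)) -> dot c c = 1 ->
  exists2 u, dot u u = 1 & forall i, dot c (p i) <= dot u (q i).
Proof.
case: n p q => [|n] p q q1 pq x0p c1; first by exists c => // -[].
pose a i := dot c (p i).
pose N2 l := dot (wcomb q l) (wcomb q l).
pose G l := Num.sqrt (N2 l) - wsum a l.
have cN2 : continuous N2.
  move=> l; have cw f := @continuous_wsum R n.+1 f l.
  exact: (continuousD (continuousD (continuousM (cw _) (cw _)) (continuousM (cw _) (cw _)))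
    (continuousM (cw _) (cw _))).
have cG : continuous G.
  move=> l; apply: (@continuousB _ _ _ (fun l => Num.sqrt (N2 l)) (wsum a)); last exact: continuous_wsum.
  by apply: continuous_comp; [exact: cN2|exact: sqrt_continuous].
have S0 : @simplex R n.+1 !=set0.
  exists (\row_j (j == ord0)%:R); split => [i|]; first by rewrite mxE ler0n.
  rewrite (bigD1 ord0)//= mxE eqxx big1 ?addr0// => j j0.
  by rewrite mxE (negbTE j0).
have [l [l0 l1] lmin] := compact_min (@compact_simplex R n.+1) cG S0.
pose P := wcomb p l; pose C := wcomb q l; pose A := wsum a l.
have PC : dot P P <= dot C C by exact: wcomb_gram.
(* The half-space condition: it keeps [P] away from 0, hence [C] too, so that [C] can be
   normalised. *)
have xP : 0 < dot x0 P.
  rewrite dot_wcomb /wsum.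
  have [i li] : exists i, 0 < l 0 i.
    apply: contrapT => H; move: l1; rewrite big1 => [/esym/eqP|i _]; first by rewrite oner_eq0.
    by apply/eqP; rewrite eq_le l0 andbT leNgt; apply/negP => li; apply: H; exists i.
  rewrite (bigD1 i)//=; apply: ltr_pwDl; first by rewrite mulr_gt0.
  by apply: sumr_ge0 => j _; rewrite mulr_ge0// ltW.
have P0 : 0 < dot P P.
  rewrite lt_neqAle dot_ge0 andbT eq_sym; apply/eqP => PP.
  by move: xP; rewrite dotC (dot_eq0 _ PP) ltxx.
have C0 : 0 < dot C C by exact: lt_le_trans PC.
pose N := Num.sqrt (dot C C).
have N0 : 0 < N by rewrite sqrtr_gt0.
have NN : N ^+ 2 = dot C C by rewrite sqr_sqrtr// ltW.
(* [A] is the product of the unit vector [c] with [P], hence at most |P|, which is at most |C|. *)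
have AN : A <= N.
  rewrite leNgt; apply/negP => NA.
  have : A ^+ 2 <= dot P P.
    by have := dot_CS c P; rewrite c1 mul1r /P dot_wcomb.
  rewrite leNgt => /negP; apply; apply: le_lt_trans PC _; rewrite -NN ltr_pXn2r// nnegrE ltW//.
  exact: lt_trans NA.
exists (N^-1 * C.1.1, N^-1 * C.1.2, N^-1 * C.2).
  transitivity (N^-1 ^+ 2 * dot C C); first by rewrite /dot /=; ring.
  by rewrite -NN -exprMn mulVf ?expr1n// gt_eqF.
move=> i; rewrite -/(a i); set u := (_, _, _).
pose D := dot C (q i).
have uD : dot u (q i) * N = D.
  rewrite /D; transitivity ((N^-1 * N) * dot C (q i)); first by rewrite /u /dot /=; ring.
  by rewrite mulVf ?mul1r// gt_eqF.
(* Minimality of [l] against moving it by [t] towards the vertex [i], divided by [t]; the square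
   root disappears through [2 N M <= M^2 + N^2]. Letting [t] tend to 0 gives the first-order
   condition [step0]. *)
have step t : 0 < t < 1 ->
    0 <= (- 2 + t) * N ^+ 2 + 2 * (1 - t) * D + t + 2 * N * (A - a i).
  move=> /andP[t0 t1].
  pose l' : 'rV[R]_n.+1 := \row_j ((1 - t) * l 0 j + t * (j == i)%:R).
  have wl' f : wsum f l' = (1 - t) * wsum f l + t * f i.
    rewrite /wsum mulr_sumr (bigD1 i)//= [in RHS](bigD1 i)//= mxE eqxx.
    rewrite mulr1 mulrDl -!addrA (mulrA (1 - t)); congr (_ + _).
    rewrite addrC; congr (_ + _); apply: eq_bigr => j ji.
    by rewrite mxE (negbTE ji) mulr0 addr0 mulrA.
  have Sl' : simplex l'.
    split => [j|]; first by rewrite mxE addr_ge0 ?mulr_ge0//; lra.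
    have := wl' (fun=> 1); rewrite /wsum; under eq_bigr do rewrite mulr1.
    by move=> ->; under eq_bigr do rewrite mulr1; rewrite l1; ring.
  have := lmin _ Sl'; rewrite /G -/A wl' -/A -/(N2 l).
  have N2l' : N2 l' = (1 - t) ^+ 2 * N ^+ 2 + 2 * t * (1 - t) * D + t ^+ 2.
    transitivity ((1 - t) ^+ 2 * N ^+ 2 + 2 * t * (1 - t) * D + t ^+ 2 * dot (q i) (q i)).
      by rewrite NN /D /N2 /dot /C /wcomb /= !wl'; ring.
    by rewrite q1 mulr1.
  set M := Num.sqrt (N2 l').
  have MM : M ^+ 2 = N2 l' by rewrite sqr_sqrtr// dot_ge0.
  have := sqr_ge0 (M - N); rewrite N2l' in MM.
  rewrite -[Num.sqrt _]/N => h1 h2.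
  have h3 : 0 <= 2 * N * (M - ((1 - t) * A + t * a i) - (N - A)).
    by rewrite mulr_ge0//; lra.
  rewrite -(pmulr_rge0 _ t0).
  have h4 : 2 * N * M <= M ^+ 2 + N ^+ 2 by move: h1; rewrite sqrrB; lra.
  rewrite MM in h4.
  by move: h3 h4; rewrite !mulrBr !mulrDr; nra.
have step0 : 0 <= - 2 * N ^+ 2 + 2 * D + 2 * N * (A - a i).
  rewrite leNgt; apply/negP => H.
  have [[]|[_ [d d0 hd]]|[]] := quadratic_near0
    (- 2 * N ^+ 2 + 2 * D + 2 * N * (A - a i)) (N ^+ 2 - 2 * D + 1) 0; [lra| |lra].
  pose t := Num.min d 1 / 2.
  have m0 : 0 < Num.min d 1 by rewrite lt_min d0 ltr01.
  have : 0 < t < Num.min d 1 by rewrite /t; apply/andP; split; lra.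
  clearbody t; rewrite lt_min => /and3P[t0 td t1].
  have := step t; rewrite t0 t1 => /(_ isT).
  by have := hd t; rewrite t0 td => /(_ isT); nra.
have : 0 <= N * (dot u (q i) - N + A - a i).
  rewrite (_ : N * _ = D - N ^+ 2 + N * (A - a i)); last by rewrite -uD; ring.
  by lra.
by rewrite pmulr_rge0//; lra.
Qed.

(** * Invariance of the area under reflections *)

Lemma tonelli_setX (R : realType) (A B : set R) (u : R * R -> R) :
  measurable A -> measurable B -> measurable_fun setT u ->
  (forall z, (A `*` B) z -> 0 <= u z) ->
  (\int[(@lebesgue_measure R \x @lebesgue_measure R)%E]_(z in A `*` B) (u z)%:E =
   \int[@lebesgue_measure R]_(x in A) \int[@lebesgue_measure R]_(y in B) (u (x, y))%:E)%E /\
  (\int[(@lebesgue_measure R \x @lebesgue_measure R)%E]_(z in A `*` B) (u z)%:E =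
   \int[@lebesgue_measure R]_(y in B) \int[@lebesgue_measure R]_(x in A) (u (x, y))%:E)%E.
Proof.
move=> mA mB mu u0; pose v := (fun z => (u z)%:E) \_ (A `*` B).
have mv : measurable_fun setT v.
  apply/(measurable_restrictT _ _).1; first exact: measurableX.
  by apply: measurable_funTS; apply/measurable_EFinP.
have v0 z : (0 <= v z)%E by apply: erestrict_ge0 => x; rewrite lee_fin; exact: u0.
split.
- transitivity (\int[@lebesgue_measure R]_x fubini_F (@lebesgue_measure R) v x)%E.
    by rewrite integral_mkcond; exact: (@fubini_tonelli1 _ _ _ _ R lebesgue_measure lebesgue_measure v mv v0).
  rewrite [RHS]integral_mkcond.
  apply: eq_integral => x _; rewrite /fubini_F patchE; case: ifPn => xA.
    rewrite [RHS]integral_mkcond; apply: eq_integral => y _; rewrite /v !patchE in_setX/=.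
    by rewrite xA.
  by apply: integral0_eq => y _; rewrite /v patchE in_setX/= (negbTE xA).
- transitivity (\int[@lebesgue_measure R]_y fubini_G (@lebesgue_measure R) v y)%E.
    by rewrite integral_mkcond; exact: (@fubini_tonelli2 _ _ _ _ R lebesgue_measure lebesgue_measure v mv v0).
  rewrite [RHS]integral_mkcond.
  apply: eq_integral => y _; rewrite /fubini_G patchE; case: ifPn => yB.
    rewrite [RHS]integral_mkcond; apply: eq_integral => x _; rewrite /v !patchE in_setX/=.
    by rewrite yB andbT.
  by apply: integral0_eq => x _; rewrite /v patchE in_setX/= (negbTE yB) andbF.
Qed.

Lemma substitution_decr (R : realType) (F F' G : R -> R) (a b : R) : a <= b ->
  (forall x : R, is_derive x 1 F (F' x)) -> continuous F' ->
  {in `[a, b] &, {homo F : x y /~ x < y}} -> continuous G ->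
  (\int[@lebesgue_measure R]_(x in `[F b, F a]) (G x)%:E =
   \int[@lebesgue_measure R]_(x in `[a, b]) (G (F x) * - F' x)%R%:E)%E.
Proof.
move=> ab dF cF' hF cG.
have FE : derive1 F = F' by apply/funext => x; rewrite derive1E; apply: derive_val.
have cF : continuous F.
  move=> x; apply: differentiable_continuous; apply/derivable1_diffP.
  exact: ex_derive.
have := @integration_by_substitution_decreasing R F G a b ab hF; rewrite FE; apply.
- by move=> x _; exact: cF'.
- by apply: cvgP; apply: cvg_at_right_filter; exact: cF'.
- by apply: cvgP; apply: cvg_at_left_filter; exact: cF'.
- split; first by move=> x _; exact: ex_derive.
    by apply: cvg_at_right_filter; exact: cF.
  by apply: cvg_at_left_filter; exact: cF.
- exact: continuous_subspaceT.
Qed.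

Lemma substitution_reflect (R : realType) (G : R -> R) (c a b : R) : a <= b -> continuous G ->
  (\int[@lebesgue_measure R]_(x in `[(c - b)%R, (c - a)%R]) (G x)%:E =
   \int[@lebesgue_measure R]_(x in `[a, b]) (G (c - x)%R)%:E)%E.
Proof.
move=> ab cG.
have dF (x : R) : is_derive x 1 (fun x => c - x) (-1).
  by apply: is_derive_eq; rewrite add0r mul1r.
transitivity (\int[@lebesgue_measure R]_(x in `[a, b]) (G (c - x) * - -1)%R%:E)%E.
  apply: (substitution_decr ab dF _ _ cG); first by move=> x; exact: cvg_cst.
  by move=> x y _ _ xy; rewrite ltrD2l ltrN2.
by apply: eq_integral => x _; rewrite opprK mulr1.
Qed.

Lemma integral_itv_split (R : realType) (G : R -> R) (a b c : R) : a <= b -> b <= c ->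
  measurable_fun setT G -> (forall x, a <= x <= c -> 0 <= G x) ->
  (\int[@lebesgue_measure R]_(x in `[a, c]) (G x)%:E =
   \int[@lebesgue_measure R]_(x in `[a, b]) (G x)%:E +
   \int[@lebesgue_measure R]_(x in `[b, c]) (G x)%:E)%E.
Proof.
move=> ab bc mG G0.
have mE (A : set R) : measurable_fun A (fun x => (G x)%:E).
  by apply: measurable_funTS; apply/measurable_EFinP.
rewrite -[in X in (_ + X)%E]integral_itv_obnd_cbnd//.
have -> : `[a, c]%classic = `[a, b]%classic `|` `]b, c]%classic :> set R.
  by rewrite -itv_bndbnd_setU ?bnd_simp.
rewrite ge0_integral_setU//=.
- exact: mE.
- move=> x; rewrite !in_itv/= lee_fin => H; apply: G0.
  by case: H => /andP[h1 h2]; apply/andP; split; lra.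
- by apply/disj_setPS => x /= []; rewrite !in_itv/= => /andP[h1 h2] /andP[h3 h4]; lra.
Qed.

(** The reflection [x -> c - x] preserves [[0, c]], and up to a period it preserves [[c, T]]. *)
Lemma integral_periodic_reflect (R : realType) (G : R -> R) (T c : R) : 0 <= c <= T ->
  continuous G -> (forall x, 0 <= G x) -> (forall x, G (T + x) = G x) ->
  (\int[@lebesgue_measure R]_(x in `[0%R, T]) (G (c - x)%R)%:E =
   \int[@lebesgue_measure R]_(x in `[0%R, T]) (G x)%:E)%E.
Proof.
move=> /andP[c0 cT] cG G0 GT.
have cG' : continuous (fun x => G (c - x)).
  move=> x; apply: (@continuous_comp _ _ _ (fun x => c - x) G); last exact: cG.
  by apply: cvgB; [exact: cvg_cst|exact: cvg_id].
rewrite (@integral_itv_split _ _ 0 c T)//; last exact: continuous_measurable_fun.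
rewrite (@integral_itv_split _ G 0 c T)//; last exact: continuous_measurable_fun.
congr (_ + _)%E.
  by rewrite -(@substitution_reflect _ G c 0 c)// subrr subr0.
transitivity (\int[@lebesgue_measure R]_(x in `[c, T]) (G (T + c - x)%R)%:E)%E.
  by apply: eq_integral => x _; rewrite -addrA GT.
by rewrite -(@substitution_reflect _ G (T + c) c T)// addrK addrAC subrr add0r.
Qed.

(** * The area integral and reflections preserving the polar axis *)

(** Integrands for which the changes of variables (continuity) and Tonelli's theorem (measurability
    and sign) both apply. *)
Definition goodf (R : realType) (f : R * R * R -> R) : Prop :=
  [/\ continuous f, measurable_fun setT f & forall x, 0 <= f x].

Definition sphp (R : realType) (theta phi : R) : R * R * R :=
  (sin theta * cos phi, sin theta * sin phi, cos theta).

Definition sint (R : realType) (f : R * R * R -> R) : \bar R :=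
  \int[(@lebesgue_measure R \x @lebesgue_measure R)%E]_(z in
      `[0%R, pi] `*` `[0%R, pi *+ 2])
    (f (sphp z.1 z.2) * sin z.1)%:E.

Lemma measurable_sin (R : realType) : measurable_fun [set: R] (@sin R).
Proof. by apply: continuous_measurable_fun; exact: continuous_sin. Qed.

Lemma measurable_cos (R : realType) : measurable_fun [set: R] (@cos R).
Proof. by apply: continuous_measurable_fun; exact: continuous_cos. Qed.

Lemma measurable_sphp (R : realType) :
  measurable_fun [set: R * R] (fun z => sphp z.1 z.2).
Proof.
have m1 : measurable_fun [set: R * R] (fun z => sin z.1).
  by apply: measurableT_comp; [exact: measurable_sin|exact: measurable_fst].
have m2 : measurable_fun [set: R * R] (fun z => cos z.2).
  by apply: measurableT_comp; [exact: measurable_cos|exact: measurable_snd].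
have m3 : measurable_fun [set: R * R] (fun z => sin z.2).
  by apply: measurableT_comp; [exact: measurable_sin|exact: measurable_snd].
have m4 : measurable_fun [set: R * R] (fun z => cos z.1).
  by apply: measurableT_comp; [exact: measurable_cos|exact: measurable_fst].
apply: measurable_fun_pair => //.
by apply: measurable_fun_pair; exact: measurable_funM.
Qed.

Lemma measurable_sint (R : realType) (f : R * R * R -> R) : measurable_fun setT f ->
  measurable_fun [set: R * R] (fun z => f (sphp z.1 z.2) * sin z.1).
Proof.
move=> mf; apply: measurable_funM.
  by apply: (measurableT_comp mf); exact: measurable_sphp.
by apply: measurableT_comp; [exact: measurable_sin|exact: measurable_fst].
Qed.

Lemma sint_ge0 (R : realType) (f : R * R * R -> R) (z : R * R) :
  (forall x, 0 <= f x) -> (`[0%R, pi] `*` `[0%R, pi *+ 2]) z ->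
  0 <= f (sphp z.1 z.2) * sin z.1.
Proof.
move=> f0 [/= + _]; rewrite in_itv/= => z1.
by apply: mulr_ge0; [exact: f0|apply: sin_ge0_pi].
Qed.

Lemma sint_iter (R : realType) (f : R * R * R -> R) :
  measurable_fun setT f -> (forall x, 0 <= f x) ->
  (sint f = \int[@lebesgue_measure R]_(t in `[0%R, pi])
      \int[@lebesgue_measure R]_(p in `[0%R, (pi *+ 2)%R]) (f (sphp t p) * sin t)%R%:E)%E /\
  (sint f = \int[@lebesgue_measure R]_(p in `[0%R, (pi *+ 2)%R])
      \int[@lebesgue_measure R]_(t in `[0%R, pi]) (f (sphp t p) * sin t)%R%:E)%E.
Proof.
move=> mf f0.
apply: (@tonelli_setX R `[0%R, pi]%classic `[0%R, pi *+ 2]%classic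
  (fun z => f (sphp z.1 z.2) * sin z.1)) => //.
  exact: measurable_sint.
by move=> z; exact: sint_ge0.
Qed.

(** Reflection in the vertical plane of azimuth [c / 2]; it sends the azimuth [phi] to [c - phi]. *)
Definition reflZ (R : realType) (c : R) (x : R * R * R) : R * R * R :=
  (cos c * x.1.1 + sin c * x.1.2, sin c * x.1.1 - cos c * x.1.2, x.2).

Lemma cvg_triple (R : realType) (T : topologicalType) (F : set_system T) (FF : Filter F)
  (a b c : T -> R) (a' b' c' : R) : a x @[x --> F] --> a' -> b x @[x --> F] --> b' ->
  c x @[x --> F] --> c' -> (a x, b x, c x) @[x --> F] --> (a', b', c').
Proof. by move=> ha hb hc; exact: (cvg_pair (cvg_pair ha hb) hc). Qed.

Lemma measurable_triple d (T : measurableType d) (R : realType) (a b c : T -> R) :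
  measurable_fun setT a -> measurable_fun setT b -> measurable_fun setT c ->
  measurable_fun setT (fun x => (a x, b x, c x)).
Proof. by move=> ma mb mc; do 2 ?[apply: measurable_fun_pair]. Qed.

Lemma sint_reflZ (R : realType) (f : R * R * R -> R) (c : R) :
  goodf f -> measurable_fun setT (f \o reflZ c) ->
  0 <= c <= pi *+ 2 -> sint (f \o reflZ c) = sint f.
Proof.
move=> [cf mf f0] mfc c02.
rewrite (sint_iter mfc _).1; last by move=> x; exact: f0.
rewrite (sint_iter mf f0).1; apply: eq_integral => t; rewrite inE/= in_itv/= => t0.
pose G p := f (sphp t p) * sin t.
transitivity (\int[@lebesgue_measure R]_(p in `[0%R, (pi *+ 2)%R]) (G (c - p)%R)%:E)%E.
  apply: eq_integral => p _; rewrite /G /=; congr ((f _ * _)%:E).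
  by rewrite /reflZ /sphp cosB sinB/=; congr (_, _, _); ring.
apply: (@integral_periodic_reflect R G (pi *+ 2) c c02).
- move=> p; apply: cvgM; last exact: cvg_cst.
  apply: (@continuous_comp _ _ _ (sphp t) f); last exact: cf.
  apply: cvg_triple; [apply: cvgM; [exact: cvg_cst|exact: continuous_cos]| |exact: cvg_cst].
  by apply: cvgM; [exact: cvg_cst|exact: continuous_sin].
- by move=> p; rewrite /G mulr_ge0// sin_ge0_pi.
- by move=> p; rewrite /G /sphp addrC sinD2pi cosD2pi.
Qed.

(** * Cylindrical coordinates and the exchange of two axes *)

Definition cyl (R : realType) (p z : R) : R * R * R :=
  (Num.sqrt (1 - z ^+ 2) * cos p, Num.sqrt (1 - z ^+ 2) * sin p, z).

Lemma continuous_sqr (R : realType) : continuous (fun x : R => x ^+ 2).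
Proof. by move=> x; exact: exprn_continuous. Qed.

Lemma continuous_sqrt1m (R : realType) (a : R) :
  continuous (fun x : R => Num.sqrt (a - x ^+ 2)).
Proof.
move=> x; apply: (@continuous_comp _ _ _ (fun x : R => a - x ^+ 2) Num.sqrt).
  by apply: cvgB; [exact: cvg_cst|exact: continuous_sqr].
exact: sqrt_continuous.
Qed.

Lemma measurable_sqrt (R : realType) : measurable_fun [set: R] (@Num.sqrt R).
Proof. by apply: continuous_measurable_fun; exact: sqrt_continuous. Qed.

Lemma measurable_cyl (R : realType) :
  measurable_fun [set: R * R] (fun w => cyl w.1 w.2).
Proof.
have m1 : measurable_fun [set: R * R] (fun w => Num.sqrt (1 - w.2 ^+ 2)).
  apply: (measurableT_comp (@measurable_sqrt R)); apply: measurable_funB => //.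
  by apply: measurable_funX; exact: measurable_snd.
apply: measurable_triple; last exact: measurable_snd.
- apply: measurable_funM => //.
  by apply: measurableT_comp; [exact: measurable_cos|exact: measurable_fst].
- apply: measurable_funM => //.
  by apply: measurableT_comp; [exact: measurable_sin|exact: measurable_fst].
Qed.

Lemma sqrt_1Bcos2 (R : realType) (t : R) : 0 <= t <= pi ->
  Num.sqrt (1 - cos t ^+ 2) = sin t.
Proof.
move=> t0; rewrite -[1](cos2Dsin2 t) addrAC subrr add0r sqrtr_sqr ger0_norm//.
exact: sin_ge0_pi.
Qed.

(** Archimedes: the substitution [z = cos t] absorbs the factor [sin t], so azimuth and height carry
    Lebesgue measure. *)
Lemma sint_cyl (R : realType) (f : R * R * R -> R) : goodf f ->
  (sint f = \int[@lebesgue_measure R]_(z in `[(-1)%R, 1%R])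
      \int[@lebesgue_measure R]_(p in `[0%R, (pi *+ 2)%R]) (f (cyl p z))%R%:E)%E.
Proof.
move=> [cf mf f0]; rewrite (sint_iter mf f0).2.
transitivity (\int[@lebesgue_measure R]_(p in `[0%R, (pi *+ 2)%R])
    \int[@lebesgue_measure R]_(z in `[(-1)%R, 1%R]) (f (cyl p z))%R%:E)%E; last first.
  have [||T1 T2] := @tonelli_setX R `[0%R, (pi *+ 2)]%classic `[-1, 1]%classic
    (fun w => f (cyl w.1 w.2)) (measurable_itv _) (measurable_itv _).
  - by apply: (measurableT_comp mf); exact: measurable_cyl.
  - by move=> z _; exact: f0.
  exact: etrans (esym T1) T2.
apply: eq_integral => p _.
have dcos (t : R) : is_derive t 1 cos (- sin t) by exact: is_derive_cos.
have := @substitution_decr R cos (fun t => - sin t) (fun z => f (cyl p z)) 0 pi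
  (pi_ge0 R) dcos.
rewrite cospi cos0 => ->.
- apply: eq_integral => t; rewrite inE/= in_itv/= => t0.
  by rewrite opprK /cyl sqrt_1Bcos2.
- by move=> t; apply: cvgN; exact: continuous_sin.
- by move=> x y xI yI; rewrite ltr_cos.
move=> z; apply: (@continuous_comp _ _ _ (cyl p) f); last exact: cf.
apply: cvg_triple; last exact: cvg_id.
  by apply: cvgM; [exact: continuous_sqrt1m|exact: cvg_cst].
by apply: cvgM; [exact: continuous_sqrt1m|exact: cvg_cst].
Qed.

Lemma normr_le_sqrt (R : realType) (x a : R) : 0 <= a ->
  (`|x| <= Num.sqrt a) = (x ^+ 2 <= a).
Proof. by move=> a0; rewrite -sqrtr_sqr ler_sqrt. Qed.

(* Orthogonal projection of the two hemispheres [y >= 0] and [y <= 0] onto the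
   [xz]-plane; the factor [|y|] cancels the Jacobian. *)
Lemma sint_proj (R : realType) (g : R * R * R -> R) : goodf g ->
  goodf (fun x => g x * `|x.1.2|) ->
  (sint (fun x => g x * `|x.1.2|)%R =
   \int[@lebesgue_measure R]_(z in `[(-1)%R, 1%R])
     \int[@lebesgue_measure R]_(x in `[(-1)%R, 1%R])
      (if x ^+ 2 + z ^+ 2 <= 1 then g (x, Num.sqrt (1 - z ^+ 2 - x ^+ 2), z) +
        g (x, - Num.sqrt (1 - z ^+ 2 - x ^+ 2), z) else 0)%R%:E)%E.
Proof.
move=> [cg mg g0] gg; rewrite (sint_cyl gg); apply: eq_integral => z.
rewrite inE/= in_itv/= => z1.
have a0 : 0 <= 1 - z ^+ 2.
  have : 0 <= (1 - z) * (1 + z) by case/andP: z1 => ? ?; rewrite mulr_ge0//; lra.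
  by rewrite expr2; lra.
set a := 1 - z ^+ 2 in a0 *; pose r := Num.sqrt a.
pose H (e x : R) := g (x, e * Num.sqrt (a - x ^+ 2), z).
have cH e : continuous (H e).
  move=> x; have h : {for x, continuous (fun x : R => (x, e * Num.sqrt (a - x ^+ 2), z))}.
    apply: cvg_triple; [exact: cvg_id| |exact: cvg_cst].
    by apply: cvgM; [exact: cvg_cst|exact: continuous_sqrt1m].
  exact: (continuous_comp h (cg _)).
have H0 e x : 0 <= H e x by exact: g0.
have rr : r ^+ 2 = a by rewrite sqr_sqrtr.
have r0 : 0 <= r by exact: sqrtr_ge0.
have rs p : 0 <= p <= pi -> Num.sqrt (a - (r * cos p) ^+ 2) = r * sin p.
  move=> p0; have -> : a - (r * cos p) ^+ 2 = (r * sin p) ^+ 2.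
    by rewrite !exprMn rr -{1}[a]mulr1 -(cos2Dsin2 p); ring.
  by rewrite sqrtr_sqr ger0_norm// mulr_ge0// sin_ge0_pi.
have dF (p : R) : is_derive p 1 (fun p => r * cos p) (- (r * sin p)).
  have h := @is_deriveZ R _ _ cos r p 1 (- sin p) (is_derive_cos p).
  by rewrite -mulrN; exact: h.
(* Substitution [x = r cos p] on the circle of height [z], where [r sin p] is the weight |y|; [e] is
   1 or -1 according to the hemisphere. The poles, where [r = 0], are treated apart since the
   substitution is not monotone there. *)
have half (e : R) :
    (\int[@lebesgue_measure R]_(p in `[0%R, pi]) (H e (r * cos p) * (r * sin p))%R%:E =
     \int[@lebesgue_measure R]_(x in `[(- r)%R, r]) (H e x)%:E)%E.
  have [r00|rn0] := eqVneq r 0.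
    rewrite r00 oppr0 set_itv1 integral_set1; apply: integral0_eq => p _.
    by rewrite !mul0r mulr0.
  have rp : 0 < r by rewrite lt_neqAle eq_sym rn0.
  have := @substitution_decr R (fun p => r * cos p) (fun p => - (r * sin p)) (H e) 0 pi
    (pi_ge0 R) dF.
  rewrite cospi cos0 mulr1 mulrN1 => ->//.
  - by apply: eq_integral => p _; rewrite opprK.
  - by move=> p; apply: cvgN; apply: cvgM; [exact: cvg_cst|exact: continuous_sin].
  - by move=> x y xI yI xy; rewrite ltr_pM2l// ltr_cos.
pose Q p := g (cyl p z) * `|(cyl p z).1.2|.
have Q1 (p : R) : 0 <= p <= pi -> Q p = H 1 (r * cos p) * (r * sin p).
  move=> p0; rewrite /Q /H rs// mul1r /cyl /= -/a -/r ger0_norm//.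
  by rewrite mulr_ge0// sin_ge0_pi.
have Q2 (p : R) : 0 <= p <= pi -> Q (pi *+ 2 - p) = H (- 1) (r * cos p) * (r * sin p).
  move=> p0; rewrite /Q /H rs// mulN1r /cyl /= -/a -/r addrC sinD2pi cosD2pi sinN cosN.
  by rewrite mulrN normrN ger0_norm// mulr_ge0// sin_ge0_pi.
have cQ : continuous Q.
  case: gg => cgg _ _ p.
  have h : {for p, continuous (fun p : R => cyl p (z : R))}.
    apply: cvg_triple; last exact: cvg_cst.
      by apply: cvgM; [exact: cvg_cst|exact: continuous_cos].
    by apply: cvgM; [exact: cvg_cst|exact: continuous_sin].
  exact: (continuous_comp h (cgg _)).
have Q0 p : 0 <= Q p by rewrite mulr_ge0.
have pi2 : pi <= pi *+ 2 :> R by rewrite mulr2n lerDl pi_ge0.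
transitivity (\int[@lebesgue_measure R]_(p in `[0%R, (pi *+ 2)%R]) (Q p)%:E)%E => //.
rewrite (@integral_itv_split R Q 0 pi (pi *+ 2))//; last 2 first.
- exact: pi_ge0.
- exact: continuous_measurable_fun.
have -> : (\int[@lebesgue_measure R]_(p in `[0%R, pi]) (Q p)%:E =
    \int[@lebesgue_measure R]_(x in `[(- r)%R, r]) (H 1 x)%:E)%E.
  rewrite -half; apply: eq_integral => p; rewrite inE/= in_itv/= => p0.
  by rewrite Q1.
have -> : (\int[@lebesgue_measure R]_(p in `[pi, (pi *+ 2)%R]) (Q p)%:E =
    \int[@lebesgue_measure R]_(x in `[(- r)%R, r]) (H (- 1) x)%:E)%E.
  have := @substitution_reflect R Q (pi *+ 2) 0 pi (pi_ge0 R) cQ.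
  rewrite subr0 mulr2n addrK => ->; rewrite -half.
  by apply: eq_integral => p; rewrite inE/= in_itv/= => p0; rewrite -mulr2n Q2.
have mH (e : R) (A : set R) : measurable_fun A (fun x => (H e x)%:E).
  by apply: measurable_funTS; apply/measurable_EFinP; exact: continuous_measurable_fun.
transitivity (\int[@lebesgue_measure R]_(x in `[(- r)%R, r]) ((H 1 x)%:E + (H (- 1) x)%:E))%E.
  apply/esym; apply: ge0_integralD => //.
  - by move=> x _; rewrite lee_fin.
  - exact: mH.
  - by move=> x _; rewrite lee_fin.
  - exact: mH.
rewrite integral_mkcond [RHS]integral_mkcond; apply: eq_integral => x _.
have mi (i : interval R) : ((x : R) \in [set` i]) = (x \in i).
  by apply/idP/idP => [/set_mem//|xi]; exact: mem_set.
rewrite !patchE !mi !in_itv/= -ler_norml.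
have -> : (x ^+ 2 + z ^+ 2 <= 1) = (`|x| <= r) by rewrite normr_le_sqrt// lerBrDr.
case: ifPn => xr; last by case: ifP.
rewrite ifT; first by rewrite /H mul1r mulN1r -EFinD.
rewrite -ler_norml; apply: le_trans xr _.
by rewrite -sqrtr1 ler_wsqrtr// /a lerBlDr lerDl sqr_ge0.
Qed.

Definition swapXZ (R : realType) (x : R * R * R) : R * R * R := (x.2, x.1.2, x.1.1).

Lemma continuous_triple (R : realType) (T : topologicalType) (a b c : T -> R) :
  continuous a -> continuous b -> continuous c -> continuous (fun x => (a x, b x, c x)).
Proof. by move=> ca cb cc x; apply: cvg_triple; [exact: ca|exact: cb|exact: cc]. Qed.

Lemma continuous_11 (R : realType) : continuous (fun x : R * R * R => x.1.1).
Proof.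
move=> x; have h : (y : R * R * R).1 @[y --> x] --> x.1 by exact: cvg_fst.
by apply: (cvg_comp _ _ h); exact: cvg_fst.
Qed.

Lemma continuous_12 (R : realType) : continuous (fun x : R * R * R => x.1.2).
Proof.
move=> x; have h : (y : R * R * R).1 @[y --> x] --> x.1 by exact: cvg_fst.
by apply: (cvg_comp _ _ h); exact: cvg_snd.
Qed.

Lemma continuous_2 (R : realType) : continuous (fun x : R * R * R => x.2).
Proof. by move=> x; exact: cvg_snd. Qed.

Lemma measurable_11 (R : realType) : measurable_fun setT (fun x : R * R * R => x.1.1).
Proof. by apply: measurableT_comp; [exact: measurable_fst|exact: measurable_fst]. Qed.

Lemma measurable_12 (R : realType) : measurable_fun setT (fun x : R * R * R => x.1.2).
Proof. by apply: measurableT_comp; [exact: measurable_snd|exact: measurable_fst]. Qed.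

Lemma measurable_2 (R : realType) : measurable_fun setT (fun x : R * R * R => x.2).
Proof. exact: measurable_snd. Qed.

Lemma goodf_comp (R : realType) (f : R * R * R -> R) (g : R * R * R -> R * R * R) :
  goodf f -> continuous g -> measurable_fun setT g -> goodf (f \o g).
Proof.
move=> [cf mf f0] cg mg; split; last by move=> x; exact: f0.
- by move=> x; apply: continuous_comp; [exact: cg|exact: cf].
- exact: measurableT_comp.
Qed.

Lemma goodfM (R : realType) (f g : R * R * R -> R) :
  goodf f -> goodf g -> goodf (fun x => f x * g x).
Proof.
move=> [cf mf f0] [cg mg g0]; split.
- by move=> x; apply: cvgM; [exact: cf|exact: cg].
- exact: measurable_funM.
- by move=> x; rewrite mulr_ge0.
Qed.

Lemma continuous_swapXZ (R : realType) : continuous (@swapXZ R).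
Proof.
by apply: continuous_triple; [exact: continuous_2|exact: continuous_12|exact: continuous_11].
Qed.

Lemma measurable_swapXZ (R : realType) : measurable_fun setT (@swapXZ R).
Proof.
by apply: measurable_triple; [exact: measurable_2|exact: measurable_12|exact: measurable_11].
Qed.

Lemma goodf_absY (R : realType) : goodf (fun x : R * R * R => `|x.1.2|).
Proof.
split=> //; last by apply: measurableT_comp => //; exact: measurable_12.
move=> x; apply: (@continuous_comp _ _ _ (fun x : R * R * R => x.1.2) (fun y : R => `|y|)).
  exact: continuous_12.
exact: norm_continuous.
Qed.

(** After projection both sides are integrals over the unit disk of the xz-plane, and Tonelli
    exchanges its two coordinates. *)
Lemma sint_swap_weighted (R : realType) (g : R * R * R -> R) : goodf g ->
  sint (fun x => g (swapXZ x) * `|x.1.2|) = sint (fun x => g x * `|x.1.2|).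
Proof.
move=> gg; have gs := goodf_comp gg (@continuous_swapXZ R) (@measurable_swapXZ R).
rewrite (sint_proj gs (goodfM gs (@goodf_absY R))) (sint_proj gg (goodfM gg (@goodf_absY R))).
case: gg => cg mg g0.
pose u (w : R * R) := if w.2 ^+ 2 + w.1 ^+ 2 <= 1 then
  g (w.2, Num.sqrt (1 - w.1 ^+ 2 - w.2 ^+ 2), w.1) +
  g (w.2, - Num.sqrt (1 - w.1 ^+ 2 - w.2 ^+ 2), w.1) else 0.
have mfst : measurable_fun [set: R * R] (fun w => w.1) by exact: measurable_fst.
have msnd : measurable_fun [set: R * R] (fun w => w.2) by exact: measurable_snd.
have ms : measurable_fun [set: R * R] (fun w => Num.sqrt (1 - w.1 ^+ 2 - w.2 ^+ 2)).
  apply: (measurableT_comp (@measurable_sqrt R)).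
  by do 2 ?[apply: measurable_funB => //]; apply: measurable_funX.
have mu : measurable_fun setT u.
  apply: measurable_fun_ifT => //.
    by apply: measurable_fun_ler => //; apply: measurable_funD; apply: measurable_funX.
  apply: measurable_funD; apply: (measurableT_comp mg); apply: measurable_triple => //.
  exact: measurableT_comp.
have u0 w : 0 <= u w by rewrite /u; case: ifP => // _; exact: addr_ge0.
have [||T1 T2] := @tonelli_setX R `[-1, 1]%classic `[-1, 1]%classic u
  (measurable_itv _) (measurable_itv _).
- exact: mu.
- by move=> w _; exact: u0.
rewrite [RHS](etrans (esym T1) T2).
apply: eq_integral => z _; apply: eq_integral => x _.
rewrite /u /swapXZ /= addrC; case: ifP => // _.
by rewrite addrAC.
Qed.

(** * Removing the weight by monotone convergence *)

Lemma sint_eq (R : realType) (f g : R * R * R -> R) :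
  (forall t p, f (sphp t p) = g (sphp t p)) -> sint f = sint g.
Proof. by move=> fg; apply: eq_integral => z _; rewrite fg. Qed.

Lemma measurable_box (R : realType) :
  measurable (`[0%R, pi]%classic `*` `[0%R, pi *+ 2]%classic : set (R * R)).
Proof. by apply: measurableX; exact: measurable_itv. Qed.

Lemma measurable_sintE (R : realType) (f : R * R * R -> R) (D : set (R * R)) :
  measurable_fun setT f ->
  measurable_fun D (fun z => (f (sphp z.1 z.2) * sin z.1)%:E).
Proof.
by move=> mf; apply: measurable_funTS; apply/measurable_EFinP; exact: measurable_sint.
Qed.

Lemma sint_cvg (R : realType) (F : nat -> R * R * R -> R) (G : R * R * R -> R) :
  (forall n, measurable_fun setT (F n)) -> (forall n x, 0 <= F n x) ->
  (forall x, nondecreasing_seq (F ^~ x)) -> (forall x, F n x @[n --> \oo] --> G x) ->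
  sint (F n) @[n --> \oo] --> sint G.
Proof.
move=> mF F0 ndF FG.
pose box := `[0%R, pi]%classic `*` `[0%R, pi *+ 2]%classic : set (R * R).
pose g n (z : R * R) := (F n (sphp z.1 z.2) * sin z.1)%:E.
have s0 z : box z -> 0 <= sin z.1.
  by move=> [+ _]; rewrite /= in_itv/=; exact: sin_ge0_pi.
have <- : (\int[(@lebesgue_measure R \x @lebesgue_measure R)%E]_(z in box)
    (limn (g ^~ z)) = sint G)%E.
  apply: eq_integral => z zB; apply/cvg_lim => //.
  apply: cvg_EFin; first by near=> n.
  by apply: cvgM; [exact: FG|exact: cvg_cst].
apply: cvg_monotone_convergence; first exact: measurable_box.
- by move=> n; exact: measurable_sintE.
- by move=> n z zB; rewrite lee_fin mulr_ge0// s0.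
- by move=> z zB m n mn; rewrite lee_fin ler_wpM2r ?s0// ndF.
Unshelve. all: by end_near. Qed.

(** Continuous functions increasing with [n] to the indicator of [a != 0], and whose quotient by |a|
    extends continuously to 0: multiplying by [ramp n y] is multiplying by |y| and a continuous
    factor. *)
Definition ramp (R : realType) (n : nat) (a : R) : R :=
  n.+1%:R * `|a| / (1 + n.+1%:R * `|a|).

Lemma ramp_den_gt0 (R : realType) n (a : R) : 0 < 1 + n.+1%:R * `|a|.
Proof. by rewrite ltr_pwDl// mulr_ge0. Qed.

Lemma rampE (R : realType) n (a : R) : ramp n a = 1 - (1 + n.+1%:R * `|a|)^-1.
Proof.
have h := ramp_den_gt0 n a; apply: (mulIf (lt0r_neq0 h)).
by rewrite /ramp divfK ?lt0r_neq0// mulrBl mul1r mulVf ?lt0r_neq0// addrC addKr.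
Qed.

Lemma ramp_ge0 (R : realType) n (a : R) : 0 <= ramp n a.
Proof. by rewrite divr_ge0 ?addr_ge0 ?mulr_ge0. Qed.

Lemma nondecreasing_ramp (R : realType) (a : R) : nondecreasing_seq (fun n => ramp n a).
Proof.
move=> m n mn; rewrite !rampE lerD2l lerN2 lef_pV2 ?posrE ?ramp_den_gt0//.
by rewrite lerD2l ler_wpM2r// ler_nat.
Qed.

Lemma cvg_ramp (R : realType) (a : R) : ramp n a @[n --> \oo] --> ((a != 0)%:R : R).
Proof.
have [->|a0] := eqVneq a 0.
  under eq_fun do rewrite /ramp normr0 mulr0 mul0r.
  exact: cvg_cst.
have {}a0 : 0 < `|a| by rewrite normr_gt0.
rewrite -[X in _ --> X]subr0; under eq_fun do rewrite rampE.
apply: cvgB; first exact: cvg_cst.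
apply: (@squeeze_cvgr _ _ _ _ (fun=> 0) (fun n => `|a|^-1 * harmonic n)).
- near=> n; rewrite invr_ge0 (ltW (ramp_den_gt0 n a))/=.
  rewrite /harmonic -invfM lef_pV2 ?posrE ?ramp_den_gt0 ?mulr_gt0//.
  by rewrite mulrC lerDr.
- exact: cvg_cst.
- by rewrite -[X in _ --> X](mulr0 `|a|^-1); apply: cvgM; [exact: cvg_cst|exact: cvg_harmonic].
Unshelve. all: by end_near. Qed.

Lemma continuous_den (R : realType) n : continuous (fun a : R => (1 + n.+1%:R * `|a|)^-1).
Proof.
move=> a; apply: cvgV; first by rewrite lt0r_neq0// ramp_den_gt0.
apply: cvgD; first exact: cvg_cst.
by apply: cvgM; [exact: cvg_cst|exact: norm_continuous].
Qed.

Lemma continuous_ramp (R : realType) n : continuous (@ramp R n).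
Proof.
move=> a; apply: cvgM; last exact: continuous_den.
by apply: cvgM; [exact: cvg_cst|exact: norm_continuous].
Qed.

Lemma goodf_R (R : realType) (u : R -> R) (h : R * R * R -> R) :
  continuous u -> (forall a, 0 <= u a) -> continuous h -> measurable_fun setT h ->
  goodf (u \o h).
Proof.
move=> cu u0 ch mh; split; last by move=> x; exact: u0.
- by move=> x; apply: continuous_comp; [exact: ch|exact: cu].
- by apply: measurableT_comp => //; exact: continuous_measurable_fun.
Qed.

Lemma sint_swap_offY (R : realType) (f : R * R * R -> R) : goodf f ->
  sint (fun x => f (swapXZ x) * (x.1.2 != 0)%:R) = sint (fun x => f x * (x.1.2 != 0)%:R).
Proof.
move=> gf; have gs := goodf_comp gf (@continuous_swapXZ R) (@measurable_swapXZ R).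
have lim (g : R * R * R -> R) : goodf g ->
    sint (fun x => g x * ramp n x.1.2) @[n --> \oo] --> sint (fun x => g x * (x.1.2 != 0)%:R).
  move=> gg; have gr n := goodfM gg (goodf_R (@continuous_ramp R n) (@ramp_ge0 R n)
    (@continuous_12 R) (@measurable_12 R)).
  apply: sint_cvg.
  - by move=> n; case: (gr n).
  - by move=> n x; case: (gr n).
  - by case: gg => _ _ g0 x m n mn; rewrite ler_wpM2l// nondecreasing_ramp.
  - by move=> x; apply: cvgM; [exact: cvg_cst|exact: cvg_ramp].
apply: (cvg_unique (@ereal_hausdorff R) (lim _ gs)).
have -> : (fun n => sint (fun x => (f \o @swapXZ R) x * ramp n x.1.2)) =
    (fun n => sint (fun x => f x * ramp n x.1.2)); last exact: lim.
apply/funext => n.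
pose g (x : R * R * R) := f x * (n.+1%:R * (1 + n.+1%:R * `|x.1.2|)^-1).
have gg : goodf g.
  apply: (goodfM gf); apply: (@goodf_R R (fun a => n.+1%:R * (1 + n.+1%:R * `|a|)^-1)).
  - by move=> a; apply: cvgM; [exact: cvg_cst|exact: continuous_den].
  - by move=> a; rewrite mulr_ge0// invr_ge0 ltW// ramp_den_gt0.
  - exact: continuous_12.
  - exact: measurable_12.
transitivity (sint (fun x => g (swapXZ x) * `|x.1.2|)).
  by apply: sint_eq => t p; rewrite /g /ramp /=; ring.
rewrite (sint_swap_weighted gg).
by apply: sint_eq => t p; rewrite /g /ramp /=; ring.
Qed.

(** The great circle [y = 0] is negligible: if [sin t] is nonzero only the azimuths 0, pi and 2 pi
    lie on it, and otherwise the area element vanishes. *)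
Lemma sint_offY (R : realType) (f : R * R * R -> R) : goodf f ->
  sint (fun x => f x * (x.1.2 != 0)%:R) = sint f.
Proof.
move=> [cf mf f0].
have mY : measurable_fun setT (fun x : R * R * R => (x.1.2 != 0)%:R : R).
  rewrite (_ : (fun _ => _) = (fun x : R * R * R => if x.1.2 == 0 then 0 else 1)).
    by apply: measurable_fun_ifT => //; apply: measurable_fun_eqr => //; exact: measurable_12.
  by apply/funext => x; case: eqP.
have mfY : measurable_fun setT (fun x : R * R * R => f x * (x.1.2 != 0)%:R).
  exact: measurable_funM.
rewrite (sint_iter mfY _).1; last by move=> x; rewrite mulr_ge0.
rewrite (sint_iter mf f0).1; apply: eq_integral => t /set_mem; rewrite /= in_itv/= => t0.
have [st|st] := eqVneq (sin t) 0.
  by apply: eq_integral => p _; rewrite st !mulr0.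
pose N := [set 0; pi; pi *+ 2 : R].
have mN : measurable N by do 2 ?[apply: measurableU => //].
have N0 : lebesgue_measure N = 0%E.
  apply: countable_lebesgue_measure0; apply: finite_set_countable.
  by rewrite /N !finite_setU; do 2 ?split.
have ms (h : R * R * R -> R) : measurable_fun setT h ->
    measurable_fun `[0, pi *+ 2] (fun p : R => (h (sphp t p) * sin t)%:E).
  move=> mh; apply: measurable_funTS; apply/measurable_EFinP.
  have m2 : measurable_fun [set: R] (fun p : R => (t, p)) by exact: pair1_measurable.
  exact: (measurableT_comp (measurable_sint mh) m2).
have sp0 : 0 <= sin t by exact: sin_ge0_pi.
have negl (h : R * R * R -> R) : measurable_fun setT h -> (forall x, 0 <= h x) ->
    (\int[@lebesgue_measure R]_(p in `[0%R, (pi *+ 2)%R]) (h (sphp t p) * sin t)%R%:E =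
     \int[@lebesgue_measure R]_(p in `[0%R, (pi *+ 2)%R] `\` N) (h (sphp t p) * sin t)%R%:E)%E.
  move=> mh h0; apply: ge0_negligible_integral => //; first exact: ms.
  by move=> p _; rewrite lee_fin mulr_ge0.
rewrite (negl _ mf f0) (negl _ mfY) => [|x]; last by rewrite mulr_ge0.
apply: eq_integral => p /set_mem[]; rewrite /= in_itv/= => /andP[p0 p2] Np.
rewrite mulf_neq0 ?mulr1//.
have [pp|pp] := ltrP p pi.
  rewrite lt0r_neq0// sin_gt0_pi// pp andbT lt_neqAle p0 andbT; apply/eqP => p00.
  by apply: Np; left; left.
have : 0 < sin (pi *+ 2 - p).
  apply: sin_gt0_pi; rewrite subr_gt0 lt_neqAle p2 andbT; apply/andP; split.
    by apply/eqP => pE; apply: Np; right.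
  have [pE|pE] := eqVneq p pi; first by exfalso; apply: Np; left; right.
  by rewrite ltrBlDr mulr2n ltrD2l lt_neqAle eq_sym pE.
by rewrite addrC sinD2pi sinN oppr_gt0 => /ltr0_neq0.
Qed.

Lemma sint_swapXZ (R : realType) (f : R * R * R -> R) : goodf f ->
  sint (f \o @swapXZ R) = sint f.
Proof.
move=> gf; have gs := goodf_comp gf (@continuous_swapXZ R) (@measurable_swapXZ R).
by rewrite -(sint_offY gs) -(sint_offY gf) -sint_swap_offY.
Qed.

(** * Reflections in arbitrary planes *)

Definition refl (R : realType) (n x : R * R * R) : R * R * R :=
  (x.1.1 - 2 * dot x n * n.1.1, x.1.2 - 2 * dot x n * n.1.2, x.2 - 2 * dot x n * n.2).

Lemma dot_refl (R : realType) (n x y : R * R * R) : dot (refl n x) y = dot x (refl n y).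
Proof. by rewrite /dot /refl /dot /=; ring. Qed.

Lemma refl_invol (R : realType) (n x : R * R * R) : dot n n = 1 -> refl n (refl n x) = x.
Proof.
move=> n1; have d : dot (refl n x) n = - dot x n.
  transitivity (dot x n - 2 * dot x n * dot n n); first by rewrite /dot /refl /dot /=; ring.
  by rewrite n1; ring.
rewrite {1}/refl d [RHS]surjective_pairing [x.1 in RHS]surjective_pairing.
by rewrite /refl /=; congr (_, _, _); ring.
Qed.

Lemma refl_isom (R : realType) (n x y : R * R * R) : dot n n = 1 ->
  dot (refl n x) (refl n y) = dot x y.
Proof. by move=> n1; rewrite dot_refl refl_invol. Qed.

Lemma refl_conj (R : realType) (m n x : R * R * R) : dot m m = 1 ->
  refl n x = refl m (refl (refl m n) (refl m x)).
Proof.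
move=> m1.
have h (k : R) (u v : R * R * R) :
    refl m (u.1.1 - k * v.1.1, u.1.2 - k * v.1.2, u.2 - k * v.2) =
    ((refl m u).1.1 - k * (refl m v).1.1, (refl m u).1.2 - k * (refl m v).1.2,
     (refl m u).2 - k * (refl m v).2).
  by rewrite /refl /dot /=; congr (_, _, _); ring.
have E (u v : R * R * R) : refl v u = (u.1.1 - 2 * dot u v * v.1.1, u.1.2 - 2 * dot u v * v.1.2,
    u.2 - 2 * dot u v * v.2) by [].
by rewrite (E (refl m x) (refl m n)) h (refl_isom _ _ m1) !refl_invol.
Qed.

Lemma continuous_dot (R : realType) (n : R * R * R) : continuous (fun x => dot x n).
Proof.
move=> x; apply: cvgD; last by apply: cvgM; [exact: continuous_2|exact: cvg_cst].
apply: cvgD; apply: cvgM; try exact: cvg_cst.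
  exact: continuous_11.
exact: continuous_12.
Qed.

Lemma measurable_dot (R : realType) (n : R * R * R) : measurable_fun setT (fun x => dot x n).
Proof.
apply: measurable_funD; last by apply: measurable_funM => //; exact: measurable_2.
apply: measurable_funD; apply: measurable_funM => //.
  exact: measurable_11.
exact: measurable_12.
Qed.

Lemma continuous_refl (R : realType) (n : R * R * R) : continuous (refl n).
Proof.
have ck (k : R) : continuous (fun x => 2 * dot x n * k).
  move=> x; apply: cvgM; last exact: cvg_cst.
  by apply: cvgM; [exact: cvg_cst|exact: continuous_dot].
apply: continuous_triple => x; apply: cvgB; try exact: ck.
- exact: continuous_11.
- exact: continuous_12.
- exact: continuous_2.
Qed.

Lemma measurable_refl (R : realType) (n : R * R * R) : measurable_fun setT (refl n).
Proof.
have mk (k : R) : measurable_fun setT (fun x => 2 * dot x n * k).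
  by apply: measurable_funM => //; apply: measurable_funM => //; exact: measurable_dot.
apply: measurable_triple; apply: measurable_funB => //.
  exact: measurable_11.
exact: measurable_12.
Qed.

Lemma exists_angle (R : realType) (a b : R) : a ^+ 2 + b ^+ 2 = 1 ->
  exists c : R, [/\ 0 <= c <= pi *+ 2, cos c = a & sin c = b].
Proof.
move=> ab; have a1 : -1 <= a <= 1.
  have := sqr_ge0 b; rewrite -ler_norml => b0.
  rewrite -[1]normr1 -ler_sqr ?nnegrE// !real_normK ?num_real// expr1n; lra.
have ac : cos (acos a) = a by rewrite acosK// in_itv.
have as_ : sin (acos a) = `|b|.
  by rewrite sin_acos// -sqrtr_sqr; congr Num.sqrt; lra.
have c0 := acos_ge0 a1; have cpi := acos_lepi a1; have pi0 := pi_ge0 R.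
have [b0|b0] := lerP 0 b.
  exists (acos a); split => //; last by rewrite as_ ger0_norm.
  by rewrite c0 mulr2n; lra.
exists (pi *+ 2 - acos a); split.
- by rewrite mulr2n; apply/andP; split; lra.
- by rewrite addrC cosD2pi cosN.
- by rewrite addrC sinD2pi sinN as_ ltr0_norm// opprK.
Qed.

Lemma sint_refl_horizontal (R : realType) (n : R * R * R) (f : R * R * R -> R) :
  dot n n = 1 -> n.2 = 0 -> goodf f -> sint (f \o refl n) = sint f.
Proof.
move=> n1 n20 gf.
have h : n.1.1 ^+ 2 + n.1.2 ^+ 2 = 1.
  by move: n1; rewrite /dot n20 mulr0 addr0 -!expr2.
(* If [n] has azimuth [a], the mirror has azimuth [a + pi / 2], so [c] is [2 a + pi]; these are its
   cosine and sine. *)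
have [|c [c02 cc sc]] := @exists_angle R (n.1.2 ^+ 2 - n.1.1 ^+ 2) (- (2 * n.1.1 * n.1.2)).
  transitivity ((n.1.1 ^+ 2 + n.1.2 ^+ 2) ^+ 2); first by ring.
  by rewrite h expr1n.
have E : refl n = reflZ c.
  apply/funext => x; rewrite /refl /reflZ cc sc /dot n20 !mulr0 addr0 subr0.
  have k (y : R) : y = (n.1.1 ^+ 2 + n.1.2 ^+ 2) * y by rewrite h mul1r.
  congr (_, _, _).
    by rewrite [X in X - _ = _]k; ring.
  by rewrite [X in X - _ = _]k; ring.
rewrite E; apply: sint_reflZ => //; rewrite -E.
by case: gf => _ mf _; apply: measurableT_comp => //; exact: measurable_refl.
Qed.

(** A normal with first coordinate 0 becomes horizontal when x and z are exchanged. Any other normal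
    is brought to this case by conjugating with a reflection whose normal [m] is horizontal. *)
Lemma sint_refl (R : realType) (n : R * R * R) (f : R * R * R -> R) :
  dot n n = 1 -> goodf f -> sint (f \o refl n) = sint f.
Proof.
have gr (m : R * R * R) g : goodf g -> goodf (g \o refl m).
  by move=> gg; exact: (goodf_comp gg (@continuous_refl R m) (@measurable_refl R m)).
have case0 (m : R * R * R) g : dot m m = 1 -> m.1.1 = 0 -> goodf g ->
    sint (g \o refl m) = sint g.
  move=> m1 m0 gg; pose g' := g \o @swapXZ R.
  have gg' : goodf g' by exact: (goodf_comp gg (@continuous_swapXZ R) (@measurable_swapXZ R)).
  have s1 : dot (swapXZ m) (swapXZ m) = 1 by rewrite -m1 /dot /swapXZ /=; ring.
  have -> : g \o refl m = (g' \o refl (swapXZ m)) \o @swapXZ R.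
    apply/funext => x; rewrite /g' /=; congr g.
    by rewrite /refl /swapXZ /dot /=; congr (_, _, _); ring.
  rewrite (sint_swapXZ (gr _ _ gg')) (sint_refl_horizontal s1 m0 gg').
  exact: sint_swapXZ.
move=> n1 gf; have [n0|n0] := eqVneq n.1.1 0; first exact: case0.
pose r := Num.sqrt (n.1.1 ^+ 2 + n.1.2 ^+ 2).
have rr : r ^+ 2 = n.1.1 ^+ 2 + n.1.2 ^+ 2 by rewrite sqr_sqrtr// addr_ge0 ?sqr_ge0.
pose d2 := n.1.1 ^+ 2 + (n.1.2 - r) ^+ 2.
have d20 : 0 < d2 by rewrite ltr_pwDl ?sqr_ge0// exprn_even_gt0.
pose d := Num.sqrt d2.
have dd : d ^+ 2 = d2 by rewrite sqr_sqrtr// ltW.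
have d0 : d != 0 by rewrite sqrtr_eq0 -ltNge.
(* The reflection with this normal sends the horizontal part of [n] to [(0, r)]. *)
pose m := (n.1.1 / d, (n.1.2 - r) / d, 0 : R).
have m1 : dot m m = 1.
  transitivity (d2 / d ^+ 2); last by rewrite dd divff// lt0r_neq0.
  by rewrite /dot /m /d2 /=; field.
have k1 : 2 * (n.1.1 ^+ 2 + n.1.2 * (n.1.2 - r)) = d2 by rewrite /d2 sqrrB rr; ring.
have mn : (refl m n).1.1 = 0.
  transitivity (n.1.1 * (1 - (2 * (n.1.1 ^+ 2 + n.1.2 * (n.1.2 - r))) / d ^+ 2)).
    by rewrite /refl /dot /m /=; field.
  by rewrite k1 dd divff ?lt0r_neq0// subrr mulr0.
have n'1 : dot (refl m n) (refl m n) = 1 by rewrite refl_isom.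
have -> : f \o refl n = ((f \o refl m) \o refl (refl m n)) \o refl m.
  by apply/funext => x /=; rewrite -(refl_conj n x m1).
rewrite (sint_refl_horizontal m1 (erefl _) (gr _ _ (gr _ _ gf))).
rewrite (case0 _ _ n'1 mn (gr _ _ gf)).
exact: sint_refl_horizontal.
Qed.

(** * Areas of intersections of caps *)

Lemma sint_mono (R : realType) (f g : R * R * R -> R) :
  measurable_fun setT f -> measurable_fun setT g -> (forall x, 0 <= f x) ->
  (forall t p, f (sphp t p) <= g (sphp t p)) -> (sint f <= sint g)%E.
Proof.
move=> mf mg f0 fg; apply: ge0_le_integral.
- exact: measurable_box.
- by move=> z zB; rewrite lee_fin sint_ge0.
- exact: measurable_sintE.
- exact: measurable_sintE.
- move=> z [+ _]; rewrite /= in_itv/= => z0; rewrite lee_fin ler_wpM2r//.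
  exact: sin_ge0_pi.
Qed.

Lemma sint_pos (R : realType) (f : R * R * R -> R) :
  (forall x, 0 <= f x) -> (0 <= sint f)%E.
Proof. by move=> f0; apply: integral_ge0 => z zB; rewrite lee_fin sint_ge0. Qed.

Lemma sintD (R : realType) (f g : R * R * R -> R) :
  measurable_fun setT f -> measurable_fun setT g ->
  (forall x, 0 <= f x) -> (forall x, 0 <= g x) ->
  (sint (fun x => (f x + g x)%R) = sint f + sint g)%E.
Proof.
move=> mf mg f0 g0.
rewrite /sint -ge0_integralD; first last.
- exact: measurable_sintE.
- by move=> z zB; rewrite lee_fin sint_ge0.
- exact: measurable_sintE.
- by move=> z zB; rewrite lee_fin sint_ge0.
- exact: measurable_box.
- by apply: eq_integral => z _; rewrite mulrDl EFinD.
Qed.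

Lemma sint_cst1 (R : realType) : (sint (fun _ => 1%R : R) < +oo)%E.
Proof.
have le1 : (sint (fun _ => 1%R : R) <=
    \int[(@lebesgue_measure R \x @lebesgue_measure R)%E]_(z in
      `[0%R, pi] `*` `[0%R, (pi *+ 2)%R]) (cst 1%E z))%E.
  apply: ge0_le_integral.
  - exact: measurable_box.
  - by move=> z zB; rewrite lee_fin; exact: (@sint_ge0 R (fun=> 1)).
  - by apply: (@measurable_sintE R (fun=> 1)); exact: measurable_cst.
  - exact: measurable_cst.
  - by move=> z _; rewrite lee_fin mul1r sin_le1.
apply: (le_lt_trans le1).
rewrite integral_cst ?mul1e; last exact: measurable_box.
have [m1 m2] : measurable `[0%R, (pi : R)]%classic /\ measurable `[0%R, (pi *+ 2 : R)]%classic.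
  by split; exact: measurable_itv.
apply: (@le_lt_trans _ _ (lebesgue_measure `[0%R, (pi : R)]%classic *
    lebesgue_measure `[0%R, (pi *+ 2 : R)%R]%classic)%E).
  by have <- := @product_measure1E _ _ _ _ R (@lebesgue_measure R) (@lebesgue_measure R) _ _ m1 m2.
rewrite !lebesgue_measure_itv /= !lte_fin.
by do 2 case: ifP => _; rewrite ?mule0 ?mul0e// -!EFinB -EFinM ltry.
Qed.

(* A set of triples is only ever measured through its trace on the sphere. *)
Definition nu (R : realType) (E : set (R * R * R)) : R := fine (sint (\1_E : _ -> R)).

Lemma sint_indic (R : realType) (E : set (R * R * R)) :
  measurable E -> sint (\1_E : _ -> R) = (nu E)%:E.
Proof.
move=> mE; rewrite /nu fineK// ge0_fin_numE; last by apply: sint_pos => x; rewrite indicE.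
apply: le_lt_trans (sint_cst1 R); exact: sint_mono.
Qed.

Lemma nu_ge0 (R : realType) (E : set (R * R * R)) : 0 <= nu E.
Proof. by apply: fine_ge0; apply: sint_pos => x; rewrite indicE. Qed.

Lemma nu_le (R : realType) (E F : set (R * R * R)) : measurable E -> measurable F ->
  (forall x, dot x x = 1 -> E x -> F x) -> nu E <= nu F.
Proof.
move=> mE mF EF; rewrite -lee_fin -!sint_indic//; apply: sint_mono => //.
move=> t p; rewrite !indicE; have [Ex|] := boolP (_ \in E); last by case: (_ \in F).
suff -> : sphp t p \in F by [].
rewrite inE; apply: EF; last exact/set_mem.
rewrite /dot /sphp /=; transitivity (cos t ^+ 2 + sin t ^+ 2 * (cos p ^+ 2 + sin p ^+ 2)).
  by ring.
by rewrite cos2Dsin2 mulr1 cos2Dsin2.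
Qed.

Lemma nu_split (R : realType) (E F : set (R * R * R)) : measurable E -> measurable F ->
  nu E = nu (E `&` F) + nu (E `\` F).
Proof.
move=> mE mF; apply: EFin_inj; rewrite EFinD -!sint_indic//; last 2 first.
- exact: measurableD.
- exact: measurableI.
rewrite -sintD; [|exact/measurable_indic/measurableI|exact/measurable_indic/measurableD|..].
- apply: sint_eq => t p; rewrite !indicE in_setI in_setD.
  by case: (_ \in E); case: (_ \in F); rewrite /= ?addr0 ?add0r.
- by move=> x; rewrite indicE.
- by move=> x; rewrite indicE.
Qed.

(** A cap is stored as its centre and the cosine of its radius. *)
Definition capK (R : realType) (F : seq (R * R * R * R)) : set (R * R * R) :=
  [set x | forall t, t \in F -> t.2 <= dot x t.1].

Lemma capK_cons (R : realType) t (F : seq (R * R * R * R)) x :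
  capK (t :: F) x <-> t.2 <= dot x t.1 /\ capK F x.
Proof.
split=> [h|[h1 h2] s]; first by split=> [|s sF]; apply: h; rewrite inE ?eqxx// sF orbT.
by rewrite inE => /predU1P[->|/h2].
Qed.

Lemma measurable_half (R : realType) (p : R * R * R) (c : R) :
  measurable [set x | c <= dot x p].
Proof.
rewrite -[X in measurable X]setTI (_ : [set x | c <= dot x p] = (fun x => dot x p) @^-1` `[c, +oo[).
  by apply: (measurable_dot p) => //; exact: measurable_itv.
by apply/seteqP; split=> x /=; rewrite in_itv/= andbT.
Qed.

Lemma measurable_capK (R : realType) (F : seq (R * R * R * R)) : measurable (capK F).
Proof.
elim: F => [|t F IH]; first by rewrite (_ : capK _ = setT)//; apply/seteqP; split.
rewrite (_ : capK (t :: F) = [set x | t.2 <= dot x t.1] `&` capK F).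
  by apply: measurableI => //; exact: measurable_half.
by apply/seteqP; split=> x /capK_cons.
Qed.

Definition posp (R : realType) (a : R) : R := (a + `|a|) / 2.

Lemma posp_ge0 (R : realType) (a : R) : 0 <= posp a.
Proof. by rewrite divr_ge0// -[a in a + _]opprK addrC subr_ge0 -normrN ler_norm. Qed.

Lemma posp_eq0 (R : realType) (a : R) : (posp a == 0) = (a <= 0).
Proof.
rewrite /posp mulf_eq0 invr_eq0 (pnatr_eq0 _ 2) orbF addr_eq0.
have [a0|a0] := lerP a 0; first by rewrite ler0_norm// opprK eqxx.
by apply/eqP; rewrite gtr0_norm// => /eqP; rewrite -addr_eq0; lra.
Qed.

(** A continuous function that vanishes exactly on [capK F]: composed with [ramp] it increases to
    the indicator of the complement, to which invariance thus passes. *)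
Definition excess (R : realType) (F : seq (R * R * R * R)) (x : R * R * R) : R :=
  \sum_(t <- F) posp (t.2 - dot x t.1).

Lemma excess_neq0 (R : realType) (F : seq (R * R * R * R)) x :
  ((excess F x != 0)%:R : R) = \1_(~` capK F) x.
Proof.
rewrite indicE; congr (nat_of_bool _)%:R; apply/idP/idP; last first.
  rewrite inE /=; apply: contra_notN; rewrite /excess psumr_eq0.
    by move=> /allP h t /h; rewrite /= posp_eq0 subr_le0.
  by move=> t _; exact: posp_ge0.
rewrite inE /=; apply: contraNnot => h; rewrite /excess psumr_eq0.
  by apply/allP => t /h; rewrite /= posp_eq0 subr_le0.
by move=> t _; exact: posp_ge0.
Qed.

Lemma excess_good (R : realType) (F : seq (R * R * R * R)) :
  continuous (excess F) /\ measurable_fun setT (excess F).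
Proof.
elim: F => [|t F [IHc IHm]].
  rewrite (_ : excess [::] = cst 0); last by apply/funext => x; rewrite /excess big_nil.
  by split; [exact: cst_continuous|exact: measurable_cst].
have cl : continuous (fun x : R * R * R => t.2 - dot x t.1).
  by move=> x; apply: cvgB; [exact: cvg_cst|exact: continuous_dot].
have ml : measurable_fun setT (fun x : R * R * R => t.2 - dot x t.1).
  by apply: measurable_funB => //; exact: measurable_dot.
have cp : continuous (@posp R).
  move=> a; apply: cvgM; last exact: cvg_cst.
  by apply: cvgD; [exact: cvg_id|exact: norm_continuous].
have mp : measurable_fun setT (@posp R) by exact: continuous_measurable_fun.
rewrite (_ : excess (t :: F) = fun x => (@posp R \o (fun x => t.2 - dot x t.1)) x + excess F x).
  split; last by apply: measurable_funD => //; exact: (measurableT_comp mp ml).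
  move=> x; apply: cvgD; last exact: IHc.
  by apply: continuous_comp; [exact: cl|exact: cp].
by apply/funext => x; rewrite /excess big_cons.
Qed.

Lemma sint_outside (R : realType) (n : R * R * R) (F : seq (R * R * R * R)) : dot n n = 1 ->
  sint (\1_(~` capK F) \o refl n : _ -> R) = sint (\1_(~` capK F) : _ -> R).
Proof.
move=> n1; have [ce me] := excess_good F.
have gr k : goodf (@ramp R k \o excess F).
  by apply: goodf_R => //; [exact: continuous_ramp|exact: ramp_ge0].
have gr' k := goodf_comp (gr k) (@continuous_refl R n) (@measurable_refl R n).
have lim (h : R * R * R -> R * R * R) :
    (forall k, goodf ((@ramp R k \o excess F) \o h)) ->
    sint ((@ramp R k \o excess F) \o h) @[k --> \oo] --> sint (\1_(~` capK F) \o h : _ -> R).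
  move=> gh; apply: sint_cvg.
  - by move=> k; case: (gh k).
  - by move=> k x; case: (gh k).
  - by move=> x k l kl; exact: nondecreasing_ramp.
  - by move=> x /=; rewrite -excess_neq0; exact: cvg_ramp.
apply: (cvg_unique (@ereal_hausdorff R) (lim _ gr')).
have -> : (fun k => sint ((@ramp R k \o excess F) \o refl n)) =
    (fun k => sint ((@ramp R k \o excess F) \o id)); last exact: lim.
by apply/funext => k; rewrite sint_refl.
Qed.

Lemma nu_refl (R : realType) (n : R * R * R) (F : seq (R * R * R * R)) : dot n n = 1 ->
  nu (refl n @^-1` capK F) = nu (capK F).
Proof.
move=> n1; have mK := measurable_capK F.
have mr : measurable (refl n @^-1` capK F).
  by rewrite -[X in measurable X]setTI; apply: (measurable_refl n).
(* The increasing approximation concerns the complement; finiteness of the total area gives the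
   intersection itself. *)
have h (E : set (R * R * R)) : measurable E -> nu E = nu setT - nu (~` E).
  by move=> mE; rewrite (nu_split (@measurableT _ _) mE) setTI setTD addrK.
rewrite h// [RHS]h//; congr (_ - _); apply: EFin_inj; rewrite -!sint_indic//; try exact: measurableC.
rewrite -(sint_outside F n1); congr sint.
Qed.

Lemma capK_cat (R : realType) (F G : seq (R * R * R * R)) :
  capK (F ++ G) = capK F `&` capK G.
Proof.
apply/seteqP; split=> x; first by move=> h; split=> t tF; apply: h; rewrite mem_cat tF ?orbT.
by move=> [] h1 h2 t; rewrite mem_cat => /orP[/h1|/h2].
Qed.

Lemma refl_preimage_capK (R : realType) (n : R * R * R) (F : seq (R * R * R * R)) :
  refl n @^-1` capK F = capK [seq (refl n t.1, t.2) | t <- F].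
Proof.
apply/seteqP; split=> x /= h t.
  by move=> /mapP[s sF ->] /=; rewrite -dot_refl; exact: h.
by move=> tF; rewrite dot_refl; apply: (h (refl n t.1, t.2)); apply/mapP; exists t.
Qed.

Lemma nu_capK_refl (R : realType) (n : R * R * R) (F : seq (R * R * R * R)) : dot n n = 1 ->
  nu (capK [seq (refl n t.1, t.2) | t <- F]) = nu (capK F).
Proof. by move=> n1; rewrite -refl_preimage_capK nu_refl. Qed.

Lemma refl_swap (R : realType) (p q : R * R * R) : dot p p = 1 -> dot q q = 1 -> p != q ->
  exists2 k : R, 0 < k & let n := (k * (q.1.1 - p.1.1), k * (q.1.2 - p.1.2), k * (q.2 - p.2)) in
    dot n n = 1 /\ refl n p = q.
Proof.
move=> p1 q1 pq; pose D := (q.1.1 - p.1.1) ^+ 2 + (q.1.2 - p.1.2) ^+ 2 + (q.2 - p.2) ^+ 2.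
have D0 : 0 < D.
  have D0 : 0 <= D by rewrite !addr_ge0// sqr_ge0.
  rewrite lt_neqAle D0 andbT eq_sym; apply: contra pq.
  rewrite !paddr_eq0 ?addr_ge0 ?sqr_ge0// !sqrf_eq0 !subr_eq0 => /andP[/andP[/eqP a /eqP b] /eqP c].
  by case: p q a b c {p1 q1 D D0} => [[? ?] ?] [[? ?] ?] /= -> -> ->.
have DE : D = 2 - 2 * dot p q.
  transitivity (dot p p + dot q q - 2 * dot p q); first by rewrite /D /dot; ring.
  by rewrite p1 q1; ring.
exists (Num.sqrt D)^-1; first by rewrite invr_gt0 sqrtr_gt0.
have kk : (Num.sqrt D)^-1 ^+ 2 * D = 1.
  by rewrite exprVn sqr_sqrtr ?ltW// mulVf// lt0r_neq0.
move: kk; set k := _^-1 => kk n; split; first by rewrite -kk /n /dot /D /=; ring.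
have e (a b : R) : a - 2 * dot p n * (k * (b - a)) = b.
  have -> : dot p n = k * (dot p q - dot p p) by rewrite /n /dot /=; ring.
  transitivity (a + k ^+ 2 * (2 - 2 * dot p q) * (b - a)); first by rewrite p1; ring.
  by rewrite -DE kk; ring.
by rewrite /refl {1 3 5}/n /= !e; case: (q) => [[]].
Qed.

(** The mirror exchanges [a] and [b], and [p] is on the side of [b]. [X] is the mirror image of the
    old lens, [Y] the new lens. The image of [X] minus [Y] lies in [Y] minus [X]: a point in the cap
    of [p] but not in its mirror image is on the side of [p], hence has a larger product with [b]
    than with [a]. *)
Lemma lens_mono (R : realType) (p a b : R * R * R) (c d : R) :
  dot a a = 1 -> dot b b = 1 -> dot p a <= dot p b ->
  nu (capK [:: (p, c); (a, d)]) <= nu (capK [:: (p, c); (b, d)]).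
Proof.
move=> a1 b1 pab; have [->//|ab] := eqVneq a b.
have [k k0] := refl_swap a1 b1 ab; set n := (X in let n := X in _) => -[n1 na].
have nb : refl n b = a by rewrite -na refl_invol.
pose X := capK [:: (refl n p, c); (b, d)]; pose Y := capK [:: (p, c); (b, d)].
have mX : measurable X by exact: measurable_capK.
have mY : measurable Y by exact: measurable_capK.
have XY : X `&` Y = capK [:: (refl n p, c); (b, d); (p, c); (b, d)] by rewrite -capK_cat.
have s1 : nu X = nu (X `&` Y) + nu (X `\` Y) by exact: nu_split.
have s2 : nu Y = nu (X `&` Y) + nu (Y `\` X) by rewrite setIC; exact: nu_split.
have mr E : measurable E -> measurable (refl n @^-1` E).
  by move=> mE; rewrite -[X in measurable X]setTI; apply: (measurable_refl n).
have s3 : nu (refl n @^-1` X) =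
    nu (refl n @^-1` (X `&` Y)) + nu (refl n @^-1` X `\` refl n @^-1` Y).
  by rewrite preimage_setI; apply: nu_split; exact: mr.
have -> : nu (capK [:: (p, c); (a, d)]) = nu X by rewrite /X -na -(nu_capK_refl _ n1).
rewrite -/Y s1 s2 lerD2l.
have -> : nu (X `\` Y) = nu (refl n @^-1` X `\` refl n @^-1` Y).
  apply: (addrI (nu (X `&` Y))); rewrite -s1.
  have <- : nu (refl n @^-1` (X `&` Y)) = nu (X `&` Y) by rewrite XY; exact: nu_refl.
  by rewrite -s3; symmetry; exact: nu_refl.
apply: nu_le; [by apply: measurableD; exact: mr|exact: measurableD|].
move=> x _ [] /= Xx Yx.
move: Xx => /capK_cons[/= xp /capK_cons[/= xb _]].
rewrite dot_refl refl_invol// in xp; rewrite dot_refl nb in xb.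
have xp' : dot x (refl n p) < c.
  rewrite ltNge; apply/negP => xc; apply: Yx; apply/capK_cons; split; first by rewrite dot_refl.
  by apply/capK_cons; split=> //=; rewrite dot_refl nb.
have pn : dot p n = k * (dot p b - dot p a) by rewrite /n /dot /=; ring.
have xn : dot x n = k * (dot x b - dot x a) by rewrite /n /dot /=; ring.
have xr : dot x (refl n p) = dot x p - 2 * dot p n * dot x n by rewrite /refl /dot /=; ring.
have pos : 0 < dot p n * dot x n.
  by move: (lt_le_trans xp' xp); rewrite xr gtrBl -mulrA pmulr_rgt0 ?ltr0n.
have pn0 : 0 <= dot p n by rewrite pn mulr_ge0 ?(ltW k0)// subr_ge0.
have xn0 : 0 < dot x n.
  by rewrite ltNge; apply/negP => xn0; move: pos; rewrite ltNge mulr_ge0_le0.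
split.
  apply/capK_cons; split=> //; apply/capK_cons; split=> //=.
  by move: xn0; rewrite xn pmulr_rgt0// subr_gt0 => /ltW; exact: le_trans.
by move=> /capK_cons[/= ]; rewrite leNgt xp'.
Qed.

(** A reflection taking [p1] to [q1] preserves the area and the inner product, and only the second
    centre remains to be moved. *)
Lemma lens_le (R : realType) (p1 p2 q1 q2 : R * R * R) (c d : R) :
  dot p1 p1 = 1 -> dot p2 p2 = 1 -> dot q1 q1 = 1 -> dot q2 q2 = 1 ->
  dot p1 p2 <= dot q1 q2 ->
  nu (capK [:: (p1, c); (p2, d)]) <= nu (capK [:: (q1, c); (q2, d)]).
Proof.
move=> p11 p21 q11 q21 pq; have [E|p1q1] := eqVneq p1 q1.
  by move: pq; rewrite -E => pq; exact: lens_mono.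
have [k k0] := refl_swap p11 q11 p1q1; set n := (X in let n := X in _) => -[n1 np].
rewrite -(nu_capK_refl _ n1) /= np; apply: lens_mono => //; first by rewrite refl_isom.
suff -> : dot q1 (refl n p2) = dot p1 p2 by [].
by rewrite -np refl_isom.
Qed.

Lemma nu_cap (R : realType) (p q : R * R * R) (c : R) : dot p p = 1 -> dot q q = 1 ->
  nu (capK [:: (p, c)]) = nu (capK [:: (q, c)]).
Proof.
move=> p1 q1; have [->//|pq] := eqVneq p q.
have [k k0] := refl_swap p1 q1 pq; set n := (X in let n := X in _) => -[n1 np].
by rewrite -(nu_capK_refl _ n1) /= np.
Qed.

Definition opp3 (R : realType) (x : R * R * R) : R * R * R := (- x.1.1, - x.1.2, - x.2).

Lemma dot_opp (R : realType) (x y : R * R * R) : dot x (opp3 y) = - dot x y.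
Proof. by rewrite /dot /=; ring. Qed.

Lemma refl_opp (R : realType) (n x : R * R * R) : refl n (opp3 x) = opp3 (refl n x).
Proof. by rewrite /refl /opp3 /dot /=; congr (_, _, _); ring. Qed.

(** A circle as the intersection of two opposite caps, so that the invariance of cap intersections
    applies to it. *)
Definition circ (R : realType) (p : R * R * R) (c : R) : set (R * R * R) :=
  capK [:: (p, c); (opp3 p, - c)].

Lemma circP (R : realType) (p : R * R * R) (c : R) x : circ p c x <-> dot x p = c.
Proof.
have e := dot_opp x p.
split=> [/capK_cons[/= h1 /capK_cons[/= + _]]|<-].
  by rewrite e lerN2 => h2; apply/eqP; rewrite eq_le h1 h2.
by apply/capK_cons; split=> //=; apply/capK_cons; split=> //=; rewrite e.
Qed.

Lemma nu_circ (R : realType) (p : R * R * R) (c : R) : dot p p = 1 -> nu (circ p c) = 0.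
Proof.
move=> p1; pose z : R * R * R := (0, 0, 1).
have z1 : dot z z = 1 by rewrite /dot /=; ring.
have -> : nu (circ p c) = nu (circ z c).
  have [->//|pz] := eqVneq p z.
  have [k k0] := refl_swap p1 z1 pz; set n := (X in let n := X in _) => -[n1 np].
  by rewrite /circ -(nu_capK_refl _ n1) /= refl_opp np.
rewrite /nu; have mf : measurable_fun setT (\1_(circ z c) : _ -> R).
  by apply: measurable_indic; exact: measurable_capK.
have f0 x : 0 <= (\1_(circ z c) x : R) by rewrite indicE.
rewrite (sint_iter mf f0).2 -[RHS](_ : fine 0%E = 0)//; congr fine.
apply: integral0_eq => ph _.
(* Around the north pole the circle has a single polar angle. *)
pose N := [set acos c].
have h : measurable_fun `[0, pi] (fun t : R => (\1_(circ z c) (sphp t ph) * sin t)%:E).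
  apply: measurable_funTS; apply/measurable_EFinP.
  have m2 : measurable_fun [set: R] (fun t : R => (t, ph)) by exact: pair2_measurable.
  exact: (measurableT_comp (measurable_sint mf) m2).
have -> : (\int[@lebesgue_measure R]_(t in `[0%R, pi]) (\1_(circ z c) (sphp t ph) * sin t)%R%:E =
    \int[@lebesgue_measure R]_(t in `[0%R, pi] `\` N) (\1_(circ z c) (sphp t ph) * sin t)%R%:E)%E.
  apply: ge0_negligible_integral => //; last exact: lebesgue_measure_set1.
    exact: measurable_set1.
  by move=> t; rewrite /= in_itv/= => t0; rewrite lee_fin mulr_ge0// sin_ge0_pi.
apply: integral0_eq => t [/=]; rewrite in_itv/= => t0 tN.
rewrite indicE; case: (boolP (_ \in _)) => [|_]; last by rewrite mul0r.
rewrite inE => /circP; rewrite /z /sphp /dot /= !mulr0 !add0r mulr1 => ct.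
by exfalso; apply: tN; rewrite /N /= -ct cosK.
Qed.

(** * From the plane to the sphere *)

Lemma nu_modular (R : realType) (A B : set (R * R * R)) : measurable A -> measurable B ->
  nu (A `&` B) + nu (A `|` B) = nu A + nu B.
Proof.
move=> mA mB; have mU := measurableU _ _ mA mB.
rewrite (nu_split mU mB) (nu_split mA mB) setIUl setIid (setUidr (@subIsetr _ A B)).
by rewrite setDUl setDv setU0 [nu B + _]addrC addrA.
Qed.

(* [dctr a] and [dlev a] are the centre and the level of the cap
   [dlev a <= <x, dctr a>] whose stereographic image from the north pole is D_a;
   [0 < a.2] says that D_a contains the image 0 of the south pole in its interior. *)
Definition dscale (R : realType) (a : R * R * R) : R :=
  (Num.sqrt (a.1.1 ^+ 2 + a.1.2 ^+ 2 + (1 + a.2) ^+ 2))^-1.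

Definition dctr (R : realType) (a : R * R * R) : R * R * R :=
  (dscale a * a.1.1, dscale a * a.1.2, - (dscale a * (1 + a.2))).

Definition dlev (R : realType) (a : R * R * R) : R := dscale a * (1 - a.2).

Definition stereo (R : realType) (x : R * R * R) : R * R :=
  (x.1.1 / (1 - x.2), x.1.2 / (1 - x.2)).

Lemma dscale_gt0 (R : realType) (a : R * R * R) : 0 < a.2 -> 0 < dscale a.
Proof.
move=> a0; rewrite invr_gt0 sqrtr_gt0 ltr_wpDl ?addr_ge0 ?sqr_ge0// exprn_gt0//.
by rewrite addr_gt0.
Qed.

Lemma dctr_unit (R : realType) (a : R * R * R) : 0 < a.2 -> dot (dctr a) (dctr a) = 1.
Proof.
move=> a0; transitivity (dscale a ^+ 2 * (a.1.1 ^+ 2 + a.1.2 ^+ 2 + (1 + a.2) ^+ 2)).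
  by rewrite /dot /=; ring.
have := dscale_gt0 a0; rewrite /dscale invr_gt0 sqrtr_gt0 => h.
by rewrite exprVn sqr_sqrtr ?ltW// mulVf// lt0r_neq0.
Qed.

Lemma pw_stereo (R : realType) (a x : R * R * R) : dot x x = 1 -> x.2 < 1 ->
  (1 - x.2) * dscale a * pw a (stereo x) = dot x (dctr a) - dlev a.
Proof.
move=> x1 x2; have d0 : 1 - x.2 != 0 by rewrite subr_eq0 gt_eqF.
have e : (x.1.1 / (1 - x.2)) ^+ 2 + (x.1.2 / (1 - x.2)) ^+ 2 = (1 + x.2) / (1 - x.2).
  have -> : (1 + x.2) / (1 - x.2) = (dot x x - x.2 ^+ 2) / (1 - x.2) ^+ 2 by rewrite x1; field.
  by rewrite /dot; field.
rewrite /pw /stereo /= e /dlev /dot /=; by field.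
Qed.

Lemma cap_stereo (R : realType) (a x : R * R * R) : dot x x = 1 -> x.2 < 1 -> 0 < a.2 ->
  (dlev a <= dot x (dctr a)) = (0 <= pw a (stereo x)).
Proof.
move=> x1 x2 a0; rewrite -subr_ge0 -pw_stereo// pmulr_rge0//.
by rewrite mulr_gt0 ?dscale_gt0// subr_gt0.
Qed.

(** At the north pole the product with the centre falls short of the level by [2 * dscale a]. *)
Lemma cap_below_north (R : realType) (a x : R * R * R) : dot x x = 1 -> 0 < a.2 ->
  dlev a <= dot x (dctr a) -> x.2 < 1.
Proof.
move=> x1 a0; rewrite ltNge; apply: contraTN => x2.
have x20 : x.2 = 1.
  apply/eqP; rewrite eq_le x2 andbT -ler_sqr ?nnegrE ?ler01//; last exact: le_trans x2.
  by rewrite expr1n -x1 /dot -!expr2 lerDr addr_ge0// sqr_ge0.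
have e : x.1.1 ^+ 2 + x.1.2 ^+ 2 = 0.
  transitivity (dot x x - x.2 ^+ 2); first by rewrite /dot; ring.
  by rewrite x1 x20 expr1n subrr.
move: e => /eqP; rewrite paddr_eq0 ?sqr_ge0// !sqrf_eq0 => /andP[/eqP x11 /eqP x12].
rewrite -ltNge -subr_gt0 /dlev /dctr /dot /= x11 x12 x20.
have -> : dscale a * (1 - a.2) - (0 * (dscale a * a.1.1) + 0 * (dscale a * a.1.2) +
  1 * - (dscale a * (1 + a.2))) = dscale a * 2 by ring.
by rewrite mulr_gt0// dscale_gt0.
Qed.

(** Levels come from the disks while centres are an arbitrary function of them, so that the same
    tree of disks serves both sides. *)
Definition caps (R : realType) (q : R * R * R -> R * R * R) (L : seq (R * R * R)) :
  set (R * R * R) := capK [seq (q a, dlev a) | a <- L].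

Lemma capsP (R : realType) q (L : seq (R * R * R)) x :
  caps q L x <-> forall a, a \in L -> dlev a <= dot x (q a).
Proof.
split=> [h a aL|h t /mapP[a aL ->]]; last exact: h.
by apply: (h (q a, dlev a)); apply/mapP; exists a.
Qed.

Lemma measurable_caps (R : realType) q (L : seq (R * R * R)) : measurable (caps q L).
Proof. exact: measurable_capK. Qed.

Lemma caps_eq (R : realType) q (L L' : seq (R * R * R)) : L =i L' -> caps q L = caps q L'.
Proof.
move=> LL'; apply/seteqP; split=> x /capsP h; apply/capsP => a aL; apply: h.
  by rewrite LL'.
by rewrite -LL'.
Qed.

Lemma caps_stereo (R : realType) (L : seq (R * R * R)) x :
  (forall a, a \in L -> 0 < a.2) -> L != [::] -> dot x x = 1 -> caps (@dctr R) L x ->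
  x.2 < 1 /\ inK L (stereo x).
Proof.
move=> L0 + x1 /capsP h; case: L L0 h => // a L L0 h _.
have x2 : x.2 < 1 by apply: (cap_below_north x1 (L0 a _) (h a _)); rewrite mem_head.
by split=> // b bL; rewrite -cap_stereo ?L0//; exact: h.
Qed.

Lemma treelike_caps_le (R : realType) (L : seq (R * R * R)) : treelike L ->
  forall q, (forall a, a \in L -> 0 < a.2) -> (forall a, a \in L -> dot (q a) (q a) = 1) ->
  (forall a b, a \in L -> b \in L -> dot (dctr a) (dctr b) <= dot (q a) (q b)) ->
  nu (caps (@dctr R) L) <= nu (caps q L).
Proof.
elim=> {L} [a b L Lab|m F1 F2 L LF sep _ IH1 _ IH2|m L Km _ IH] q L0 q1 pq.
- have [aL bL] : a \in L /\ b \in L by rewrite !Lab !inE !eqxx orbT.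
  rewrite !(caps_eq _ Lab) /caps /=; apply: lens_le; rewrite ?dctr_unit ?L0 ?q1//.
  exact: pq.
- have [mL s1 s2] : [/\ m \in L, {subset m :: F1 <= L} & {subset m :: F2 <= L}].
    split=> [|a|a]; rewrite LF !inE ?mem_cat ?eqxx//.
      by case/predU1P => [->|->]; rewrite ?eqxx ?orbT.
    by case/predU1P => [->|->]; rewrite ?eqxx ?orbT.
  have cI q' : caps q' L = caps q' (m :: F1) `&` caps q' (m :: F2).
    rewrite /caps -capK_cat -map_cat; apply: caps_eq => a.
    by rewrite LF !(inE, mem_cat); case: (a == m); case: (_ \in F1); case: (_ \in F2).
  have mc q' (F : seq (R * R * R)) : measurable (caps q' F) by exact: measurable_caps.
  have h1 : nu (caps (@dctr R) (m :: F1)) <= nu (caps q (m :: F1)).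
    by apply: IH1 => [a /s1/L0|a /s1/q1|a b /s1 aL /s1 bL] //; exact: pq.
  have h2 : nu (caps (@dctr R) (m :: F2)) <= nu (caps q (m :: F2)).
    by apply: IH2 => [a /s2/L0|a /s2/q1|a b /s2 aL /s2 bL] //; exact: pq.
  have h3 : nu (caps q (m :: F1) `|` caps q (m :: F2)) <=
            nu (caps (@dctr R) (m :: F1) `|` caps (@dctr R) (m :: F2)).
    apply: (@le_trans _ _ (nu (capK [:: (q m, dlev m)]))).
      apply: nu_le => [||x _]; [exact: (measurableU _ _ (mc _ _) (mc _ _))|exact: measurable_capK|].
      move=> xF; have {xF} : dlev m <= dot x (q m).
        by case: xF => /capsP h; apply: h; rewrite mem_head.
      by move=> h t; rewrite inE => /eqP ->.
    rewrite (nu_cap _ (q1 m mL) (dctr_unit (L0 m mL))).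
    apply: nu_le => [||x x1]; [exact: measurable_capK|exact: (measurableU _ _ (mc _ _) (mc _ _))|].
    move=> /capK_cons[/= xm _]; have x2 := cap_below_north x1 (L0 m mL) xm.
    have xm' : 0 <= pw m (stereo x) by rewrite -cap_stereo// L0.
    have [h|h] := pselect (inK F1 (stereo x)).
      left; apply/capsP => a; rewrite inE => /predU1P[->//|aF].
      by rewrite cap_stereo//; [exact: h|apply: L0; apply: s1; rewrite inE aF orbT].
    right; apply/capsP => b; rewrite inE => /predU1P[->//|bF].
    rewrite cap_stereo//; last by apply: L0; apply: s2; rewrite inE bF orbT.
    apply: contrapT => nb; apply: h => a aF.
    by case: (sep a b _ aF bF xm').
  rewrite !cI; move: h1 h2 h3.
  have := nu_modular (mc q (m :: F1)) (mc q (m :: F2)).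
  have := nu_modular (mc (@dctr R) (m :: F1)) (mc (@dctr R) (m :: F2)).
  move: (nu _) (nu _) (nu _) (nu _) (nu _) (nu _) (nu _) (nu _) => *; lra.
have [/eqP L00|Ln0] := boolP (L == [::]).
  by rewrite L00 /caps /=.
have [mL|mL] := boolP (m \in L).
  have E : m :: L =i L by move=> a; rewrite inE; case: eqP => // ->.
  rewrite -!(caps_eq _ E); apply: IH => [a|a|a b]; rewrite ?E.
  - exact: L0.
  - exact: q1.
  - exact: pq.
(* The origin is interior to all disks of [L], hence to D_m. *)
have m0 : 0 < m.2.
  have := @intK_lt R L m (0, 0) _ Km.
  rewrite /pw /= !mulr0 !expr0n/= !addr0 !add0r subr0; apply => a aL.
  by rewrite /pw /= !mulr0 !expr0n/= !addr0 !add0r subr0 L0.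
(* The south pole, interior to all caps, witnesses the half-space condition. *)
pose z : R * R * R := (0, 0, - 1).
pose ix (i : 'I_(size L)) := nth m L i.
have ixL i : ix i \in L by rewrite mem_nth.
have [||||u u1 um] := @kirszbraun_fin R _ (fun i => dctr (ix i)) (fun i => q (ix i)) z (dctr m).
- by move=> i; apply: q1.
- by move=> i j; apply: pq.
- move=> i; rewrite /z /dot /= !mul0r !add0r mulN1r opprK mulr_gt0 ?dscale_gt0 ?L0//.
  by rewrite addr_gt0// L0.
- exact: dctr_unit.
pose q' a := if a == m then u else q a.
have q'L a : a \in L -> q' a = q a.
  by move=> aL; rewrite /q'; case: eqP => // am; rewrite -am aL in mL.
have q'm : q' m = u by rewrite /q' eqxx.
have um' a : a \in L -> dot (dctr m) (dctr a) <= dot u (q a).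
  move=> aL; have sL : (index a L < size L)%N by rewrite index_mem.
  by have := um (Ordinal sL); rewrite /ix /= nth_index.
have IHq : nu (caps (@dctr R) (m :: L)) <= nu (caps q' (m :: L)).
  apply: IH => [a|a|a b]; rewrite !inE.
  - by case/predU1P => [->//|/L0].
  - by case/predU1P => [->|aL]; rewrite ?q'm// q'L// q1.
  - move=> /predU1P[->|aL] /predU1P[->|bL].
    + by rewrite dctr_unit// q'm u1.
    + by rewrite q'm q'L// um'.
    + by rewrite q'm q'L// dotC [X in _ <= X]dotC um'.
    + by rewrite !q'L// pq.
apply: le_trans (le_trans IHq _); apply: nu_le; try exact: measurable_caps.
- move=> x x1 xL; have [x2 xK] := caps_stereo L0 Ln0 x1 xL.
  apply/capsP => a; rewrite inE => /predU1P[->|aL]; last by move/capsP: xL; apply.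
  by rewrite cap_stereo// Km.
- move=> x _ /capsP h; apply/capsP => a aL.
  by have := h a; rewrite inE aL orbT q'L// => /(_ isT).
Qed.

(** * Caps given by centre and level *)

Lemma unit_dot_eq (R : realType) (p q : R * R * R) :
  dot p p = 1 -> dot q q = 1 -> 1 <= dot p q -> p = q.
Proof.
move=> p1 q1 pq.
have : (p.1.1 - q.1.1) ^+ 2 + (p.1.2 - q.1.2) ^+ 2 + (p.2 - q.2) ^+ 2 <= 0.
  have -> : (p.1.1 - q.1.1) ^+ 2 + (p.1.2 - q.1.2) ^+ 2 + (p.2 - q.2) ^+ 2 =
    dot p p + dot q q - 2 * dot p q by rewrite /dot; ring.
  by rewrite p1 q1 -mulr2n -mulr_natr mul1r subr_le0 ler_peMr.
rewrite le_eqVlt ltNge !addr_ge0 ?sqr_ge0//= orbF.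
rewrite !paddr_eq0 ?addr_ge0 ?sqr_ge0// !sqrf_eq0 !subr_eq0 => /andP[/andP[/eqP a /eqP b] /eqP d].
by case: p q a b d {p1 q1 pq} => [[? ?] ?] [[? ?] ?] /= -> -> ->.
Qed.

(** Inverse of [dctr] and [dlev], for caps that avoid the north pole, as [0 < c - p.2] says. *)
Definition sdisk (R : realType) (p : R * R * R) (c : R) : R * R * R :=
  (2 * p.1.1 / (c - p.2), 2 * p.1.2 / (c - p.2), - (p.2 + c) / (c - p.2)).

Lemma dscale_sdisk (R : realType) (p : R * R * R) (c : R) :
  dot p p = 1 -> 0 < c - p.2 -> dscale (sdisk p c) = (c - p.2) / 2.
Proof.
move=> p1 d0; have dn : c - p.2 != 0 by rewrite gt_eqF.
rewrite /dscale /sdisk /=.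
have -> : (2 * p.1.1 / (c - p.2)) ^+ 2 + (2 * p.1.2 / (c - p.2)) ^+ 2 +
    (1 + - (p.2 + c) / (c - p.2)) ^+ 2 = (2 / (c - p.2)) ^+ 2.
  transitivity (dot p p * (2 / (c - p.2)) ^+ 2); last by rewrite p1 mul1r.
  by rewrite /dot; field.
by rewrite sqrtr_sqr gtr0_norm ?divr_gt0// invf_div.
Qed.

Lemma dctr_sdisk (R : realType) (p : R * R * R) (c : R) :
  dot p p = 1 -> 0 < c - p.2 -> dctr (sdisk p c) = p.
Proof.
move=> p1 d0; have dn : c - p.2 != 0 by rewrite gt_eqF.
rewrite /dctr dscale_sdisk// [RHS]surjective_pairing [p.1 in RHS]surjective_pairing /=.
by congr (_, _, _); field.
Qed.

Lemma dlev_sdisk (R : realType) (p : R * R * R) (c : R) :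
  dot p p = 1 -> 0 < c - p.2 -> dlev (sdisk p c) = c.
Proof.
move=> p1 d0; have dn : c - p.2 != 0 by rewrite gt_eqF.
by rewrite /dlev dscale_sdisk//= ; field.
Qed.

Definition fcaps (R : realType) k (p : 'I_k -> R * R * R) (c : 'I_k -> R) : seq (R * R * R * R) :=
  [seq (p i, c i) | i <- enum 'I_k].

Lemma fcapsP (R : realType) k (p : 'I_k -> R * R * R) (c : 'I_k -> R) x :
  capK (fcaps p c) x <-> forall i, c i <= dot x (p i).
Proof.
split=> [h i|h t /mapP[i _ ->]]; last exact: h.
by apply: (h (p i, c i)); apply/mapP; exists i; rewrite ?mem_enum.
Qed.

Lemma fcaps_le_south (R : realType) k (p q : 'I_k -> R * R * R) (c : 'I_k -> R) :
  (forall i, dot (p i) (p i) = 1) -> (forall i, dot (q i) (q i) = 1) ->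
  (forall i j, dot (p i) (p j) <= dot (q i) (q j)) ->
  (forall i, 0 < c i - (p i).2) -> (forall i, 0 < - ((p i).2 + c i)) ->
  nu (capK (fcaps p c)) <= nu (capK (fcaps q c)).
Proof.
move=> p1 q1 pq cp cp'; case: k p q c p1 q1 pq cp cp' => [|k] p q c p1 q1 pq cp cp'.
  rewrite /fcaps; suff -> : enum 'I_0 = [::] by [].
  by apply: size0nil; rewrite size_enum_ord.
pose D i := sdisk (p i) (c i).
have dD i : dctr (D i) = p i by exact: dctr_sdisk.
have lD i : dlev (D i) = c i by exact: dlev_sdisk.
(* Turns the family [q] into a function of disks. If two indices give the same disk, then
   [p i = p j], so [q i] and [q j] have product at least 1 and coincide; values outside [L] are
   irrelevant. *)
pose q' a := if [pick i | D i == a] is Some i then q i else a.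
have qD i : q' (D i) = q i.
  rewrite /q'; case: pickP => [j /eqP Dji|/(_ i)]; last by rewrite eqxx.
  by apply: unit_dot_eq => //; apply: le_trans (pq j i); rewrite -(dD j) Dji dD p1.
pose L := [seq D i | i <- enum 'I_k.+1].
have capE r s : (forall i, r (D i) = s i) -> caps r L = capK (fcaps s c).
  move=> rs; rewrite /caps /L -map_comp; congr capK.
  by apply: eq_map => i /=; rewrite rs lD.
have L0 a : a \in L -> 0 < a.2.
  by move=> /mapP[i _ ->]; rewrite /D /sdisk /= divr_gt0.
rewrite -(capE _ _ dD) -(capE _ _ qD); apply: treelike_caps_le => //.
- apply: (@treelike_common_interior R L (0, 0)); first by rewrite -size_eq0 size_map size_enum_ord.
  by move=> a aL; rewrite /pw /= !mulr0 !expr0n/= !addr0 !add0r subr0 L0.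
- by move=> a /mapP[i _ ->]; rewrite qD.
- by move=> a b /mapP[i _ ->] /mapP[j _ ->]; rewrite !dD !qD.
Qed.

Lemma nu_cover_circles (R : realType) (s : seq (R * R * R * R)) (E : set (R * R * R)) :
  measurable E -> (forall t, t \in s -> dot t.1 t.1 = 1) ->
  (forall x, dot x x = 1 -> E x -> exists2 t, t \in s & dot x t.1 = t.2) -> nu E = 0.
Proof.
elim: s E => [|t s IH] E mE s1 Es.
  apply/eqP; rewrite eq_le nu_ge0 andbT.
  have <- : nu (circ (0, 0, 1) (0 : R)) = 0 by apply: nu_circ; rewrite /dot /=; ring.
  by apply: nu_le => //; [exact: measurable_capK|move=> x x1 /(Es x x1)[]].
have mc : measurable (circ t.1 t.2) by exact: measurable_capK.
rewrite (nu_split mE mc) (IH (E `\` circ t.1 t.2)) ?addr0.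
- apply/eqP; rewrite eq_le nu_ge0 andbT.
  have <- : nu (circ t.1 t.2) = 0 by apply: nu_circ; apply: s1; exact: mem_head.
  by apply: nu_le => //; [exact: measurableI|move=> x _ []].
- exact: measurableD.
- by move=> u us; apply: s1; rewrite inE us orbT.
- move=> x x1 [/(Es x x1)[u]]; rewrite inE => /predU1P[->|us] xu nx; last by exists u.
  by exfalso; apply: nx; apply/circP.
Qed.

Lemma refl_to (R : realType) (x y : R * R * R) : dot x x = 1 -> dot y y = 1 ->
  exists2 g : R * R * R -> R * R * R, g x = y &
    (forall u v, dot (g u) (g v) = dot u v) /\
    (forall F, nu (capK [seq (g t.1, t.2) | t <- F]) = nu (capK F)).
Proof.
move=> x1 y1; have [<-|xy] := eqVneq x y.
  exists id => //; split=> // F; congr (nu (capK _)); rewrite -[RHS]map_id.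
  by apply: eq_map => -[].
have [k k0] := refl_swap x1 y1 xy; set n := (X in let n := X in _) => -[n1 nxy].
by exists (refl n) => //; split=> [u v|F]; [exact: refl_isom|exact: nu_capK_refl].
Qed.

Lemma fcaps_le (R : realType) k (p q : 'I_k -> R * R * R) (c : 'I_k -> R) :
  (forall i, dot (p i) (p i) = 1) -> (forall i, dot (q i) (q i) = 1) ->
  (forall i j, dot (p i) (p j) <= dot (q i) (q j)) -> (forall i, 0 <= c i) ->
  nu (capK (fcaps p c)) <= nu (capK (fcaps q c)).
Proof.
move=> p1 q1 pq c0.
have [[x0 x01 x0c]|none] := pselect (exists2 x, dot x x = 1 & forall i, c i < dot x (p i)).
  pose z : R * R * R := (0, 0, - 1).
  have z1 : dot z z = 1 by rewrite /dot /=; ring.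
  have [g gx [giso gnu]] := refl_to x01 z1.
  have gp i : c i < - (g (p i)).2.
    suff -> : - (g (p i)).2 = dot x0 (p i) by [].
    by rewrite -(giso x0) gx /z /dot /=; ring.
  have -> : nu (capK (fcaps p c)) = nu (capK (fcaps (g \o p) c)).
    rewrite -gnu; congr (nu (capK _)); rewrite /fcaps -map_comp; exact: eq_map.
  apply: fcaps_le_south => // [i|i j|i|i]; rewrite /= ?giso//.
  (* Nonnegative levels put the antipode of the interior point outside every cap. *)
  - exact: ltr_wpDl (c0 i) (le_lt_trans (c0 i) (gp i)).
  - by rewrite opprD subr_gt0.
(* Without a common interior point, every point of the intersection lies on one of the boundary
   circles. *)
rewrite (@nu_cover_circles R (fcaps p c)) ?nu_ge0//.
- exact: measurable_capK.
- by move=> t /mapP[i _ ->]; exact: p1.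
move=> x x1 /fcapsP xp; apply: contrapT => nt; apply: none; exists x => // i.
rewrite lt_neqAle xp andbT; apply/eqP => e; apply: nt; exists (p i, c i) => //.
by apply/mapP; exists i; rewrite ?mem_enum.
Qed.

Definition cupK (R : realType) (F : seq (R * R * R * R)) : set (R * R * R) :=
  [set x | exists2 t, t \in F & t.2 <= dot x t.1].

Lemma measurable_cupK (R : realType) (F : seq (R * R * R * R)) : measurable (cupK F).
Proof.
elim: F => [|t F IH].
  by rewrite (_ : cupK _ = set0)//; apply/seteqP; split=> x // -[].
rewrite (_ : cupK (t :: F) = [set x | t.2 <= dot x t.1] `|` cupK F).
  by apply: measurableU => //; exact: measurable_half.
apply/seteqP; split=> x; first by move=> [u]; rewrite inE => /predU1P[->|uF] xu; [left|right; exists u].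
by move=> [xt|[u uF xu]]; [exists t => //; exact: mem_head|exists u => //; rewrite inE uF orbT].
Qed.

(** The closed caps opposite to those of [F] meet in the complement of the union, up to points of
    the boundary circles, which are null. *)
Lemma nu_cupK (R : realType) (F : seq (R * R * R * R)) :
  (forall t, t \in F -> dot t.1 t.1 = 1) ->
  nu (cupK F) = nu setT - nu (capK [seq (opp3 t.1, - t.2) | t <- F]).
Proof.
move=> F1; set G := map _ F; have mG := measurable_capK G; have mF := measurable_cupK F.
rewrite (nu_split mF mG) (nu_split measurableT mG) setTI setTD [RHS]addrC addKr.
have h x t : t \in F -> capK G x -> dot x t.1 <= t.2.
  move=> tF /(_ (opp3 t.1, - t.2)); rewrite /= dot_opp lerN2; apply.
  by apply/mapP; exists t.
rewrite (@nu_cover_circles R F (cupK F `&` capK G))//.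
- rewrite add0r; congr nu; apply/seteqP; split=> x; first by move=> [].
  move=> nx; split=> //; apply: contrapT => nF; apply: nx => u /mapP[t tF ->] /=.
  rewrite dot_opp lerN2 leNgt; apply/negP => xt; apply: nF; exists t => //; exact: ltW.
- exact: measurableI.
- move=> x _ [[t tF xt] xG]; exists t => //; apply/eqP.
  by rewrite eq_le xt (h x).
Qed.

(** * Spherical distance and area in terms of triples *)

Definition triple (R : realType) (x : sphere2 R) : R * R * R :=
  (val x 0 ord0, val x 0 (lift ord0 ord0), val x 0 (lift ord0 (lift ord0 ord0))).

Lemma dotv_triple (R : realType) (x y : sphere2 R) :
  dotv (val x) (val y) = dot (triple x) (triple y).
Proof. by rewrite /dotv !big_ord_recl big_ord0 addr0 addrA. Qed.

Lemma triple_unit (R : realType) (x : sphere2 R) : dot (triple x) (triple x) = 1.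
Proof. by rewrite -dotv_triple; apply/eqP; exact: (valP x). Qed.

Lemma triple_sph (R : realType) (t p : R) : triple (sph_point t p) = sphp t p.
Proof. by rewrite /triple /= !mxE. Qed.

Lemma dot_triple_itv (R : realType) (x y : sphere2 R) : -1 <= dot (triple x) (triple y) <= 1.
Proof.
rewrite -ler_norml -(ler_pXn2r (_ : 0 < 2)%N) ?nnegrE// expr1n real_normK ?num_real//.
by have := dot_CS (triple x) (triple y); rewrite !triple_unit mulr1.
Qed.

Lemma gdist_le (R : realType) (x y u v : sphere2 R) : gdist u v <= gdist x y ->
  dot (triple x) (triple y) <= dot (triple u) (triple v).
Proof.
have xy := dot_triple_itv x y; have uv := dot_triple_itv u v.
rewrite /gdist !dotv_triple !leNgt; apply: contraNN => h.
rewrite -ltr_cos ?in_itv/= ?acos_ge0 ?acos_lepi//.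
by rewrite !acosK ?in_itv/=.
Qed.

Lemma gballE (R : realType) (p x : sphere2 R) (r : R) : 0 < r -> r <= pi ->
  gball p r x <-> cos r <= dot (triple x) (triple p).
Proof.
move=> r0 rpi; have px := dot_triple_itv p x.
rewrite dotC /gball /= /gdist dotv_triple.
suff -> : (acos (dot (triple p) (triple x)) <= r) = (cos r <= dot (triple p) (triple x)) by [].
rewrite !leNgt; congr (~~ _).
by rewrite -ltr_cos ?in_itv/= ?acos_ge0 ?acos_lepi ?(ltW r0)// acosK ?in_itv/=.
Qed.

Lemma areaE (R : realType) (A : set (sphere2 R)) (E : set (R * R * R)) : measurable E ->
  (forall x, A x <-> E (triple x)) -> area A = (nu E)%:E.
Proof.
move=> mE AE; rewrite -sint_indic//; apply: eq_integral => z _; congr (_ * _)%:E.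
rewrite !indicE -triple_sph; congr (nat_of_bool _)%:R.
by apply/idP/idP; rewrite !inE => /AE.
Qed.

Theorem corollary1p4 (R : realType) (k : nat) (p q : 'I_k -> sphere2 R)
    (r : 'I_k -> R)
    (hr : forall i, 0 < r i)
    (hpq : forall i j, gdist (q i) (q j) <= gdist (p i) (p j)) :
  ((forall i, pi / 2 <= r i) ->
     (area (\bigcup_(i in [set: 'I_k]) gball (q i) (r i)) <=
      area (\bigcup_(i in [set: 'I_k]) gball (p i) (r i)))%E) /\
  ((forall i, r i <= pi / 2) ->
     (area (\bigcap_(i in [set: 'I_k]) gball (p i) (r i)) <=
      area (\bigcap_(i in [set: 'I_k]) gball (q i) (r i)))%E).
Proof.
have pi0 := pi_gt0 R.
have dpq i j := gdist_le (hpq i j).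
split=> hr2; last first.
  have E (s : 'I_k -> sphere2 R) : area (\bigcap_(i in [set: 'I_k]) gball (s i) (r i)) =
      (nu (capK (fcaps (@triple R \o s) (cos \o r))))%:E.
    have rpi i : r i <= pi by apply: le_trans (hr2 i) _; move: pi0; move: (pi : R) => a; lra.
    apply: areaE => [|x]; first exact: measurable_capK.
    split=> [h|/fcapsP h i _]; last by apply/gballE => //; exact: h.
    by apply/fcapsP => i; apply/gballE => //; exact: h.
  rewrite !E lee_fin; apply: fcaps_le => [i|i|i j|i] /=; rewrite ?triple_unit//.
  by apply: cos_ge0_pihalf; rewrite hr2 andbT (le_trans _ (ltW (hr i)))// oppr_le0 divr_ge0// ltW.
(* A radius of at least pi gives the whole sphere on both sides, and for smaller radii the cosine
   determines the cap. *)
have [[i0 ri0]|small] := pselect (exists i, pi <= r i).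
  have full (s : 'I_k -> sphere2 R) (x : sphere2 R) : (\bigcup_(i in [set: 'I_k]) gball (s i) (r i)) x.
    exists i0 => //; apply: le_trans ri0; rewrite /gdist dotv_triple acos_lepi//.
    exact: dot_triple_itv.
  suff -> : \bigcup_(i in [set: 'I_k]) gball (q i) (r i) =
      \bigcup_(i in [set: 'I_k]) gball (p i) (r i) by [].
  by apply/seteqP; split=> x _; exact: full.
have rpi i : r i < pi by rewrite ltNge; apply/negP => h; apply: small; exists i.
have E (s : 'I_k -> sphere2 R) : area (\bigcup_(i in [set: 'I_k]) gball (s i) (r i)) =
    (nu (cupK (fcaps (@triple R \o s) (cos \o r))))%:E.
  apply: areaE => [|x]; first exact: measurable_cupK.
  split=> [[i _ xi]|[_ /mapP[i _ ->] xi]].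
    exists (triple (s i), cos (r i)); first by apply/mapP; exists i; rewrite ?mem_enum.
    by apply/gballE => //; exact: ltW.
  by exists i => //; apply/gballE => //; exact: ltW.
have U (s : 'I_k -> sphere2 R) t : t \in fcaps (@triple R \o s) (cos \o r) -> dot t.1 t.1 = 1.
  by move=> /mapP[i _ ->]; exact: triple_unit.
have O (s : 'I_k -> sphere2 R) :
    [seq (opp3 t.1, - t.2) | t <- fcaps (@triple R \o s) (cos \o r)] =
    fcaps (@opp3 R \o (@triple R \o s)) (fun i => - cos (r i)).
  by rewrite /fcaps -map_comp.
have D (x y : R * R * R) : dot (opp3 x) (opp3 y) = dot x y by rewrite /opp3 /dot /=; ring.
rewrite !E lee_fin (nu_cupK (U p)) (nu_cupK (U q)) !O lerB//.
apply: fcaps_le => [i|i|i j|i] /=; rewrite ?D ?triple_unit//.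
(* The opposite cap has radius [pi - r i], at most [pi / 2], so its level [- cos (r i)] is
   nonnegative. *)
rewrite oppr_ge0 -(subrK pi (r i)) cosDpi oppr_le0; apply: cos_ge0_pihalf.
have := hr2 i; have := rpi i; have := pi0; move: (pi : R) (r i) => a b *; apply/andP; split; lra.
Qed.
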